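(* Let $H$ be a Hamiltonian on $n$ qubits, $\beta>0$, $\rho=e^{-\beta H}/\mathrm{Tr}[e^{-\beta H}]$, let $A^a$ be a Hermitian jump operator, and let $\mathcal L_a$ be the associated KMS-$\rho$-detailed-balanced Lindbladian (defined in the context). Then for every full-rank state $\sigma$, $$\mathsf{EP}_{\mathcal L_a}[\sigma]=\mathsf{FI}_a[\sigma\|\rho],$$ where $\mathsf{EP}_{\mathcal L_a}[\sigma]=-\mathrm{Tr}\big[\mathcal L_a[\sigma](\log\sigma-\log\rho)\big]$ and $$\mathsf{FI}_a[\sigma\|\rho]=\iint_{-\infty}^\infty\int_{-1/2}^{1/2}\Big\|\big[\hat A^a(\omega,t),\log\sigma-\log\rho\big]\Big\|_{\sigma,s}^2\,h_s(\omega)\,g_s(t)\,ds\,d\omega\,dt .$$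
   Context: $0<\kappa\le1/\beta$ is a Gaussian width. With $f(t)=e^{-\kappa^2t^2}\sqrt{\kappa\sqrt{2/\pi}}$, for an operator $A$ put $\hat A(\omega)=\frac1{\sqrt{2\pi}}\int_{-\infty}^\infty e^{iHt}Ae^{-iHt}e^{-i\omega t}f(t)\,dt$ and $\hat A(\omega,t)=e^{iHt}\hat A(\omega)e^{-iHt}$. With $\gamma(\omega)=\exp(-\beta\max(\omega+\beta\kappa^2/2,0))$, $$\mathcal L_a[X]=-i[C^a,X]+\int_{-\infty}^\infty\gamma(\omega)\Big(\hat A^a(\omega)X\hat A^a(\omega)^\dagger-\tfrac12\{\hat A^a(\omega)^\dagger\hat A^a(\omega),X\}\Big)d\omega,$$ $C^a=\iint\gamma(\omega)c(t)\,\hat A^a(\omega,t)^\dagger\hat A^a(\omega,t)\,dt\,d\omega$, $c(t)=\frac1{\beta\sinh(2\pi t/\beta)}$ (principal value at $t=0$). $\mathcal L_a^\dagger$ is self-adjoint for $\langle X,Y\rangle_\rho=\mathrm{Tr}[X^\dagger\rho^{1/2}Y\rho^{1/2}]$. Weighted norm: $\|X\|_{\sigma,s}^2=\mathrm{Tr}[X^\dagger\sigma^{\frac12+s}X\sigma^{\frac12-s}]$. Filters, for $s\in(-\frac12,\frac12)$: $h(\omega)=e^{-\kappa^2\beta^2/8}e^{-\beta|\omega|/2}$, $$h_s(\omega)=\exp\Big(\frac{s\beta(2\omega-s\beta\kappa^2)}2\Big)h(\omega-s\beta\kappa^2),\qquad g_s(t)=\frac2\beta\,\frac{\cos(s\pi)\cosh(2\pi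 t/\beta)}{\cosh(4\pi t/\beta)+\cos(2s\pi)}.$$ *)

(* Defs.v *)
From HB Require Import structures.
From mathcomp Require Import all_boot all_order all_algebra.
From mathcomp Require Import spectral sesquilinear.
From mathcomp Require Import all_classical all_reals all_analysis.
From mathcomp Require Import complex.

Set Implicit Arguments.
Unset Strict Implicit.
Unset Printing Implicit Defensive.

Import Order.TTheory GRing.Theory Num.Theory.
Import numFieldNormedType.Exports.

Local Open Scope classical_set_scope.
Local Open Scope ring_scope.
Local Open Scope sesquilinear_scope.
Local Open Scope complex_scope.

Definition sinh (R : realType) (x : R) : R := (expR x - expR (- x)) / 2.
Definition cosh (R : realType) (x : R) : R := (expR x + expR (- x)) / 2.

Definition expi (R : realType) (x : R) : R[i] := cos x +i* sin x.

(* Functional calculus: sum_k f(x_k) |k><k| for the spectral decomposition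
   A = sum_k x_k |k><k| of a Hermitian A.  The library's spectral_diag lives
   in R[i]; the eigenvalues of a Hermitian matrix being real, Re is harmless.
   The value is meaningless if A is not Hermitian. *)
Definition hermfun (R : realType) (m : nat) (f : R -> R[i])
    (A : 'M[R[i]]_m) : 'M[R[i]]_m :=
  invmx (spectralmx A)
    *m diag_mx (map_mx (fun z => f (complex.Re z)) (spectral_diag A))
    *m spectralmx A.

Definition expmx (R : realType) (m : nat) (A : 'M[R[i]]_m) : 'M[R[i]]_m :=
  hermfun (fun x => (expR x)%:C) A.

Definition logmx (R : realType) (m : nat) (A : 'M[R[i]]_m) : 'M[R[i]]_m :=
  hermfun (fun x => (ln x)%:C) A.

Definition powmx (R : realType) (m : nat) (A : 'M[R[i]]_m) (a : R) :
    'M[R[i]]_m :=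
  hermfun (fun x => (x `^ a)%:C) A.

(* e^{iHt} *)
Definition propagator (R : realType) (m : nat) (H : 'M[R[i]]_m) (t : R) :
    'M[R[i]]_m :=
  hermfun (fun x => expi (x * t)) H.

Definition commx (R : realType) (m : nat) (X Y : 'M[R[i]]_m) : 'M[R[i]]_m :=
  X *m Y - Y *m X.

Definition acommx (R : realType) (m : nat) (X Y : 'M[R[i]]_m) : 'M[R[i]]_m :=
  X *m Y + Y *m X.

Definition mxintegral (R : realType) (m : nat) (D : set R)
    (F : R -> 'M[R[i]]_m) : 'M[R[i]]_m :=
  \matrix_(i, j)
    ((\int[@lebesgue_measure R]_(x in D) complex.Re (F x i j))
     +i* (\int[@lebesgue_measure R]_(x in D) complex.Im (F x i j))).

(* Cauchy principal value at 0 of the integral over the real line. *)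
Definition pvmxintegral (R : realType) (m : nat) (F : R -> 'M[R[i]]_m) :
    'M[R[i]]_m :=
  let cut e := mxintegral [set t : R | e < `|t|] F in
  \matrix_(i, j)
    (lim (complex.Re (cut e i j) @[e --> (0 : R)^'+])
     +i* lim (complex.Im (cut e i j) @[e --> (0 : R)^'+])).

Definition is_state (R : realType) (m : nat) (sigma : 'M[R[i]]_m) : Prop :=
  [/\ sigma \is hermsymmx,
      forall v : 'cV[R[i]]_m, 0 <= (v ^t* *m sigma *m v) 0 0
    & \tr sigma = 1].

Definition gibbs (R : realType) (m : nat) (beta : R) (H : 'M[R[i]]_m) :
    'M[R[i]]_m :=
  (\tr (expmx (- beta%:C *: H)))^-1 *: expmx (- beta%:C *: H).

Definition gaussian_filter (R : realType) (kappa t : R) : R :=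
  expR (- (kappa ^+ 2 * t ^+ 2)) * Num.sqrt (kappa * Num.sqrt (2 / pi)).

Definition jump_freq (R : realType) (m : nat) (kappa : R)
    (H A : 'M[R[i]]_m) (omega : R) : 'M[R[i]]_m :=
  ((Num.sqrt (2 * pi))^-1)%:C *:
    mxintegral setT (fun t =>
      (expi (- (omega * t)) * (gaussian_filter kappa t)%:C) *:
        (propagator H t *m A *m propagator H (- t))).

Definition jump_time (R : realType) (m : nat) (kappa : R)
    (H A : 'M[R[i]]_m) (omega t : R) : 'M[R[i]]_m :=
  propagator H t *m jump_freq kappa H A omega *m propagator H (- t).

Definition transition_weight (R : realType) (beta kappa omega : R) : R :=
  expR (- (beta * Num.max (omega + beta * kappa ^+ 2 / 2) 0)).

Definition coherent_kernel (R : realType) (beta t : R) : R :=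
  (beta * sinh (2 * pi * t / beta))^-1.

Definition coherent_term (R : realType) (m : nat) (beta kappa : R)
    (H A : 'M[R[i]]_m) : 'M[R[i]]_m :=
  mxintegral setT (fun omega =>
    pvmxintegral (fun t =>
      (transition_weight beta kappa omega * coherent_kernel beta t)%:C *:
        ((jump_time kappa H A omega t) ^t* *m jump_time kappa H A omega t))).

Definition lindbladian (R : realType) (m : nat) (beta kappa : R)
    (H A X : 'M[R[i]]_m) : 'M[R[i]]_m :=
  - (0 +i* 1) *: commx (coherent_term beta kappa H A) X
  + mxintegral setT (fun omega =>
      let Aw := jump_freq kappa H A omega in
      (transition_weight beta kappa omega)%:C *:
        (Aw *m X *m Aw ^t* - 2^-1 *: acommx (Aw ^t* *m Aw) X)).

Definition entropy_production (R : realType) (m : nat)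
    (L : 'M[R[i]]_m -> 'M[R[i]]_m) (rho sigma : 'M[R[i]]_m) : R[i] :=
  - \tr (L sigma *m (logmx sigma - logmx rho)).

Definition weighted_inner (R : realType) (m : nat) (sigma : 'M[R[i]]_m)
    (s : R) (X : 'M[R[i]]_m) : R[i] :=
  \tr (X ^t* *m powmx sigma (2^-1 + s) *m X *m powmx sigma (2^-1 - s)).

(* The trace is real and nonnegative: see weighted_innerE. *)
Definition weighted_normsq (R : realType) (m : nat) (sigma : 'M[R[i]]_m)
    (s : R) (X : 'M[R[i]]_m) : R :=
  complex.Re (weighted_inner sigma s X).

Definition filter_h (R : realType) (beta kappa omega : R) : R :=
  expR (- (kappa ^+ 2 * beta ^+ 2 / 8)) * expR (- (beta * `|omega| / 2)).

Definition filter_hs (R : realType) (beta kappa s omega : R) : R :=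
  expR (s * beta * (2 * omega - s * beta * kappa ^+ 2) / 2)
  * filter_h beta kappa (omega - s * beta * kappa ^+ 2).

Definition filter_gs (R : realType) (beta s t : R) : R :=
  2 / beta * (cos (s * pi) * cosh (2 * pi * t / beta)
              / (cosh (4 * pi * t / beta) + cos (2 * s * pi))).

(* The integrand is nonnegative, so the integral is taken in [0, +oo]. *)
Definition fisher_information (R : realType) (m : nat) (beta kappa : R)
    (H A sigma rho : 'M[R[i]]_m) : \bar R :=
  (\int[@lebesgue_measure R]_t
    \int[@lebesgue_measure R]_omega
      \int[@lebesgue_measure R]_(s in `](- 2^-1)%R, (2^-1)%R[)
        (weighted_normsq sigma s
           (commx (jump_time kappa H A omega t) (logmx sigma - logmx rho))
         * filter_hs beta kappa s omega * filter_gs beta s t)%:E)%E.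

Lemma weighted_innerE (R : realType) (m : nat) (sigma : 'M[R[i]]_m) (s : R)
    (X : 'M[R[i]]_m) :
  weighted_inner sigma s X = (weighted_normsq sigma s X)%:C
  /\ 0 <= weighted_normsq sigma s X.
Proof.
suff w0 : 0 <= weighted_inner sigma s X.
  move: w0; rewrite /weighted_normsq; case: weighted_inner => a b /=.
  by rewrite lecE /= => /andP[/eqP-> ->].
rewrite /weighted_inner /powmx /hermfun.
set U := spectralmx sigma; set V := invmx U.
have VE : V = U ^t* by rewrite /V invmx_unitary // spectral_unitarymx.
set D1 := diag_mx _; set D2 := diag_mx _.
rewrite !mulmxA mxtrace_mulC !mulmxA.
set Y := U *m X *m V.
have YE : Y ^t* = U *m X ^t* *m V.
  rewrite /Y VE !trmx_mul !map_mxM /= mulmxA; congr (_ *m _ *m _).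
  by apply/matrixP => i j; rewrite !mxE conjCK.
suff -> : \tr (U *m X^t* *m V *m D1 *m U *m X *m V *m D2)
        = \tr (Y ^t* *m D1 *m Y *m D2).
  rewrite /mxtrace; apply: sumr_ge0 => j _.
  rewrite mul_mx_diag mxE mulr_ge0 //; last first.
    by rewrite !mxE lecR powR_ge0.
  rewrite mxE; apply: sumr_ge0 => i _.
  rewrite mul_mx_diag !mxE mulrAC; apply: mulr_ge0; last by rewrite lecR powR_ge0.
  by rewrite mulrC mul_conjC_ge0.
by rewrite YE /Y !mulmxA.
Qed.

(* Main.v *)
Require Import Defs.
From mathcomp Require Import all_boot all_order all_algebra.
From mathcomp Require Import spectral sesquilinear.
From mathcomp Require Import all_classical all_reals all_analysis.
From mathcomp Require Import measurable_realfun gauss_integral complex ring lra.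

(** Write [A] as the sum of its Bohr components [a_p], indexed by pairs [p] of
    eigenvectors of [H] with energy difference [nu_p], so that
    [A(omega, t) = sum_p F(omega - nu_p) e^(i nu_p t) a_p] with [F] Gaussian.
    Every time and frequency integral then becomes scalar.  Completing the
    square, the weights [gamma] and [h_s] integrate against
    [F(omega - nu_p) F(omega - nu_q)] to exponential tilts of one symmetric
    weight [eta p q].  The Fourier transform of [g_s] is
    [cosh (s beta nu / 2) / (2 cosh (beta nu / 4))], the boundary value of a
    Cauchy-Riemann pair on a strip; letting the strip close up to [s = 1/2]
    gives the principal value sine transform [tanh (beta nu / 4) / 2] of [c].

    With [D = log sigma - log rho] one has
    [<i| [D, a_p] |j> = y <i| a_p |j>], [y = log x_i - log x_j + beta nu_p],
    in an eigenbasis of [sigma].  This factor [y] cancels the denominator of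
    [int e^(s y) ds] over [(-1/2, 1/2)], which turns the integrated norm of
    [[A(omega, t), D]] into traces without any power of [sigma].  Both sides are
    now sums over pairs [(p, q)] of traces of products of [a_q^*], [a_p],
    [sigma] and [D].  They agree after symmetrization under the swap
    [(p, q) -> (-q, -p)] coming from [A^* = A]. *)

Set Implicit Arguments.
Unset Strict Implicit.
Unset Printing Implicit Defensive.

Import Order.TTheory GRing.Theory Num.Theory.
Import numFieldNormedType.Exports.

Local Open Scope classical_set_scope.
Local Open Scope ring_scope.

(** * Integrals over the real line *)

(** No contour is shifted. Integration by parts turns the Cauchy-Riemann equations of
    [sech (b t + i th)] into the system [U' = m V], [V' = m U] in the strip variable [th], with
    [m = nu / b], for the cosine and sine transforms; [V] vanishes at [th = 0], so one constant
    [U 0] stays free. The edge of the strip fixes it: there the real part concentrates at [t = 0]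
    with mass [pi / b], whatever [nu] is. The edge value of [V] is the transform of [c], so [g_s]
    and [c] come out of one computation. The order of integration is a second obstacle: the Fisher
    information integrates [s] innermost, while the frequency and time integrals are computed at
    fixed [s]. The integrand is nonnegative, so Tonelli moves [s] outside, and finiteness is a
    result of the computation. With [u_p = e^(beta nu_p / 4)] the hyperbolic factors become rational
    in [u_p] and [u_q], and the swap inverts each [u]; what remains is field arithmetic on traces.
    The factor [y] is never divided by, so [y = 0] is no special case. *)

Section lebesgue_line.
Context {R : realType}.
Local Notation mu := (@lebesgue_measure R).

Lemma Rintegral_oppr (f : R -> R) : mu.-integrable setT (EFin \o f) ->
  \int[mu]_x f (- x) = \int[mu]_x f x.
Proof.
move=> intf; have mf := measurable_int _ intf.
(* Negation preserves Lebesgue measure. The pushforward formula is applied to nonnegative functions,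
   hence the split into positive and negative parts below. *)
have pos (g : R -> \bar R) : measurable_fun setT g -> (forall x, 0 <= g x)%E ->
    (\int[mu]_x g (- x)%R = \int[mu]_x g x)%E.
  move=> mg g0.
  rewrite -[LHS](@ge0_integral_pushforward _ _ _ _ _ (-%R : measurableTypeR R -> measurableTypeR R) _ mu setT g)//.
  by apply: eq_measure_integral => //= A mA _; exact: lebesgue_measureN.
rewrite /Rintegral; congr fine; rewrite integralE [RHS]integralE.
congr (_ - _)%E.
- apply: etrans (pos _ (measurable_funepos mf) _) => //.
  by apply: eq_integral => x _; rewrite unlock.
- apply: etrans (pos _ (measurable_funeneg mf) _) => //.
  by apply: eq_integral => x _; rewrite unlock.
Qed.

Lemma Rintegral_odd (f : R -> R) : mu.-integrable setT (EFin \o f) ->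
  (forall x, f (- x) = - f x) -> \int[mu]_x f x = 0.
Proof.
move=> intf fN; have := Rintegral_oppr intf.
under eq_Rintegral do rewrite fN -mulN1r.
rewrite RintegralZl//; lra.
Qed.

Lemma ge0_integral_translation (g : R -> R) (c : R) :
  measurable_fun setT g -> (forall x, 0 <= g x) ->
  (\int[mu]_x (g (x - c))%:E = \int[mu]_x (g x)%:E)%E.
Proof.
move=> mg g0; pose phi : measurableTypeR R -> measurableTypeR R := fun x => x - c.
have mphi : measurable_fun setT phi by apply: measurable_funB.
rewrite -[LHS](ge0_integral_pushforward mphi mu measurableT (f := EFin \o g))//; last 2 first.
- exact/measurable_EFinP.
- by move=> y _; rewrite lee_fin.
apply: eq_measure_integral => A mA _.
(* Translation invariance only has to be checked on the intervals []a, b]], which determine the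
   measure. *)
apply/esym/lebesgue_measure_unique => //= _ [[a b]] _ <-.
rewrite /pushforward (_ : phi @^-1` _ = `]a + c, b + c]%classic); last first.
  by apply/seteqP; split => x /=; rewrite /phi !in_itv/= ltrBrDr lerBlDr.
rewrite !lebesgue_measure_itv/= !lte_fin ltrD2r; case: ifPn => // _.
by rewrite -!EFinB; congr EFin; ring.
Qed.

Lemma cvg_integral_symitv (f : R -> R) : mu.-integrable setT (EFin \o f) ->
  (\int[mu]_(x in `[(- n%:R)%R, n%:R%R]) (f x)%:E @[n --> \oo] --> \int[mu]_x (f x)%:E)%E.
Proof.
move=> intf; have mf := measurable_int _ intf.
pose g n : R -> \bar R := (EFin \o f) \_ (`[- n%:R, n%:R]%classic : set R).
rewrite [X in X @ _ --> _](_ : _ = fun n => \int[mu]_x g n x)%E; last first.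
  by apply/funext => n; rewrite integral_mkcond.
have [|||||_ _] // := @dominated_convergence _ _ _ mu setT measurableT
  g (EFin \o f) (abse \o (EFin \o f)).
- move=> n; apply: (measurable_restrictT _ _).1 => //; exact: measurable_funTS.
- apply/aeW => x _; apply: cvg_near_cst; near=> n.
  rewrite /g patchE ifT// inE/= in_itv/= -ler_norml.
  near: n; exact: nbhs_infty_ger.
- exact: integrable_abse.
- apply/aeW => x n _; rewrite /g patchE; case: ifP => // _.
  by rewrite abse0 /= lee_fin.
Unshelve. all: by end_near. Qed.

Lemma ge0_cvg_integral_symitv (f : R -> R) : measurable_fun setT f ->
  (forall x, 0 <= f x) ->
  (\int[mu]_(x in `[(- n%:R)%R, n%:R%R]) (f x)%:E @[n --> \oo] --> \int[mu]_x (f x)%:E)%E.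
Proof.
move=> mf f0.
pose g n : R -> \bar R := (EFin \o f) \_ (`[- n%:R, n%:R]%classic : set R).
rewrite [X in X @ _ --> _](_ : _ = fun n => \int[mu]_x g n x)%E; last first.
  by apply/funext => n; rewrite integral_mkcond.
rewrite (_ : (\int[mu]_x (f x)%:E = \int[mu]_x (limn (g ^~ x)))%E); last first.
  apply: eq_integral => x _; apply/esym/cvg_lim => //.
  apply: cvg_near_cst; near=> n.
  rewrite /g patchE ifT// inE/= in_itv/= -ler_norml.
  near: n; exact: nbhs_infty_ger.
apply: cvg_monotone_convergence => //.
- move=> n; apply: (measurable_restrictT _ _).1 => //; apply: measurable_funTS.
  exact/measurable_EFinP.
- by move=> n x _; rewrite /g patchE; case: ifP => //= _; rewrite lee_fin.
- move=> x _ m n mn; rewrite /g !patchE.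
  case: ifPn => [|_]; last by case: ifPn => //= _; rewrite lee_fin.
  rewrite inE/= in_itv/= -ler_norml => xm; rewrite ifT//.
  by rewrite inE/= in_itv/= -ler_norml (le_trans xm)// ler_nat.
Unshelve. all: by end_near. Qed.

Lemma integral_symitv_FTC (f F : R -> R) (n : nat) : continuous f ->
  (forall x : R, is_derive x 1 F (f x)) ->
  (\int[mu]_(x in `[(- n%:R)%R, n%:R%R]) (f x)%:E = (F n%:R - F (- n%:R))%:E)%E.
Proof.
move=> cf dF; case: n => [|n].
  by rewrite oppr0 set_itv1 integral_set1 subrr.
have cF : continuous F.
  by move=> x; apply/differentiable_continuous/derivable1_diffP; case: (dF x).
rewrite (continuous_FTC2 (F := F))//.
- by rewrite (lt_trans (y := 0))// ?oppr_lt0 ltr0n.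
- by apply: continuous_subspaceT => x; exact: cf.
- split.
  + by move=> x _; case: (dF x).
  + by apply: cvg_at_right_filter; exact: cF.
  + by apply: cvg_at_left_filter; exact: cF.
- by move=> x _; rewrite derive1E; case: (dF x).
Qed.

(** Monotone convergence over the intervals from [-n] to [n] takes the place of an integrability
    assumption; finite limits of the primitive then yield integrability itself, in
    [integrable_line_FTC]. *)
Lemma ge0_integral_line_FTC (f F : R -> R) (l l' : R) : continuous f ->
  (forall x, 0 <= f x) -> (forall x : R, is_derive x 1 F (f x)) ->
  F n%:R @[n --> \oo] --> l -> F (- n%:R) @[n --> \oo] --> l' ->
  (\int[mu]_x (f x)%:E = (l - l')%:E)%E.
Proof.
move=> cf f0 dF Fl Fl'.
have := ge0_cvg_integral_symitv (continuous_measurable_fun cf) f0.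
under [X in X @ _ --> _]eq_fun do rewrite (integral_symitv_FTC _ cf dF).
move=> /cvg_lim <-//; apply/cvg_lim => //.
by apply: cvg_EFin; [exact: nearW | apply: cvgB].
Qed.

Lemma integrable_line_FTC (f F : R -> R) (l l' : R) : continuous f ->
  (forall x, 0 <= f x) -> (forall x : R, is_derive x 1 F (f x)) ->
  F n%:R @[n --> \oo] --> l -> F (- n%:R) @[n --> \oo] --> l' ->
  mu.-integrable setT (EFin \o f).
Proof.
move=> cf f0 dF Fl Fl'; apply/integrableP; split.
  by apply/measurable_EFinP; exact: continuous_measurable_fun cf.
under eq_integral do rewrite /= ger0_norm//.
by rewrite (ge0_integral_line_FTC cf f0 dF Fl Fl') ltry.
Qed.

Lemma Rintegral_line_FTC (f F : R -> R) (l l' : R) : continuous f ->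
  mu.-integrable setT (EFin \o f) -> (forall x : R, is_derive x 1 F (f x)) ->
  F n%:R @[n --> \oo] --> l -> F (- n%:R) @[n --> \oo] --> l' ->
  \int[mu]_x f x = l - l'.
Proof.
move=> cf intf dF Fl Fl'; rewrite /Rintegral.
have := cvg_integral_symitv intf.
under [X in X @ _ --> _]eq_fun do rewrite (integral_symitv_FTC _ cf dF).
move=> /cvg_lim <-//; have -> // : limn (fun n : nat => (F n%:R - F (- n%:R))%:E) = (l - l')%:E.
apply/cvg_lim => //.
by apply: cvg_EFin; [exact: nearW | apply: cvgB].
Qed.

(** Packages differentiation under the integral sign as one [is_derive] fact, so that derivability
    and the value of the derivative travel together into the product and quotient rules. *)
Lemma is_derive_Rintegral (f df : R -> R -> R) (u v a : R) (G : R -> R) :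
  u < a < v ->
  (forall x, u < x < v -> mu.-integrable setT (EFin \o f x)) ->
  (forall x y : R, u < x < v -> is_derive x 1 (f ^~ y) (df x y)) ->
  mu.-integrable setT (EFin \o G) ->
  (forall x y, u < x < v -> `|df x y| <= G y) ->
  is_derive a 1 (fun x => \int[mu]_y f x y) (\int[mu]_y df a y).
Proof.
move=> uav intf derf intG Gdf.
have d1 x y : u < x < v -> partial1of2 f x y = df x y.
  by move=> xuv; rewrite partial1of2E; case: (derf x y xuv).
have G0 y : 0 <= G y by apply: le_trans (Gdf a y uav).
have Ia : `]u, v[%classic a by rewrite /= in_itv.
have H1 x : `]u, v[%classic x -> mu.-integrable setT (EFin \o f x).
  by rewrite /= in_itv/=; exact: intf.
have H2 x y : `]u, v[%classic x -> [set: R] y -> derivable (f ^~ y) x 1.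
  by rewrite /= in_itv/= => xuv _; case: (derf x y xuv).
have H3 x y : `]u, v[%classic x -> [set: R] y -> `|partial1of2 f x y| <= G y.
  by rewrite /= in_itv/= => xuv _; rewrite d1//; exact: Gdf.
apply: DeriveDef.
  exact: (derivable_under_integral measurableT Ia H1 H2 G0 intG H3).
rewrite -derive1E (differentiation_under_integral measurableT Ia H1 H2 G0 intG H3).
by apply: eq_Rintegral => y _; rewrite d1.
Qed.

End lebesgue_line.

(** * Derivatives, bounds and limits for hyperbolic and trigonometric functions *)

Section calculus.
Context {R : realType}.
Implicit Types (f g : R -> R) (x y t a b c : R).

Lemma is_derive1_mul f g x df dg : is_derive x 1 f df -> is_derive x 1 g dg ->
  is_derive x 1 (fun t => f t * g t) (df * g x + f x * dg).
Proof.
move=> Df Dg; apply: (is_derive_eq (is_deriveM Df Dg)).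
by rewrite /GRing.scale/=; ring.
Qed.

Lemma is_derive1_inv f x df : f x != 0 -> is_derive x 1 f df ->
  is_derive x 1 (fun t => (f t)^-1) (- df / f x ^+ 2).
Proof.
move=> fx0 Df; apply: (is_derive_eq (is_deriveV fx0 Df)).
by rewrite /GRing.scale/=; field.
Qed.

Lemma is_derive1_div f g x df dg : g x != 0 ->
  is_derive x 1 f df -> is_derive x 1 g dg ->
  is_derive x 1 (fun t => f t / g t) ((df * g x - f x * dg) / g x ^+ 2).
Proof.
move=> gx0 Df Dg; apply: (is_derive_eq (is_derive1_mul Df (is_derive1_inv gx0 Dg))).
by field.
Qed.

Lemma is_derive1_cst c x : is_derive x 1 (fun=> c) 0.
Proof. exact: is_derive_cst. Qed.

Lemma is_derive1_add f g x df dg : is_derive x 1 f df -> is_derive x 1 g dg ->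
  is_derive x 1 (fun t => f t + g t) (df + dg).
Proof. by move=> Df Dg; exact: is_deriveD. Qed.

Lemma is_derive1_opp f x df : is_derive x 1 f df ->
  is_derive x 1 (fun t => - f t) (- df).
Proof. by move=> Df; exact: is_deriveN. Qed.

Lemma is_derive1_sub f g x df dg : is_derive x 1 f df -> is_derive x 1 g dg ->
  is_derive x 1 (fun t => f t - g t) (df - dg).
Proof. by move=> Df Dg; exact: is_deriveB. Qed.

Lemma is_derive1_sqr f x df : is_derive x 1 f df ->
  is_derive x 1 (fun t => f t ^+ 2) (2 * f x * df).
Proof.
move=> Df; apply: (is_derive_eq (is_derive1_mul Df Df)); ring.
Qed.

Lemma is_derive1_compose f g x df dg : is_derive (g x) 1 f df ->
  is_derive x 1 g dg -> is_derive x 1 (fun t => f (g t)) (df * dg).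
Proof. by move=> Df Dg; exact: is_derive1_comp. Qed.

Lemma is_derive1_scale f b x df : is_derive (b * x) 1 f df ->
  is_derive x 1 (fun t => f (b * t)) (b * df).
Proof.
move=> Df; have D : is_derive x 1 (fun t => b * t) b.
  apply: (is_derive_eq (is_derive1_mul (is_derive1_cst b x) (is_derive_id x 1))).
  by rewrite mul0r add0r mulr1.
by apply: (is_derive_eq (is_derive1_comp Df D)); rewrite mulrC.
Qed.

Lemma is_derive1_expRN x : is_derive x 1 (fun t => expR (- t)) (- expR (- x)).
Proof.
apply: (is_derive_eq (is_derive1_comp (is_derive_expR (- x)) (is_deriveNid x 1))).
by rewrite mulrN1.
Qed.

Lemma is_derive1_sinh x : is_derive x 1 (@sinh R) (cosh x).
Proof.
apply: (is_derive_eq (is_derive1_mul (is_derive1_sub (is_derive_expR x)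
  (is_derive1_expRN x)) (is_derive1_cst 2^-1 x))).
by rewrite /cosh mulr0 addr0 opprK.
Qed.

Lemma is_derive1_cosh x : is_derive x 1 (@cosh R) (sinh x).
Proof.
apply: (is_derive_eq (is_derive1_mul (is_derive1_add (is_derive_expR x)
  (is_derive1_expRN x)) (is_derive1_cst 2^-1 x))).
by rewrite /sinh mulr0 addr0.
Qed.

Lemma is_derive1_continuous f (df : R -> R) :
  (forall x, is_derive x 1 f (df x)) -> continuous f.
Proof.
by move=> D x; apply/differentiable_continuous/derivable1_diffP; case: (D x).
Qed.

(** The position of [c] is not recorded, because the derivatives it is applied to have global
    bounds: [cosh >= 1] and [|cos| <= 1]. *)
Lemma MVT_origin f (df : R -> R) x : (forall y, is_derive y 1 f (df y)) ->
  exists c, f x - f 0 = df c * x.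
Proof.
move=> D; have cf := is_derive1_continuous D.
have [x0|x0|->] := ltgtP x 0; last by exists 0; rewrite subrr mulr0.
- have [|c _ E] := @MVT R f df x 0 x0 (fun y _ => D y).
    by apply: continuous_subspaceT => y; exact: cf.
  by exists c; lra.
- have [|c _ E] := @MVT R f df 0 x x0 (fun y _ => D y).
    by apply: continuous_subspaceT => y; exact: cf.
  by exists c; lra.
Qed.

Lemma le_of_sqr_le x y : 0 <= y -> x ^+ 2 <= y ^+ 2 -> x <= y.
Proof. by move=> y0; case: (lerP x y) => // xy; nra. Qed.

Lemma cosh_sinh x : cosh x ^+ 2 = 1 + sinh x ^+ 2.
Proof.
have e : expR x * expR (- x) = 1 by rewrite -expRD subrr expR0.
rewrite /cosh /sinh; move: e; set u := expR x; set v := expR (- x) => e.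
have -> : ((u + v) / 2) ^+ 2 = u * v + ((u - v) / 2) ^+ 2 by field.
by rewrite e.
Qed.

Lemma cosh_gt0 x : 0 < cosh x.
Proof. by rewrite divr_gt0// addr_gt0// expR_gt0. Qed.

Lemma cosh_ge1 x : 1 <= cosh x.
Proof.
apply: le_of_sqr_le; first exact/ltW/cosh_gt0.
by rewrite expr1n cosh_sinh lerDl sqr_ge0.
Qed.

Lemma sinhN x : sinh (- x) = - sinh x.
Proof. by rewrite /sinh opprK; field. Qed.

Lemma coshN x : cosh (- x) = cosh x.
Proof. by rewrite /cosh opprK addrC. Qed.

Lemma sinh0 : sinh 0 = 0 :> R.
Proof. by rewrite /sinh oppr0 subrr mul0r. Qed.

Lemma cosh0 : cosh 0 = 1 :> R.
Proof. by rewrite /cosh oppr0 expR0; field. Qed.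

Lemma continuous_sinh : continuous (@sinh R).
Proof. exact: is_derive1_continuous is_derive1_sinh. Qed.

Lemma continuous_cosh : continuous (@cosh R).
Proof. exact: is_derive1_continuous is_derive1_cosh. Qed.

Lemma norm_sinh_ge x : `|x| <= `|sinh x|.
Proof.
have [c] := MVT_origin x is_derive1_sinh; rewrite sinh0 subr0 => ->.
by rewrite normrM ler_peMl// ger0_norm ?cosh_ge1// ltW// cosh_gt0.
Qed.

Lemma sinh_eq0 x : (sinh x == 0) = (x == 0).
Proof.
apply/idP/eqP => [/eqP s0|->]; last by rewrite sinh0.
by apply/eqP; rewrite -normr_le0 (le_trans (norm_sinh_ge x))// s0 normr0.
Qed.

Lemma norm_sin_le x : `|sin x| <= `|x|.
Proof.
have [c] := MVT_origin x (@is_derive_sin R); rewrite sin0 subr0 => ->.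
by rewrite normrM ler_piMl// ler_norml cos_geN1 cos_le1.
Qed.

Lemma cosh_le x : cosh x <= 1 + `|sinh x|.
Proof.
apply: le_of_sqr_le; first exact: addr_ge0.
rewrite cosh_sinh -[sinh x ^+ 2]real_normK ?num_real//.
have := normr_ge0 (sinh x); nra.
Qed.

Lemma sub1cos_le x : 1 - cos x <= x ^+ 2.
Proof.
have := ler_pM (normr_ge0 _) (normr_ge0 _) (norm_sin_le (x / 2)) (norm_sin_le (x / 2)).
have -> : cos x = 1 - 2 * sin (x / 2) ^+ 2.
  rewrite {1}(_ : x = x / 2 + x / 2); last by field.
  by rewrite cosD -!expr2 cos2sin2; ring.
rewrite -!expr2 !real_normK ?num_real//.
rewrite exprMn; have := sqr_ge0 x; set y := x ^+ 2; set z := sin _ ^+ 2; lra.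
Qed.

Lemma cosh_ge_norm x : `|x| <= 2 * cosh x.
Proof.
have := norm_sinh_ge x; have := cosh_sinh x; have := cosh_gt0 x => c0 cs sx.
have : `|sinh x| <= cosh x.
  apply: le_of_sqr_le; first exact: ltW.
  by rewrite real_normK ?num_real// cs lerDr.
by lra.
Qed.

(** Serves to kill the boundary terms of integrations by parts over the whole line. *)
Lemma decay_cvg0 f C : (forall t, `|f t| * `|t| <= C) ->
  (f n%:R @[n --> \oo] --> (0 : R)) /\ (f (- n%:R) @[n --> \oo] --> (0 : R)).
Proof.
move=> fC; have C0 : 0 <= C by apply: le_trans (fC 0); rewrite normr0 mulr0.
have H (s : R) : `|s| = 1 -> f (s * n%:R) @[n --> \oo] --> (0 : R).
  move=> s1; apply/cvgrPdist_lt => e e0; near=> n.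
  rewrite sub0r normrN -(@ltr_pM2r _ n%:R)//; last first.
    by near: n; exact: nbhs_infty_gtr.
  have := fC (s * n%:R); rewrite normrM s1 mul1r [`|n%:R|]ger0_norm// => /le_lt_trans -> //.
  rewrite mulrC -ltr_pdivrMr//; near: n; exact: nbhs_infty_gtr.
split; first by under eq_fun do rewrite -[X in f X]mul1r; apply: H; rewrite normr1.
by under eq_fun do rewrite -mulN1r; apply: H; rewrite normrN1.
Unshelve. all: by end_near. Qed.

Lemma continuous_mul f g : continuous f -> continuous g ->
  continuous (fun t => f t * g t).
Proof. by move=> cf cg x; exact: cvgM (cf x) (cg x). Qed.

Lemma continuous_add f g : continuous f -> continuous g ->
  continuous (fun t => f t + g t).
Proof. by move=> cf cg x; exact: cvgD (cf x) (cg x). Qed.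

Lemma continuous_sub f g : continuous f -> continuous g ->
  continuous (fun t => f t - g t).
Proof. by move=> cf cg x; exact: cvgB (cf x) (cg x). Qed.

Lemma continuous_inv f : continuous f -> (forall x, f x != 0) ->
  continuous (fun t => (f t)^-1).
Proof. by move=> cf f0 x; exact: cvgV (f0 x) (cf x). Qed.

Lemma continuous_scale f b : continuous f -> continuous (fun t => f (b * t)).
Proof.
move=> cf x; apply: (@continuous_comp _ _ _ ( *%R b) f); last exact: cf.
exact: mulrl_continuous.
Qed.

(** The inverse is discontinuous at 0; writing it as [f] times the square of [|f| ^ (-1)] reduces
    the claim to measurability of [powR]. At a zero of [f] both sides are 0 by convention. *)
Lemma measurable_fun_inv d (T : measurableType d) (f : T -> R) :
  measurable_fun setT f -> measurable_fun setT (fun z => (f z)^-1).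
Proof.
move=> mf; rewrite (_ : (fun z => _) = fun z => f z * (`|f z| `^ (-1)) ^+ 2).
  apply: measurable_funM => //; apply: measurable_funX.
  apply: (measurableT_comp (measurable_powR (-1))).
  exact: measurableT_comp.
apply/funext => z; rewrite powR_inv1// exprVn real_normK ?num_real//.
by have [->|f0] := eqVneq (f z) 0; [rewrite invr0 mul0r | field].
Qed.

End calculus.

(** * Fourier transform of the time filters *)

Section strip_kernel.
Context {R : realType} (b nu : R).
Hypothesis b0 : 0 < b.
Local Notation mu := (@lebesgue_measure R).
Implicit Types (th t x : R).

(** [strip_den] is the squared modulus of [cosh (b t + i th)], and [sech (b t + i th) = strip_re - i
    strip_im], holomorphic for [|th| < pi / 2]. The primed functions are the derivatives in [th];
    the derivatives in [t] are the same ones up to a factor [b] or [-b], which is the Cauchy-Riemann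
    system. *)
Definition strip_den th t : R := sinh (b * t) ^+ 2 + cos th ^+ 2.
Definition strip_re th t : R := cosh (b * t) * cos th / strip_den th t.
Definition strip_im th t : R := sinh (b * t) * sin th / strip_den th t.
Definition strip_re' th t : R :=
  cosh (b * t) * sin th * (cos th ^+ 2 - sinh (b * t) ^+ 2) / strip_den th t ^+ 2.
Definition strip_im' th t : R :=
  sinh (b * t) * cos th * (2 + sinh (b * t) ^+ 2 - cos th ^+ 2) / strip_den th t ^+ 2.

Lemma strip_den_gt0 th t : 0 < cos th -> 0 < strip_den th t.
Proof. by move=> c0; rewrite /strip_den ltr_wpDl// ?sqr_ge0// exprn_gt0. Qed.

Let den_neq0 th t : 0 < cos th -> strip_den th t != 0.
Proof. by move=> c0; rewrite gt_eqF// strip_den_gt0. Qed.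

Let dsinh t : is_derive t 1 (fun t => sinh (b * t)) (b * cosh (b * t)).
Proof. exact/is_derive1_scale/is_derive1_sinh. Qed.

Let dcosh t : is_derive t 1 (fun t => cosh (b * t)) (b * sinh (b * t)).
Proof. exact/is_derive1_scale/is_derive1_cosh. Qed.

Let dden t th : is_derive t 1 (strip_den th) (2 * sinh (b * t) * (b * cosh (b * t))).
Proof.
apply: (is_derive_eq (is_derive1_add (is_derive1_sqr (dsinh t)) (is_derive1_cst (cos th ^+ 2) t))).
by rewrite addr0.
Qed.

Let dden_th t th : is_derive th 1 (strip_den ^~ t) (- (2 * cos th * sin th)).
Proof.
apply: (is_derive_eq (is_derive1_add (is_derive1_cst (sinh (b * t) ^+ 2) th)
   (is_derive1_sqr (is_derive_cos th)))).
by rewrite add0r mulrN.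
Qed.

Lemma is_derive_strip_re th t : 0 < cos th ->
  is_derive t 1 (strip_re th) (- (b * strip_im' th t)).
Proof.
move=> c0; apply: (is_derive_eq (is_derive1_div (den_neq0 t c0)
  (is_derive1_mul (dcosh t) (is_derive1_cst (cos th) t)) (dden t th))).
rewrite /strip_im'; have := den_neq0 t c0; rewrite /strip_den => n0; field : (cosh_sinh (b * t)).
by rewrite n0.
Qed.

Lemma is_derive_strip_im th t : 0 < cos th ->
  is_derive t 1 (strip_im th) (b * strip_re' th t).
Proof.
move=> c0; apply: (is_derive_eq (is_derive1_div (den_neq0 t c0)
  (is_derive1_mul (dsinh t) (is_derive1_cst (sin th) t)) (dden t th))).
by rewrite /strip_re'; have := den_neq0 t c0; rewrite /strip_den => n0; field.
Qed.

Lemma is_derive_strip_re_th th t : 0 < cos th ->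
  is_derive th 1 (strip_re ^~ t) (strip_re' th t).
Proof.
move=> c0; rewrite /strip_re.
apply: (is_derive_eq (is_derive1_div (g := strip_den ^~ t) (den_neq0 t c0)
  (is_derive1_mul (is_derive1_cst (cosh (b * t)) th) (is_derive_cos th)) (dden_th t th))).
by rewrite /strip_re'; have := den_neq0 t c0; rewrite /strip_den => n0; field.
Qed.

Lemma is_derive_strip_im_th th t : 0 < cos th ->
  is_derive th 1 (strip_im ^~ t) (strip_im' th t).
Proof.
move=> c0; rewrite /strip_im.
apply: (is_derive_eq (is_derive1_div (g := strip_den ^~ t) (den_neq0 t c0)
  (is_derive1_mul (is_derive1_cst (sinh (b * t)) th) (is_derive_sin th)) (dden_th t th))).
rewrite /strip_im'; have := den_neq0 t c0; rewrite /strip_den => n0; field : (sin2cos2 th).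
by rewrite n0.
Qed.

Lemma ler_norm_div (n d K c : R) : 0 < d -> 0 < c -> `|n| * c <= K * d ->
  `|n / d| <= K / c.
Proof.
move=> d0 c0 H; rewrite normrM [`|d^-1|]gtr0_norm ?invr_gt0//.
by rewrite ler_pdivrMr// mulrAC ler_pdivlMr.
Qed.

Let sech t : R := (cosh (b * t))^-1.

Let sech_gt0 t : 0 < sech t. Proof. by rewrite invr_gt0 cosh_gt0. Qed.

Section strip_bounds.
Variables (th c0 : R).
Hypotheses (c00 : 0 < c0) (c0th : c0 <= cos th).
Variable t : R.
Let c := cosh (b * t).
Let s := sinh (b * t).
Let k := cos th.
Let cE : c ^+ 2 = 1 + s ^+ 2. Proof. exact: cosh_sinh. Qed.
Let cgt0 : 0 < c. Proof. exact: cosh_gt0. Qed.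
Let k0 : 0 < k. Proof. exact: lt_le_trans c0th. Qed.
Let k1 : k <= 1. Proof. exact: cos_le1. Qed.
Let k21 : k ^+ 2 <= 1. Proof. by rewrite exprn_ile1// ltW. Qed.
Let d := strip_den th t.
Let d0 : 0 < d. Proof. exact: strip_den_gt0. Qed.
(** The distance to the poles at [cos th = 0] enters here: [c0 <= k <= 1] gives
    [c0^2 (1 + s^2) <= s^2 + k^2]. The four bounds below reduce to this inequality or to its square,
    hence are uniform over all [th] with [cos th >= c0]. *)
Let dE : c ^+ 2 <= c0 ^- 2 * d.
Proof.
rewrite mulrC ler_pdivlMr ?exprn_gt0// cE /d /strip_den -/s -/k.
have h1 : c0 ^+ 2 <= k ^+ 2 by rewrite lerXn2r// nnegrE ltW.
have h2 : k ^+ 2 <= 1 by rewrite exprn_ile1// ltW.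
by have := sqr_ge0 s; nra.
Qed.
Let sc : `|s| <= c.
Proof.
by apply: le_of_sqr_le; [exact: ltW|rewrite real_normK ?num_real// cE; lra].
Qed.

Let sin1 : `|sin th| <= 1.
Proof. by rewrite ler_norml sin_geN1 sin_le1. Qed.
Let dE2 : (c ^+ 2) ^+ 2 <= c0 ^- 2 ^+ 2 * d ^+ 2.
Proof. by rewrite -exprMn lerXn2r// nnegrE ?sqr_ge0// mulr_ge0 ?invr_ge0 ?sqr_ge0// ltW. Qed.

Lemma strip_re_le : `|strip_re th t| <= c0 ^- 2 / cosh (b * t).
Proof.
apply: ler_norm_div => //; apply: le_trans dE; rewrite -/c -/k.
rewrite gtr0_norm; last exact: mulr_gt0.
by rewrite mulrAC -expr2 ler_piMr// sqr_ge0.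
Qed.

Lemma strip_im_le : `|strip_im th t| <= c0 ^- 2 / cosh (b * t).
Proof.
apply: ler_norm_div => //; apply: le_trans dE; rewrite -/c -/k.
rewrite normrM expr2 ler_pM2r// -[leRHS]mulr1; exact: ler_pM.
Qed.

Lemma strip_re'_le : `|strip_re' th t| <= c0 ^- 2 ^+ 2 / cosh (b * t).
Proof.
apply: ler_norm_div => //; first exact: exprn_gt0.
apply: le_trans dE2; rewrite -/c -/k -/s.
rewrite 2!normrM [`|c|]gtr0_norm//.
have h : `|k ^+ 2 - s ^+ 2| <= c ^+ 2.
  rewrite ler_norml cE; have := sqr_ge0 s; have := sqr_ge0 k; have := k21.
  by move=> *; apply/andP; split; lra.
have := ler_pM (normr_ge0 _) (normr_ge0 _) sin1 h; rewrite mul1r => h2.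
have := ler_wpM2l (sqr_ge0 c) h2.
by rewrite -expr2; lra.
Qed.

Lemma strip_im'_le : `|strip_im' th t| <= 2 * c0 ^- 2 ^+ 2 / cosh (b * t).
Proof.
apply: ler_norm_div => //; first exact: exprn_gt0.
have := dE2; rewrite -/c -/k -/s -/d.
rewrite 2!normrM [`|k|]gtr0_norm//.
have h : `|2 + s ^+ 2 - k ^+ 2| <= 2 * c ^+ 2.
  rewrite ler_norml cE; have := sqr_ge0 s; have := sqr_ge0 k; have := k21.
  by move=> *; apply/andP; split; lra.
have h1 : `|s| * k <= c by rewrite -[leRHS]mulr1; apply: ler_pM => //; exact: ltW.
have h0 : 0 <= `|s| * k by apply: mulr_ge0 => //; exact: ltW.
have := ler_wpM2r (ltW cgt0) (ler_pM h0 (normr_ge0 _) h1 h).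
by rewrite !expr2; lra.
Qed.

End strip_bounds.

Let ccosh : continuous (fun t => cosh (b * t)).
Proof. exact/continuous_scale/continuous_cosh. Qed.

Let csinh : continuous (fun t => sinh (b * t)).
Proof. exact/continuous_scale/continuous_sinh. Qed.

Lemma continuous_strip_den th : continuous (strip_den th).
Proof. exact: is_derive1_continuous (fun t => dden t th). Qed.

Lemma continuous_strip_re th : 0 < cos th -> continuous (strip_re th).
Proof. by move=> c0; exact: is_derive1_continuous (fun t => is_derive_strip_re t c0). Qed.

Lemma continuous_strip_im th : 0 < cos th -> continuous (strip_im th).
Proof. by move=> c0; exact: is_derive1_continuous (fun t => is_derive_strip_im t c0). Qed.

Let csqr (f : R -> R) : continuous f -> continuous (fun t => f t ^+ 2).
Proof. by move=> cf; exact: continuous_mul. Qed.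

Lemma continuous_strip_re' th : 0 < cos th -> continuous (strip_re' th).
Proof.
move=> c0; apply: continuous_mul.
  apply: continuous_mul; first by apply: continuous_mul => // x; exact: cvg_cst.
  by apply: continuous_sub; [move=> x; exact: cvg_cst|exact: csqr].
apply: continuous_inv; first exact/csqr/continuous_strip_den.
by move=> t; rewrite gt_eqF// exprn_gt0// strip_den_gt0.
Qed.

Lemma continuous_strip_im' th : 0 < cos th -> continuous (strip_im' th).
Proof.
move=> c0; apply: continuous_mul.
  apply: continuous_mul; first by apply: continuous_mul => // x; exact: cvg_cst.
  apply: continuous_sub; last by move=> x; exact: cvg_cst.
  by apply: continuous_add; [move=> x; exact: cvg_cst|exact: csqr].
apply: continuous_inv; first exact/csqr/continuous_strip_den.
by move=> t; rewrite gt_eqF// exprn_gt0// strip_den_gt0.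
Qed.

(** [atan (sinh (b t)) / b] is a primitive of [sech (b t)]; its limits at both ends give the total
    mass [pi / b]. *)
Lemma cvg_atan_sinh : atan (sinh (b * n%:R)) @[n --> \oo] --> (pi / 2 : R).
Proof.
apply: (@cvg_comp _ _ _ (fun n : nat => sinh (b * n%:R)) (@atan R)); last exact: cvgy_atan.
apply/cvgryPge => A; near=> n.
have bn0 : 0 <= b * n%:R by rewrite mulr_ge0// ltW.
have bs : b * n%:R <= sinh (b * n%:R).
  have := norm_sinh_ge (b * n%:R); rewrite ger0_norm//.
  by rewrite ger0_norm// /sinh divr_ge0// subr_ge0 ler_expR; lra.
by apply: le_trans bs; rewrite mulrC -ler_pdivrMr//; near: n; exact: nbhs_infty_ger.
Unshelve. all: by end_near. Qed.

Let datan_sinh t : is_derive t 1 (fun t => atan (sinh (b * t)) / b) (cosh (b * t))^-1.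
Proof.
have D := is_derive1_compose (f := @atan R) (g := fun t => sinh (b * t))
  (is_derive1_atan _) (dsinh t).
apply: (is_derive_eq (is_derive1_mul D (is_derive1_cst b^-1 t))).
rewrite mulr0 addr0 -cosh_sinh; have := cosh_gt0 (b * t) => c0.
by field; rewrite !gt_eqF.
Qed.

Let cvg_p : atan (sinh (b * n%:R)) / b @[n --> \oo] --> pi / 2 / b.
Proof. exact: cvgM cvg_atan_sinh (cvg_cst b^-1). Qed.

Let cvg_n : atan (sinh (b * - n%:R)) / b @[n --> \oo] --> - (pi / 2) / b.
Proof.
under eq_fun do rewrite mulrN sinhN atanN.
exact: cvgM (cvgN cvg_atan_sinh) (cvg_cst b^-1).
Qed.

Let csech : continuous (fun t => (cosh (b * t))^-1).
Proof. by apply: continuous_inv => // t; rewrite gt_eqF// cosh_gt0. Qed.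

Lemma integrable_sech : mu.-integrable setT (EFin \o (fun t => (cosh (b * t))^-1)).
Proof. by apply: (integrable_line_FTC csech _ datan_sinh cvg_p cvg_n) => t; exact/ltW/sech_gt0. Qed.

Lemma Rintegral_sech : \int[mu]_t (cosh (b * t))^-1 = pi / b.
Proof.
rewrite (Rintegral_line_FTC csech integrable_sech datan_sinh cvg_p cvg_n).
by field; rewrite gt_eqF.
Qed.

(** A multiple of [sech (b t)] is the common dominating function for every integrand on the strip;
    the companion [le_sech_decay] draws the vanishing boundary terms from the same bound. *)
Lemma le_sech_integrable (f : R -> R) K : measurable_fun setT f ->
  (forall t, `|f t| <= K / cosh (b * t)) -> mu.-integrable setT (EFin \o f).
Proof.
move=> mf fK; apply: (le_integrable measurableT _ _ (integrableZl measurableT K integrable_sech)).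
  exact/measurable_EFinP.
move=> t _ /=; rewrite lee_fin; apply: le_trans (fK t) _; exact: ler_norm.
Qed.

Lemma le_sech_decay (f : R -> R) K : (forall t, `|f t| <= K / cosh (b * t)) ->
  (f n%:R @[n --> \oo] --> (0 : R)) /\ (f (- n%:R) @[n --> \oo] --> (0 : R)).
Proof.
move=> fK; apply: (@decay_cvg0 _ _ (`|K| * (2 / b))) => t.
apply: le_trans (ler_wpM2r (normr_ge0 t) (fK t)) _.
apply: le_trans (_ : `|K| / cosh (b * t) * `|t| <= _).
  by apply: ler_wpM2r => //; apply: ler_wpM2r; [exact/ltW/sech_gt0|exact: ler_norm].
rewrite -mulrA; apply: ler_wpM2l => //.
rewrite mulrC ler_pdivrMr ?cosh_gt0// mulrAC ler_pdivlMr//.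
by have := cosh_ge_norm (b * t); rewrite normrM gtr0_norm// mulrC.
Qed.

End strip_kernel.

(** * The transforms as solutions of a linear system in the strip variable *)

Section strip_transform.
Context {R : realType} (b nu : R).
Hypothesis b0 : 0 < b.
Local Notation mu := (@lebesgue_measure R).
Implicit Types (th t x : R).

(** In [t], [strip_re] is even and [strip_im] is odd, so the Fourier transform of
    [sech (b t + i th)] at [nu] is [strip_cos + strip_sin]. *)
Definition strip_cos th : R := \int[mu]_t (strip_re b th t * cos (nu * t)).
Definition strip_sin th : R := \int[mu]_t (strip_im b th t * sin (nu * t)).

Let cos1 x : `|cos x| <= 1. Proof. exact: cos_max. Qed.
Let sin1 x : `|sin x| <= 1. Proof. by rewrite ler_norml sin_geN1 sin_le1. Qed.

Let ccos : continuous (fun t => cos (nu * t)).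
Proof. exact/continuous_scale/continuous_cos. Qed.

Let csin : continuous (fun t => sin (nu * t)).
Proof. exact/continuous_scale/continuous_sin. Qed.

Let ccst (c : R) : continuous (fun _ : R => c).
Proof. by move=> x; exact: cvg_cst. Qed.

Let normM1 (x y K : R) : `|x| <= K -> `|y| <= 1 -> `|x * y| <= K.
Proof.
by move=> xK y1; rewrite normrM -[leRHS]mulr1; apply: ler_pM.
Qed.

Let cos_gt0 th : - (pi / 2) < th < pi / 2 -> 0 < cos th.
Proof. by move=> h; apply: cos_gt0_pihalf. Qed.

Let cont_meas (f : R -> R) : continuous f -> measurable_fun setT f.
Proof. exact: continuous_measurable_fun. Qed.

Lemma integrable_strip_cos th : 0 < cos th ->
  mu.-integrable setT (EFin \o (fun t => strip_re b th t * cos (nu * t))).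
Proof.
move=> c0; apply: (le_sech_integrable b0).
  by apply: cont_meas; apply: continuous_mul => //; exact: continuous_strip_re.
by move=> t; apply: normM1 => //; exact: (strip_re_le _ c0 (lexx _)).
Qed.

Lemma integrable_strip_sin th : 0 < cos th ->
  mu.-integrable setT (EFin \o (fun t => strip_im b th t * sin (nu * t))).
Proof.
move=> c0; apply: (le_sech_integrable b0).
  by apply: cont_meas; apply: continuous_mul => //; exact: continuous_strip_im.
by move=> t; apply: normM1 => //; exact: (strip_im_le _ c0 (lexx _)).
Qed.

Let integrable_strip_cos' th : 0 < cos th ->
  mu.-integrable setT (EFin \o (fun t => strip_re' b th t * cos (nu * t))).
Proof.
move=> c0; apply: (le_sech_integrable b0).
  by apply: cont_meas; apply: continuous_mul => //; exact: continuous_strip_re'.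
by move=> t; apply: normM1 => //; exact: (strip_re'_le _ c0 (lexx _)).
Qed.

Let integrable_strip_sin' th : 0 < cos th ->
  mu.-integrable setT (EFin \o (fun t => strip_im' b th t * sin (nu * t))).
Proof.
move=> c0; apply: (le_sech_integrable b0).
  by apply: cont_meas; apply: continuous_mul => //; exact: continuous_strip_im'.
by move=> t; apply: normM1 => //; exact: (strip_im'_le _ c0 (lexx _)).
Qed.

Let dcos t : is_derive t 1 (fun t => cos (nu * t)) (nu * - sin (nu * t)).
Proof. exact: is_derive1_scale. Qed.

Let dsin t : is_derive t 1 (fun t => sin (nu * t)) (nu * cos (nu * t)).
Proof. exact: is_derive1_scale. Qed.

(* Cauchy-Riemann for sech(bt + i th), integrated by parts against cos(nu t) *)
Lemma strip_cos'E th : 0 < cos th ->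
  \int[mu]_t (strip_re' b th t * cos (nu * t)) = nu / b * strip_sin th.
Proof.
move=> c0.
have i1 := integrable_strip_cos' c0; have i2 := integrable_strip_sin c0.
have ib := integrableZl measurableT b i1; have inu := integrableZl measurableT nu i2.
have [l0 l1] : (strip_im b th n%:R * cos (nu * n%:R) @[n --> \oo] --> (0 : R)) /\
  (strip_im b th (- n%:R) * cos (nu * - n%:R) @[n --> \oo] --> (0 : R)).
  by apply: (le_sech_decay b0 (K := cos th ^- 2) (f := fun t => strip_im b th t * cos (nu * t))) => t;
    apply: normM1 => //; exact: (strip_im_le _ c0 (lexx _)).
have D t : is_derive t 1 (fun t => strip_im b th t * cos (nu * t))
   (b * (strip_re' b th t * cos (nu * t)) - nu * (strip_im b th t * sin (nu * t))).
  apply: (is_derive_eq (is_derive1_mul (is_derive_strip_im b t c0) (dcos t))); ring.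
have cD : continuous (fun t => b * (strip_re' b th t * cos (nu * t)) - nu * (strip_im b th t * sin (nu * t))).
  apply: continuous_sub; (apply: continuous_mul; first exact: ccst).
  - exact: continuous_mul (continuous_strip_re' c0) ccos.
  - exact: continuous_mul (continuous_strip_im c0) csin.
have := Rintegral_line_FTC cD (integrableB measurableT ib inu) D l0 l1.
rewrite RintegralB// !RintegralZl// subrr => /eqP; rewrite subr_eq0 => /eqP E.
by rewrite /strip_sin mulrAC -E mulrC mulKf// gt_eqF.
Qed.

Lemma strip_sin'E th : 0 < cos th ->
  \int[mu]_t (strip_im' b th t * sin (nu * t)) = nu / b * strip_cos th.
Proof.
move=> c0.
have i1 := integrable_strip_sin' c0; have i2 := integrable_strip_cos c0.
have ib := integrableZl measurableT b i1; have inu := integrableZl measurableT nu i2.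
have [l0 l1] : (strip_re b th n%:R * sin (nu * n%:R) @[n --> \oo] --> (0 : R)) /\
  (strip_re b th (- n%:R) * sin (nu * - n%:R) @[n --> \oo] --> (0 : R)).
  by apply: (le_sech_decay b0 (K := cos th ^- 2) (f := fun t => strip_re b th t * sin (nu * t))) => t;
    apply: normM1 => //; exact: (strip_re_le _ c0 (lexx _)).
have D t : is_derive t 1 (fun t => strip_re b th t * sin (nu * t))
   (nu * (strip_re b th t * cos (nu * t)) - b * (strip_im' b th t * sin (nu * t))).
  apply: (is_derive_eq (is_derive1_mul (is_derive_strip_re b t c0) (dsin t))); ring.
have cD : continuous (fun t => nu * (strip_re b th t * cos (nu * t)) - b * (strip_im' b th t * sin (nu * t))).
  apply: continuous_sub; (apply: continuous_mul; first exact: ccst).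
  - exact: continuous_mul (continuous_strip_re c0) ccos.
  - exact: continuous_mul (continuous_strip_im' c0) csin.
have := Rintegral_line_FTC cD (integrableB measurableT inu ib) D l0 l1.
rewrite RintegralB// !RintegralZl// subrr => /eqP; rewrite subr_eq0 => /eqP E.
by rewrite /strip_cos mulrAC E mulrC mulKf// gt_eqF.
Qed.

Let cos_le th th1 : `|th| <= th1 -> th1 < pi / 2 -> cos th1 <= cos th.
Proof.
move=> h h1; rewrite -(cos_norm th); have p0 := pi_gt0 R.
rewrite leNgt ltr_cos ?in_itv/=; first by rewrite -leNgt.
- by rewrite (le_trans _ h)//=; lra.
- by rewrite normr_ge0/=; lra.
Qed.

(** The midpoint between [|th|] and [pi / 2] leaves room around [th] while keeping [cos] away from
    0, which gives a dominating function valid on a whole neighbourhood of [th]. *)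
Let enlarge th : - (pi / 2) < th < pi / 2 ->
  exists th1, [/\ - th1 < th < th1, 0 < cos th1, th1 < pi / 2 &
    forall x, - th1 < x < th1 -> cos th1 <= cos x].
Proof.
move=> h; exists ((`|th| + pi / 2) / 2).
have p0 := pi_gt0 R; have : `|th| < pi / 2 by rewrite ltr_norml.
move=> h1; have h2 : (`|th| + pi / 2) / 2 < pi / 2 by lra.
have h3 := normr_ge0 th; split => //.
- by rewrite -ltr_norml; lra.
- by apply: cos_gt0; apply/andP; split; lra.
- by move=> x; rewrite -ltr_norml => /ltW h4; exact: cos_le.
Qed.

(** Differentiation under the integral produces the transform of [strip_re'], which the integration
    by parts in [strip_cos'E] has already traded for [strip_sin]. *)
Lemma is_derive_strip_cos th : - (pi / 2) < th < pi / 2 ->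
  is_derive th 1 strip_cos (nu / b * strip_sin th).
Proof.
move=> /[dup] hth /enlarge [th1 [h1 c1 _ cc]]; rewrite -strip_cos'E; last exact: cos_gt0.
pose K := cos th1 ^- 2 ^+ 2.
pose f x t := strip_re b x t * cos (nu * t).
pose df x t := strip_re' b x t * cos (nu * t).
have cx x : - th1 < x < th1 -> 0 < cos x by move=> hx; exact: lt_le_trans (cc _ hx).
have intf x : - th1 < x < th1 -> mu.-integrable setT (EFin \o f x).
  by move=> hx; exact: integrable_strip_cos (cx x hx).
have derf x y : - th1 < x < th1 -> is_derive x 1 (f ^~ y) (df x y).
  move=> hx.
  have D := is_derive1_mul (f := strip_re b ^~ y) (is_derive_strip_re_th b y (cx x hx))
    (is_derive1_cst (cos (nu * y)) x).
  by apply: (is_derive_eq D); rewrite mulr0 addr0.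
have intG : mu.-integrable setT (EFin \o (fun t => K / cosh (b * t))).
  exact: (integrableZl measurableT K (integrable_sech b0)).
have Gdf x y : - th1 < x < th1 -> `|df x y| <= K / cosh (b * y).
  by move=> hx; apply: normM1 => //; exact: (strip_re'_le _ c1 (cc _ hx)).
exact: (is_derive_Rintegral h1 intf derf intG Gdf).
Qed.

Lemma is_derive_strip_sin th : - (pi / 2) < th < pi / 2 ->
  is_derive th 1 strip_sin (nu / b * strip_cos th).
Proof.
move=> /[dup] hth /enlarge [th1 [h1 c1 _ cc]]; rewrite -strip_sin'E; last exact: cos_gt0.
pose K := 2 * cos th1 ^- 2 ^+ 2.
pose f x t := strip_im b x t * sin (nu * t).
pose df x t := strip_im' b x t * sin (nu * t).
have cx x : - th1 < x < th1 -> 0 < cos x by move=> hx; exact: lt_le_trans (cc _ hx).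
have intf x : - th1 < x < th1 -> mu.-integrable setT (EFin \o f x).
  by move=> hx; exact: integrable_strip_sin (cx x hx).
have derf x y : - th1 < x < th1 -> is_derive x 1 (f ^~ y) (df x y).
  move=> hx.
  have D := is_derive1_mul (f := strip_im b ^~ y) (is_derive_strip_im_th b y (cx x hx))
    (is_derive1_cst (sin (nu * y)) x).
  by apply: (is_derive_eq D); rewrite mulr0 addr0.
have intG : mu.-integrable setT (EFin \o (fun t => K / cosh (b * t))).
  exact: (integrableZl measurableT K (integrable_sech b0)).
have Gdf x y : - th1 < x < th1 -> `|df x y| <= K / cosh (b * y).
  by move=> hx; apply: normM1 => //; exact: (strip_im'_le _ c1 (cc _ hx)).
exact: (is_derive_Rintegral h1 intf derf intG Gdf).
Qed.

Lemma strip_sin0 : strip_sin 0 = 0.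
Proof.
rewrite /strip_sin; under eq_Rintegral do rewrite /strip_im sin0 mulr0 !mul0r.
by rewrite Rintegral_cst// mul0r.
Qed.

Lemma is_derive0_const (f : R -> R) (u v x : R) :
  u < 0 < v -> u < x < v ->
  (forall y, u < y < v -> is_derive y 1 f 0) -> f x = f 0.
Proof.
move=> /andP[u0 v0] /andP[ux xv] D.
have cf y : u < y < v -> {for y, continuous f}.
  by move=> /D Dy; apply/differentiable_continuous/derivable1_diffP; case: Dy.
have [x0|x0|->//] := ltgtP x 0.
- have Dx y : y \in `]x, 0[ -> is_derive y 1 f 0.
    by rewrite in_itv/= => /andP[? ?]; apply: D; apply/andP; split; lra.
  have [|c _ E] := MVT x0 Dx; last by lra.
  apply: continuous_in_subspaceT => y; rewrite inE/= in_itv/= => /andP[? ?].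
  by apply: cf; apply/andP; split; lra.
- have Dx y : y \in `]0, x[ -> is_derive y 1 f 0.
    by rewrite in_itv/= => /andP[? ?]; apply: D; apply/andP; split; lra.
  have [|c _ E] := MVT x0 Dx; last by lra.
  apply: continuous_in_subspaceT => y; rewrite inE/= in_itv/= => /andP[? ?].
  by apply: cf; apply/andP; split; lra.
Qed.

Lemma strip_transform_solution th : - (pi / 2) < th < pi / 2 ->
  strip_cos th = strip_cos 0 * cosh (nu / b * th) /\
  strip_sin th = strip_cos 0 * sinh (nu / b * th).
Proof.
move=> hth; set m := nu / b.
have dch x : is_derive x 1 (fun x => cosh (m * x)) (m * sinh (m * x)).
  exact/is_derive1_scale/is_derive1_cosh.
have dsh x : is_derive x 1 (fun x => sinh (m * x)) (m * cosh (m * x)).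
  exact/is_derive1_scale/is_derive1_sinh.
have p0 := pi_gt0 R.
have h0 : - (pi / 2) < (0 : R) < pi / 2 by apply/andP; split; lra.
(* [E] and [G] undo a hyperbolic rotation by [m x], hence are constant along the system; at 0 they
   equal [strip_cos 0] and 0. *)
pose E x := strip_cos x * cosh (m * x) - strip_sin x * sinh (m * x).
pose G x := strip_sin x * cosh (m * x) - strip_cos x * sinh (m * x).
have dE y : - (pi / 2) < y < pi / 2 -> is_derive y 1 E 0.
  move=> hy; apply: (is_derive_eq (is_derive1_sub
   (is_derive1_mul (is_derive_strip_cos hy) (dch y))
   (is_derive1_mul (is_derive_strip_sin hy) (dsh y)))); rewrite -/m; ring.
have dG y : - (pi / 2) < y < pi / 2 -> is_derive y 1 G 0.
  move=> hy; apply: (is_derive_eq (is_derive1_sub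
   (is_derive1_mul (is_derive_strip_sin hy) (dch y))
   (is_derive1_mul (is_derive_strip_cos hy) (dsh y)))); rewrite -/m; ring.
have := is_derive0_const h0 hth dE; have := is_derive0_const h0 hth dG.
rewrite /E /G mulr0 cosh0 sinh0 strip_sin0 !mulr0 !mulr1 !subr0.
set u := strip_cos th; set v := strip_sin th; set M := strip_cos 0.
have := cosh_sinh (m * th); set c := cosh _; set s := sinh _ => cs e1 e2.
have d1 : c ^+ 2 - s ^+ 2 = 1 by rewrite cs; ring.
split.
- transitivity (u * (c ^+ 2 - s ^+ 2)); first by rewrite d1 mulr1.
  by rewrite -e2 -[RHS]addr0 -(mul0r s) -e1; ring.
- transitivity (v * (c ^+ 2 - s ^+ 2)); first by rewrite d1 mulr1.
  by rewrite -e2 -[RHS]addr0 -(mul0r c) -e1; ring.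
Qed.

End strip_transform.

(** * Dominated convergence for sequences of real functions *)

Section dominated.
Context {R : realType}.
Local Notation mu := (@lebesgue_measure R).

Lemma Rintegral_dominated_cvg (f_ : nat -> R -> R) (f g : R -> R) :
  (forall n, measurable_fun setT (f_ n)) ->
  (forall x, f_ n x @[n --> \oo] --> f x) ->
  mu.-integrable setT (EFin \o g) -> (forall n x, `|f_ n x| <= g x) ->
  mu.-integrable setT (EFin \o f) /\
  \int[mu]_x f_ n x @[n --> \oo] --> \int[mu]_x f x.
Proof.
move=> mf_ f_f intg f_g.
have mf : measurable_fun setT f by apply: measurable_fun_cvg mf_ _ => x _; exact: f_f.
have [|||||int_f _ H] := @dominated_convergence _ _ _ mu setT measurableT
  (fun n => EFin \o f_ n) (EFin \o f) (EFin \o g).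
- by move=> n; apply/measurable_EFinP; exact: mf_.
- by apply/measurable_EFinP; exact: mf.
- apply/aeW => x _; apply: cvg_EFin; [exact: nearW|exact: f_f].
- exact: intg.
- by apply/aeW => x n _ /=; rewrite lee_fin.
split => //; apply: fine_cvg; rewrite fineK; first exact: H.
exact: integrable_fin_num.
Qed.

End dominated.

(** * Boundary values as the strip closes up *)

Section boundary_limit.
Context {R : realType} (b nu : R).
Hypothesis b0 : 0 < b.
Local Notation mu := (@lebesgue_measure R).
Implicit Types (th t x : R).

(** [harmonic n] is [1 / (n + 1)], so the sequence starts at 0 and increases to [pi / 2] inside the
    strip. *)
Let th_ (n : nat) : R := pi / 2 - pi / 2 * harmonic n.

Let th_int n : - (pi / 2) < th_ n < pi / 2.
Proof.
have h0 : 0 < (harmonic n : R) by rewrite /= invr_gt0.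
have h1 : (harmonic n : R) <= 1 by rewrite /= invf_le1// ler1n.
rewrite /th_; set h := harmonic n in h0 h1 *.
have p2 : 0 < pi / 2 :> R by rewrite divr_gt0// pi_gt0.
have := ler_wpM2l (ltW p2) h1; have := mulr_gt0 p2 h0.
by set y := pi / 2 * h; move=> *; apply/andP; split; lra.
Qed.

Let cos_th n : 0 < cos (th_ n). Proof. by apply: cos_gt0_pihalf; exact: th_int. Qed.

Let cvg_th : th_ n @[n --> \oo] --> pi / 2.
Proof.
rewrite -[X in _ --> X]subr0 -[X in _ - X](mulr0 (pi / 2)).
by apply: cvgB; [exact: cvg_cst|apply: cvgM; [exact: cvg_cst|exact: cvg_harmonic]].
Qed.

Let cvg_at (f : R -> R) : continuous f -> f (th_ n) @[n --> \oo] --> f (pi / 2).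
Proof. by move=> cf; apply: (cvg_comp _ _ cvg_th); exact: cf. Qed.

Let cvg_cos : cos (th_ n) @[n --> \oo] --> (0 : R).
Proof. by rewrite -(@cos_pihalf R); apply: cvg_at; exact: continuous_cos. Qed.

Let cvg_sin : sin (th_ n) @[n --> \oo] --> (1 : R).
Proof. by rewrite -(@sin_pihalf R); apply: cvg_at; exact: continuous_sin. Qed.

Let t_le t : `|t| <= `|sinh (b * t)| / b.
Proof.
by rewrite ler_pdivlMr// mulrC -[X in X * _](gtr0_norm b0) -normrM norm_sinh_ge.
Qed.

Let cvg_den t : strip_den b (th_ n) t @[n --> \oo] --> sinh (b * t) ^+ 2.
Proof.
rewrite -[X in _ --> X]addr0 -[X in _ + X](mulr0 0).
by apply: cvgD; [exact: cvg_cst|exact: cvgM cvg_cos cvg_cos].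
Qed.

Let sinh_neq0 t : t != 0 -> sinh (b * t) != 0.
Proof. by move=> t0; rewrite sinh_eq0 mulf_neq0// gt_eqF. Qed.

(** At the edge [strip_im] becomes [1 / sinh (b t)], whose pole at 0 is cancelled by [sin (nu t)].
    The constant [K] combines [cosh <= 1 + |sinh|] with [|sin (nu t)| <= |nu| |t| <= |nu| |sinh (b
    t)| / b], so the bound does not depend on [n]. *)
Lemma boundary_sin :
  mu.-integrable setT (EFin \o (fun t => sin (nu * t) / sinh (b * t))) /\
  strip_sin b nu (th_ n) @[n --> \oo] --> \int[mu]_t (sin (nu * t) / sinh (b * t)).
Proof.
pose K := `|nu| / b + 1.
apply: (@Rintegral_dominated_cvg _ _ _ (fun t => K / cosh (b * t))).
- move=> n; apply: continuous_measurable_fun; apply: continuous_mul.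
    exact: continuous_strip_im.
  exact/continuous_scale/continuous_sin.
- move=> t; have [->|t0] := eqVneq t 0.
    rewrite mulr0 sin0 mul0r; under eq_fun do rewrite mulr0.
    exact: cvg_cst.
  have s0 := sinh_neq0 t0.
  have -> : sin (nu * t) / sinh (b * t) = sinh (b * t) * 1 / sinh (b * t) ^+ 2 * sin (nu * t).
    by field.
  apply: cvgM; last exact: cvg_cst.
  apply: cvgM; first by apply: cvgM; [exact: cvg_cst|exact: cvg_sin].
  by apply: cvgV; [rewrite sqrf_eq0|exact: cvg_den].
- exact: (integrableZl measurableT K (integrable_sech b0)).
- move=> n t; rewrite /strip_im mulrAC.
  apply: ler_norm_div; [exact: strip_den_gt0|exact: cosh_gt0|].
  rewrite 2!normrM.
  have h1 : `|sin (th_ n)| <= 1 by rewrite ler_norml sin_geN1 sin_le1.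
  have h2 : `|sin (nu * t)| * cosh (b * t) <= K * `|sinh (b * t)|.
    apply: le_trans (ler_wpM2l (normr_ge0 _) (cosh_le (b * t))) _.
    rewrite mulrDr mulr1 /K mulrDl mul1r lerD//.
      apply: le_trans (norm_sin_le _) _; rewrite normrM mulrAC -mulrA.
      by apply: ler_wpM2l.
    by rewrite ler_piMl// ler_norml sin_geN1 sin_le1.
  have K0 : 0 <= K by rewrite addr_ge0// divr_ge0// ltW.
  apply: le_trans (_ : K * `|sinh (b * t)| ^+ 2 <= _); last first.
    rewrite real_normK ?num_real//; apply: ler_wpM2l => //.
    by rewrite lerDl sqr_ge0.
  rewrite expr2 mulrA.
  have := ler_pM (normr_ge0 (sinh (b * t))) (normr_ge0 _) (lexx `|sinh (b * t)|) h1.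
  rewrite mulr1 => h3.
  have := ler_pM (mulr_ge0 (normr_ge0 (sinh (b * t))) (normr_ge0 (sin (th_ n))))
     (mulr_ge0 (normr_ge0 (sin (nu * t))) (ltW (cosh_gt0 (b * t)))) h3 h2.
  lra.
Qed.

(** This is the case [nu = 0] of the system: both right-hand sides vanish, and the mass is the one
    of [sech] at [th = 0]. *)
Let strip_re_total th : - (pi / 2) < th < pi / 2 -> \int[mu]_t strip_re b th t = pi / b.
Proof.
move=> hth; have [E _] := strip_transform_solution 0 b0 hth.
have E0 x : \int[mu]_t strip_re b x t = strip_cos b 0 x.
  by apply: eq_Rintegral => t _; rewrite mul0r cos0 mulr1.
rewrite E0 E mul0r mul0r cosh0 mulr1 -(Rintegral_sech b0).
apply: eq_Rintegral => t _; rewrite mul0r cos0 mulr1 /strip_re /strip_den cos0.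
by rewrite mulr1 expr1n addrC -cosh_sinh; field; rewrite gt_eqF// cosh_gt0.
Qed.

Let int_re th : 0 < cos th -> mu.-integrable setT (EFin \o strip_re b th).
Proof.
move=> c0; have := integrable_strip_cos 0 b0 c0.
by apply: eq_integrable => // t _ /=; rewrite mul0r cos0 mulr1.
Qed.

(** The kernels [strip_re b (th_ n)] concentrate at 0 and have no common dominating function.
    Subtracting the constant mass leaves [1 - cos (nu t)], whose double zero tames the
    concentration; the difference then tends to 0 by dominated convergence. *)
Lemma boundary_cos : strip_cos b nu (th_ n) @[n --> \oo] --> pi / b.
Proof.
(* From [cosh^2 (1 - cos) = (1 - cos) + sinh^2 (1 - cos)]: the first summand is at most
   [nu^2 t^2 <= nu^2 sinh^2 / b^2], the second at most [2 sinh^2]. *)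
pose K := nu ^+ 2 / b ^+ 2 + 2.
pose f_ n t := strip_re b (th_ n) t * (1 - cos (nu * t)).
have cf_ n : continuous (f_ n).
  apply: continuous_mul; first exact: continuous_strip_re.
  apply: continuous_sub; first by move=> x; exact: cvg_cst.
  exact/continuous_scale/continuous_cos.
have f_K n t : `|f_ n t| <= K / cosh (b * t).
  rewrite /f_ /strip_re mulrAC.
  apply: ler_norm_div; [exact: strip_den_gt0|exact: cosh_gt0|].
  set c := cosh _; set k := cos (th_ n); set s := sinh (b * t).
  have k0 : 0 < k := cos_th n; have k1 : k <= 1 := cos_le1 _.
  have c0 : 0 < c := cosh_gt0 _.
  have u0 : 0 <= 1 - cos (nu * t) by rewrite subr_ge0 cos_le1.
  have u2 : 1 - cos (nu * t) <= 2 by have := cos_geN1 (nu * t); lra.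
  have u1 := sub1cos_le (nu * t).
  rewrite ger0_norm; last by apply: mulr_ge0 => //; apply: mulr_ge0; exact: ltW.
  have cE : c ^+ 2 = 1 + s ^+ 2 := cosh_sinh _.
  have ts : t ^+ 2 <= s ^+ 2 / b ^+ 2.
    have := ler_pM (normr_ge0 _) (normr_ge0 _) (t_le t) (t_le t).
    rewrite -!expr2 real_normK ?num_real// => /le_trans; apply.
    by rewrite expr_div_n real_normK ?num_real.
  have h1 : c ^+ 2 * (1 - cos (nu * t)) <= K * s ^+ 2.
    rewrite cE; have := ler_wpM2l (sqr_ge0 nu) ts; have := ler_wpM2l (sqr_ge0 s) u2.
    by rewrite exprMn in u1; rewrite /K; set B := (b ^+ 2)^-1; lra.
  have K0 : 0 <= K by rewrite addr_ge0// divr_ge0// sqr_ge0.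
  have h2 := ler_wpM2l K0 (_ : s ^+ 2 <= strip_den b (th_ n) t).
  apply: le_trans (h2 _); last by rewrite lerDl sqr_ge0.
  apply: le_trans h1.
  have := ler_wpM2l (mulr_ge0 (sqr_ge0 c) u0) k1.
  by rewrite mulr1; lra.
have lim0 : \int[mu]_t f_ n t @[n --> \oo] --> \int[mu]_t (0 : R).
  suff [] : mu.-integrable setT (EFin \o (fun _ : R => 0 : R)) /\
    \int[mu]_t f_ n t @[n --> \oo] --> \int[mu]_t (0 : R) by [].
  apply: (Rintegral_dominated_cvg (f := fun=> 0) (g := fun t => K / cosh (b * t))).
  - by move=> n; exact: continuous_measurable_fun.
  - move=> t; have [->|t0] := eqVneq t 0.
      by rewrite /f_; under eq_fun do rewrite mulr0 cos0 subrr mulr0; exact: cvg_cst.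
    have s0 := sinh_neq0 t0.
    rewrite -[X in _ --> X](mul0r (1 - cos (nu * t))).
    apply: cvgM; last exact: cvg_cst.
    rewrite -[X in _ --> X](mul0r (sinh (b * t) ^+ 2)^-1).
    apply: cvgM; last by apply: cvgV; [rewrite sqrf_eq0|exact: cvg_den].
    rewrite -[X in _ --> X](mulr0 (cosh (b * t))).
    by apply: cvgM; [exact: cvg_cst|exact: cvg_cos].
  - exact: (integrableZl measurableT K (integrable_sech b0)).
  - exact: f_K.
have E n : strip_cos b nu (th_ n) = pi / b - \int[mu]_t f_ n t.
  rewrite -(strip_re_total (th_int n)) -RintegralB//.
  - by apply: eq_Rintegral => t _; rewrite /f_; ring.
  - exact: int_re.
  - by apply: (le_sech_integrable b0 _ (f_K n)); exact: continuous_measurable_fun.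
under eq_fun do rewrite E.
move: lim0; rewrite Rintegral_cst// mul0r => lim0.
have L : pi / b - \int[mu]_t f_ n t @[n --> \oo] --> pi / b - 0.
  exact: cvgB (cvg_cst _) lim0.
by rewrite subr0 in L.
Qed.

Let m := nu / b * (pi / 2).

Let lim_uniq (f : nat -> R) (x y : R) :
  f n @[n --> \oo] --> x -> f n @[n --> \oo] --> y -> x = y.
Proof. by move=> fx fy; exact: (cvg_unique _ fx fy). Qed.

(** Two computations of one limit: the explicit solution tends to [strip_cos 0 * cosh m], while
    concentration gives [pi / b]. *)
Lemma strip_cos0E : strip_cos b nu 0 = pi / b / cosh m.
Proof.
have := boundary_cos.
under eq_fun do rewrite (strip_transform_solution nu b0 (th_int _)).1.
have : strip_cos b nu 0 * cosh (nu / b * th_ n) @[n --> \oo] --> strip_cos b nu 0 * cosh m.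
  apply: cvgM; first exact: cvg_cst.
  by apply: (cvg_at (f := fun x => cosh (nu / b * x))); exact/continuous_scale/continuous_cosh.
move=> /lim_uniq/[apply] <-.
by rewrite mulfK// gt_eqF// cosh_gt0.
Qed.

Lemma Rintegral_sin_sinh :
  \int[mu]_t (sin (nu * t) / sinh (b * t)) = pi / b * (sinh m / cosh m).
Proof.
have [_] := boundary_sin.
under eq_fun do rewrite (strip_transform_solution nu b0 (th_int _)).2.
have : strip_cos b nu 0 * sinh (nu / b * th_ n) @[n --> \oo] --> strip_cos b nu 0 * sinh m.
  apply: cvgM; first exact: cvg_cst.
  by apply: (cvg_at (f := fun x => sinh (nu / b * x))); exact/continuous_scale/continuous_sinh.
move=> /lim_uniq/[apply] <-.
by rewrite strip_cos0E mulrAC -!mulrA.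
Qed.

Lemma strip_cosE th : - (pi / 2) < th < pi / 2 ->
  strip_cos b nu th = pi / b * (cosh (nu / b * th) / cosh m).
Proof.
move=> hth; rewrite (strip_transform_solution nu b0 hth).1 strip_cos0E.
by rewrite mulrAC -!mulrA.
Qed.

End boundary_limit.

(** * The filters [g_s] and [c] *)

Section time_filter.
Context {R : realType} (beta : R).
Hypothesis beta0 : 0 < beta.
Local Notation mu := (@lebesgue_measure R).
Implicit Types (nu s t x : R).

Let b : R := 2 * pi / beta.

Let pn0 : pi != 0 :> R. Proof. by rewrite gt_eqF// pi_gt0. Qed.

Let bn0 : beta != 0. Proof. by rewrite gt_eqF. Qed.

Let cn0 x : cosh x != 0. Proof. by rewrite gt_eqF// cosh_gt0. Qed.

Let b0 : 0 < b. Proof. by rewrite divr_gt0// mulr_gt0// pi_gt0. Qed.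

(** By the double angle formulas [cosh (2 b t) + cos (2 th) = 2 (sinh^2 (b t) + cos^2 th)] with
    [b = 2 pi / beta] and [th = s pi]. The range [|s| < 1/2] is exactly the open strip. *)
Lemma filter_gsE s t : filter_gs beta s t = beta^-1 * strip_re b (s * pi) t.
Proof.
rewrite /filter_gs /strip_re /strip_den.
have -> : 4 * pi * t / beta = 2 * (b * t) by rewrite /b; ring.
have -> : 2 * pi * t / beta = b * t by rewrite /b; ring.
have -> : 2 * s * pi = s * pi + s * pi by ring.
have -> : 2 * (b * t) = b * t + b * t by ring.
have -> : cosh (b * t + b * t) = 1 + 2 * sinh (b * t) ^+ 2.
  have e : expR (b * t) * expR (- (b * t)) = 1 by rewrite -expRD subrr expR0.
  rewrite /cosh /sinh opprD !expRD; move: e.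
  set u := expR (b * t); set v := expR (- (b * t)) => e.
  by rewrite -[X in _ = X + _]e; field.
have -> : cos (s * pi + s * pi) = 2 * cos (s * pi) ^+ 2 - 1.
  by rewrite cosD -!expr2 sin2cos2; ring.
set S := sinh _ ^+ 2; set c := cos _ ^+ 2.
have -> : 1 + 2 * S + (2 * c - 1) = 2 * (S + c) by ring.
by rewrite invfM; set D := (S + c)^-1; field; rewrite gt_eqF.
Qed.

Let spi s : - 2^-1 < s < 2^-1 -> - (pi / 2) < s * pi < pi / 2.
Proof.
have p0 := pi_gt0 R; move=> /andP[h1 h2]; apply/andP; split.
  by rewrite [X in X < _](_ : _ = - 2^-1 * pi); [rewrite ltr_pM2r|field].
by rewrite [X in _ < X](_ : _ = 2^-1 * pi); [rewrite ltr_pM2r|field].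
Qed.

Lemma filter_gs_ge0 s t : - 2^-1 < s < 2^-1 -> 0 <= filter_gs beta s t.
Proof.
move=> /spi/cos_gt0_pihalf c0; rewrite filter_gsE mulr_ge0 ?invr_ge0 ?(ltW beta0)//.
by rewrite ltW// divr_gt0 ?strip_den_gt0// mulr_gt0// cosh_gt0.
Qed.

Let nuE nu : nu / b * (pi / 2) = beta * nu / 4.
Proof. by rewrite /b; move: pn0; move: (@pi R) => p ph; field; rewrite ?bn0 ?ph. Qed.

Lemma integrable_filter_gs s nu : - 2^-1 < s < 2^-1 ->
  mu.-integrable setT (EFin \o (fun t => filter_gs beta s t * cos (nu * t))) /\
  mu.-integrable setT (EFin \o (fun t => filter_gs beta s t * sin (nu * t))).
Proof.
move=> hs; have c0 := cos_gt0_pihalf (spi hs).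
have H (f : R -> R) : continuous f -> (forall t, `|f t| <= 1) ->
    mu.-integrable setT (EFin \o (fun t => filter_gs beta s t * f t)).
  move=> cf f1.
  suff Z : mu.-integrable setT (EFin \o (fun t => strip_re b (s * pi) t * f t)).
    apply: eq_integrable (integrableZl measurableT beta^-1 Z) => // t _ /=.
    by rewrite filter_gsE -[in RHS]mulrA.
  apply: (le_sech_integrable b0 (K := cos (s * pi) ^- 2)).
    apply: continuous_measurable_fun.
    exact: continuous_mul (continuous_strip_re c0) cf.
  move=> t; rewrite normrM -[leRHS]mulr1; apply: ler_pM => //.
  exact: (strip_re_le _ c0 (lexx _)).
split; apply: H.
- exact/continuous_scale/continuous_cos.
- by move=> t; exact: cos_max.
- exact/continuous_scale/continuous_sin.
- by move=> t; rewrite ler_norml sin_geN1 sin_le1.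
Qed.

(** The prefactor is [beta^-1 * pi / b = 1 / 2]. The sine part vanishes because [g_s] is even. *)
Lemma filter_gs_transform s nu : - 2^-1 < s < 2^-1 ->
  \int[mu]_t (filter_gs beta s t * cos (nu * t)) =
    cosh (s * (beta * nu / 2)) / (2 * cosh (beta * nu / 4)) /\
  \int[mu]_t (filter_gs beta s t * sin (nu * t)) = 0.
Proof.
move=> hs; have c0 := cos_gt0_pihalf (spi hs); split.
- transitivity (\int[mu]_t (beta^-1 * (strip_re b (s * pi) t * cos (nu * t)))).
    by apply: eq_Rintegral => t _; rewrite filter_gsE -mulrA.
  rewrite RintegralZl//; last exact: integrable_strip_cos.
  rewrite -/(strip_cos b nu (s * pi)) strip_cosE//; last exact: spi.
  rewrite nuE; have -> : nu / b * (s * pi) = s * (beta * nu / 2).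
    by rewrite /b; move: pn0; move: (@pi R) => p ph; field; rewrite ?bn0 ?ph.
  by rewrite /b; move: pn0; move: (@pi R) => p ph; field; rewrite ?cn0 ?bn0 ?ph.
- apply: Rintegral_odd; first by have [] := integrable_filter_gs nu hs.
  move=> t; rewrite mulrN sinN mulrN !filter_gsE /strip_re /strip_den.
  by rewrite mulrN sinhN coshN sqrrN.
Qed.

Lemma coherent_kernelE t : coherent_kernel beta t = beta^-1 / sinh (b * t).
Proof. by rewrite /coherent_kernel invfM /b; congr (_ / sinh _); ring. Qed.

Let cut (e : R) : set R := [set t : R | e < `|t|].

Lemma measurable_cut e : measurable (cut e : set (measurableTypeR R)).
Proof.
have -> : cut e = (fun t : R => `|t|) @^-1` `]e, +oo[%classic.
  by apply/seteqP; split => t /=; rewrite in_itv/= andbT.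
by rewrite -[X in measurable X]setTI; apply: normr_measurable.
Qed.

Let mfun (f : R -> R) : continuous f -> measurable_fun setT (fun t => coherent_kernel beta t * f t).
Proof.
move=> cf; apply: measurable_funM; last exact: continuous_measurable_fun.
rewrite (_ : coherent_kernel beta = fun t => beta^-1 / sinh (b * t)); last first.
  by apply/funext => t; rewrite coherent_kernelE.
apply: measurable_funM => //; apply: (measurable_fun_inv (f := fun t => sinh (b * t))).
by apply: continuous_measurable_fun; exact: continuous_scale (@continuous_sinh R).
Qed.

(** Off the cut [|sinh (b t)| >= b e], hence [cosh <= 1 + |sinh| <= (1 / (b e) + 1) |sinh|], and the
    kernel is again dominated by a multiple of [sech]. *)
Lemma integrable_cut_kernel e (f : R -> R) : 0 < e -> continuous f ->
  (forall t, `|f t| <= 1) ->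
  mu.-integrable (cut e) (EFin \o (fun t => coherent_kernel beta t * f t)).
Proof.
move=> e0 cf f1; have mc := measurable_cut e.
pose K := beta^-1 * ((b * e)^-1 + 1).
have iK := integrableS measurableT mc (@subsetT _ (cut e)) (integrableZl measurableT K (integrable_sech b0)).
apply: (le_integrable mc _ _ iK).
  by apply: measurable_funTS; apply/measurable_EFinP; exact: mfun.
move=> t /= et; rewrite lee_fin.
have be : 0 < b * e by rewrite mulr_gt0.
have bi : 0 < beta^-1 by rewrite invr_gt0.
have K0 : 0 <= K by rewrite mulr_ge0 ?(ltW bi)// addr_ge0// invr_ge0 ltW.
have sge : b * e <= `|sinh (b * t)|.
  apply: le_trans (norm_sinh_ge _); rewrite normrM gtr0_norm//.
  by rewrite ler_pM2l// ltW.
have s0 : 0 < `|sinh (b * t)| by exact: lt_le_trans sge.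
have c0 := cosh_gt0 (b * t).
rewrite [leRHS]ger0_norm; last by rewrite mulr_ge0// invr_ge0 ltW.
rewrite normrM -[leRHS]mulr1; apply: ler_pM => //.
rewrite coherent_kernelE normrM [`|beta^-1|]gtr0_norm// normfV.
have h : cosh (b * t) <= ((b * e)^-1 + 1) * `|sinh (b * t)|.
  apply: le_trans (cosh_le _) _; rewrite mulrDl mul1r lerD2r.
  by rewrite mulrC ler_pdivlMr// mul1r.
rewrite ler_pdivrMr// mulrAC ler_pdivlMr// /K -[leRHS]mulrA.
by apply: ler_wpM2l => //; exact: ltW.
Qed.

Let odd_cut e : 0 < e -> forall nu,
  \int[mu]_(t in cut e) (coherent_kernel beta t * cos (nu * t)) = 0.
Proof.
move=> e0 nu; rewrite Rintegral_mkcond; apply: Rintegral_odd.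
  have := integrable_cut_kernel e0 (continuous_scale (b := nu) (@continuous_cos R)) (fun t => cos_max _).
  move=> /(integrable_mkcond _ (measurable_cut e)).1.
  by rewrite restrict_EFin.
(* The cut is symmetric and the kernel is odd, so the integral vanishes for every cutoff and not
   merely in the limit. *)
move=> t; rewrite !patchE.
have -> : (- t \in cut e) = (t \in cut e) by apply/idP/idP; rewrite !inE /cut /= normrN.
case: ifP => _; last by rewrite oppr0.
by rewrite !coherent_kernelE !mulrN sinhN cosN invrN; ring.
Qed.

Lemma coherent_kernel_cos e nu : 0 < e ->
  \int[mu]_(t in cut e) (coherent_kernel beta t * cos (nu * t)) = 0.
Proof. by move=> e0; exact: odd_cut. Qed.

(** The singularity of [c] is removed by the sine: the full integrand is integrable and, up to
    [beta^-1], is the edge value found in [boundary_sin]. The principal value is then an ordinary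
    limit, taken along sequences of cutoffs by dominated convergence. *)
Lemma coherent_kernel_sin nu :
  \int[mu]_(t in cut e) (coherent_kernel beta t * sin (nu * t)) @[e --> 0^'+] -->
    2^-1 * (sinh (beta * nu / 4) / cosh (beta * nu / 4)).
Proof.
pose F t := coherent_kernel beta t * sin (nu * t).
have FE t : F t = beta^-1 * (sin (nu * t) / sinh (b * t)).
  by rewrite /F coherent_kernelE; ring.
have [isin _] := boundary_sin nu b0.
have iF : mu.-integrable setT (EFin \o F).
  apply: eq_integrable (integrableZl measurableT beta^-1 isin) => // t _ /=.
  by rewrite FE.
have -> : 2^-1 * (sinh (beta * nu / 4) / cosh (beta * nu / 4)) = \int[mu]_t F t.
  under eq_Rintegral do rewrite FE.
  rewrite RintegralZl// Rintegral_sin_sinh// nuE /b; move: pn0; move: (@pi R) => p ph; field.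
  by rewrite ?cn0 ?bn0 ?ph.
apply/cvg_at_rightP => u [u0 cu].
have [||||_ L] := @Rintegral_dominated_cvg R (fun n => F \_ (cut (u n))) F (fun t => `|F t|).
- move=> n; apply: (measurable_restrictT _ (measurable_cut _)).1.
  by apply: measurable_funTS; apply/measurable_EFinP; exact: measurable_int iF.
- move=> t; have [->|t0] := eqVneq t 0.
    have F0 : F 0 = 0 by rewrite /F mulr0 sin0 mulr0.
    under eq_fun do rewrite patchE F0 if_same.
    rewrite F0; exact: cvg_cst.
  apply: cvg_near_cst; near=> n; rewrite patchE ifT//.
  rewrite inE /cut /=; near: n.
  have t1 : 0 < `|t| by rewrite normr_gt0.
  by move/cvgrPdist_lt : cu => /(_ _ t1); apply: filterS => n; rewrite sub0r normrN gtr0_norm.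
- exact: integrable_norm iF.
- by move=> n t; rewrite patchE; case: ifP => // _; rewrite normr0.
by under eq_fun do rewrite Rintegral_mkcond.
Unshelve. all: by end_near. Qed.

End time_filter.

(** * Gaussian frequency weights *)

Section gaussian.
Context {R : realType}.
Local Notation mu := (@lebesgue_measure R).
Implicit Types (a c t x nu : R).

Definition gauss a x : R := expR (- (a * x ^+ 2)).

Lemma gauss_gt0 a x : 0 < gauss a x. Proof. exact: expR_gt0. Qed.

Lemma gauss0 a : gauss a 0 = 1.
Proof. by rewrite /gauss expr0n/= mulr0 oppr0 expR0. Qed.

Lemma gauss_le1 a x : 0 <= a -> gauss a x <= 1.
Proof. by move=> a0; rewrite /gauss -expR0 ler_expR oppr_le0 mulr_ge0// sqr_ge0. Qed.

Lemma is_derive_gauss a x : is_derive x 1 (gauss a) (- (2 * a * x) * gauss a x).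
Proof.
have D : is_derive x 1 (fun x => - (a * x ^+ 2)) (- (2 * a * x)).
  apply: (is_derive_eq (is_derive1_opp (is_derive1_mul (is_derive1_cst a x)
    (is_derive1_sqr (is_derive_id x 1))))); rewrite /=; ring.
apply: (is_derive_eq (is_derive1_compose (f := @expR R) (g := fun x => - (a * x ^+ 2))
  (is_derive_expR _) D)).
by rewrite mulrC.
Qed.

Lemma continuous_gauss a : continuous (gauss a).
Proof. exact: is_derive1_continuous (is_derive_gauss a). Qed.

Lemma integrable_gauss_shift a c : 0 < a ->
  mu.-integrable setT (EFin \o (fun x => gauss a (x - c))).
Proof.
(* Variance [1 / (2 a)] makes the unnormalised normal density equal to [gauss a]. *)
move=> a0; pose s := Num.sqrt (a^-1 / 2).
have a2 : 0 < a^-1 / 2 by rewrite divr_gt0// invr_gt0.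
have s0 : s != 0 by rewrite gt_eqF// sqrtr_gt0.
have ss : s ^+ 2 = a^-1 / 2 by rewrite sqr_sqrtr// ltW.
have pk : normal_peak s != 0 by rewrite gt_eqF// normal_peak_gt0.
apply: eq_integrable (integrableZl measurableT (normal_peak s)^-1 (integrable_normal_pdf c s)) => //.
move=> x _ /=; rewrite -EFinM; congr EFin.
rewrite normal_pdfE// mulKf// /normal_fun /gauss ss; congr expR.
by rewrite -mulr_natl; field; rewrite gt_eqF.
Qed.

Lemma integrable_gauss a : 0 < a -> mu.-integrable setT (EFin \o gauss a).
Proof.
move=> a0; apply: eq_integrable (integrable_gauss_shift 0 a0) => // x _ /=.
by rewrite subr0.
Qed.

Let cos1 x : `|cos x| <= 1. Proof. exact: cos_max. Qed.
Let sin1 x : `|sin x| <= 1. Proof. by rewrite ler_norml sin_geN1 sin_le1. Qed.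

(** Half of the exponent is spent on the factor [|t|]: [e^(a t^2 / 2) >= 1 + a t^2 / 2], and
    [1 + 2 / a] makes the product at least [1 + t^2 >= |t|]. *)
Let norm_mul_gauss a t : 0 < a -> `|t| * gauss a t <= (1 + 2 / a) * gauss (a / 2) t.
Proof.
move=> a0; have -> : gauss a t = gauss (a / 2) t * gauss (a / 2) t.
  by rewrite /gauss -expRD; congr expR; field.
rewrite mulrA ler_pM2r ?gauss_gt0//.
rewrite /gauss expRN ler_pdivrMr ?expR_gt0//.
apply: le_trans (_ : (1 + 2 / a) * (1 + a / 2 * t ^+ 2) <= _); last first.
  by rewrite ler_wpM2l ?expR_ge1Dx// addr_ge0// divr_ge0// ltW.
have -> : (1 + 2 / a) * (1 + a / 2 * t ^+ 2) = 1 + 2 / a + a / 2 * t ^+ 2 + t ^+ 2.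
  by field; rewrite gt_eqF.
have h1 : 0 <= 2 / a by rewrite divr_ge0// ltW.
have h2 : 0 <= a / 2 * t ^+ 2 by rewrite mulr_ge0 ?sqr_ge0// divr_ge0// ltW.
have h3 : `|t| <= 1 + t ^+ 2.
  rewrite -[t ^+ 2]real_normK ?num_real//.
  by have := sqr_ge0 (`|t| - 2^-1); rewrite sqrrB expr2; lra.
lra.
Qed.

Lemma gauss_trig_integrable a (f : R -> R) : 0 < a -> continuous f -> (forall t, `|f t| <= 1) ->
  mu.-integrable setT (EFin \o (fun t => gauss a t * f t)).
Proof.
move=> a0 cf f1; apply: (le_integrable measurableT _ _ (integrable_gauss a0)).
  apply/measurable_EFinP; apply: continuous_measurable_fun.
  exact: continuous_mul (@continuous_gauss a) cf.
move=> t _ /=; rewrite lee_fin normrM -[leRHS]mulr1; exact: ler_pM.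
Qed.

Let ccos nu : continuous (fun t => cos (nu * t)).
Proof. exact/continuous_scale/continuous_cos. Qed.
Let csin nu : continuous (fun t => sin (nu * t)).
Proof. exact/continuous_scale/continuous_sin. Qed.

Lemma gauss_sin a nu : 0 < a -> \int[mu]_t (gauss a t * sin (nu * t)) = 0.
Proof.
move=> a0; apply: Rintegral_odd; first exact: gauss_trig_integrable.
by move=> t; rewrite /gauss sqrrN mulrN sinN mulrN.
Qed.

Let integrable_t_gauss a nu : 0 < a ->
  mu.-integrable setT (EFin \o (fun t => t * gauss a t * sin (nu * t))).
Proof.
move=> a0; have a20 : 0 < a / 2 by rewrite divr_gt0.
have I := integrableZl measurableT (1 + 2 / a) (integrable_gauss a20).
apply: (le_integrable measurableT _ _ I).
  apply/measurable_EFinP; apply: continuous_measurable_fun; apply: continuous_mul => //.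
  by apply: continuous_mul; [move=> x; exact: cvg_id|exact: continuous_gauss].
move=> t _ /=; rewrite lee_fin normrM -[leRHS]mulr1; apply: ler_pM => //.
rewrite normrM [`|gauss _ _|]gtr0_norm ?gauss_gt0//.
by apply: le_trans (norm_mul_gauss t a0) _; exact: ler_norm.
Qed.

Let gauss_cos_ibp a nu : 0 < a ->
  \int[mu]_t (- (t * gauss a t * sin (nu * t))) =
  - (nu / (2 * a)) * \int[mu]_t (gauss a t * cos (nu * t)).
Proof.
move=> a0.
have i1 := integrable_t_gauss nu a0.
have i2 := gauss_trig_integrable a0 (@ccos nu) (fun t => cos1 (nu * t)).
have j1 := integrableZl measurableT (2 * a) i1.
have j2 := integrableZl measurableT nu i2.
have D t : is_derive t 1 (fun t => gauss a t * sin (nu * t))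
    (nu * (gauss a t * cos (nu * t)) - (2 * a) * (t * gauss a t * sin (nu * t))).
  apply: (is_derive_eq (is_derive1_mul (is_derive_gauss a t)
    (is_derive1_scale (is_derive_sin (nu * t))))); ring.
have cD : continuous (fun t => nu * (gauss a t * cos (nu * t)) - (2 * a) * (t * gauss a t * sin (nu * t))).
  have cg := @continuous_gauss a.
  apply: continuous_sub; (apply: continuous_mul; first by move=> x; exact: cvg_cst).
    exact: continuous_mul.
  by apply: continuous_mul => //; apply: continuous_mul => // x; exact: cvg_id.
have [l0 l1] : (gauss a n%:R * sin (nu * n%:R) @[n --> \oo] --> (0 : R)) /\
    (gauss a (- n%:R) * sin (nu * - n%:R) @[n --> \oo] --> (0 : R)).
  apply: (decay_cvg0 (f := fun t => gauss a t * sin (nu * t)) (C := 1 + 2 / a)) => t.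
  rewrite normrM mulrAC -[leRHS]mulr1; apply: ler_pM => //.
  rewrite gtr0_norm ?gauss_gt0// mulrC; apply: le_trans (norm_mul_gauss t a0) _.
  rewrite -[leRHS]mulr1 ler_wpM2l//; first by rewrite addr_ge0// divr_ge0// ltW.
  by apply: gauss_le1; rewrite divr_ge0// ltW.
have := Rintegral_line_FTC cD (integrableB measurableT j2 j1) D l0 l1.
rewrite RintegralB// !RintegralZl// subrr.
under [X in _ -> X = _]eq_Rintegral do rewrite -mulN1r.
rewrite RintegralZl//.
set A := \int[mu]_t (gauss a t * cos _); set B := \int[mu]_t _ => E.
have -> : - (nu / (2 * a)) * A = - (nu * A / (2 * a)) by ring.
have -> : nu * A = 2 * a * B by lra.
by field; rewrite gt_eqF.
Qed.

Lemma is_derive_gauss_cos a nu : 0 < a ->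
  is_derive nu 1 (fun nu => \int[mu]_t (gauss a t * cos (nu * t)))
    (- (nu / (2 * a)) * \int[mu]_t (gauss a t * cos (nu * t))).
Proof.
move=> a0; rewrite -gauss_cos_ibp//.
have a20 : 0 < a / 2 by rewrite divr_gt0.
pose f x t := gauss a t * cos (x * t).
pose df x t := - (t * gauss a t * sin (x * t)).
have h1 : nu - 1 < nu < nu + 1 by apply/andP; split; lra.
have intf x : nu - 1 < x < nu + 1 -> mu.-integrable setT (EFin \o f x).
  by move=> _; exact: gauss_trig_integrable.
have derf (x y : R) : nu - 1 < x < nu + 1 -> is_derive x 1 (f ^~ y) (df x y).
  move=> _; rewrite /f /df.
  have D : is_derive x 1 (fun x => cos (x * y)) (y * - sin (x * y)).
    have := is_derive1_scale (f := @cos R) (b := y) (x := x) (is_derive_cos (y * x)).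
    by rewrite [y * x]mulrC; under eq_fun do rewrite mulrC.
  apply: (is_derive_eq (is_derive1_mul (is_derive1_cst (gauss a y) x) D)); ring.
have intG := integrableZl measurableT (1 + 2 / a) (integrable_gauss a20).
apply: (is_derive_Rintegral h1 intf derf intG) => x y _.
rewrite /df normrN normrM -[leRHS]mulr1; apply: ler_pM => //.
by rewrite normrM [`|gauss _ _|]gtr0_norm ?gauss_gt0//; exact: norm_mul_gauss.
Qed.

(** The transform satisfies [F' = - nu / (2 a) F], the equation of [gauss (1 / (4 a))], so the
    quotient of the two is constant. The total mass stays symbolic; it reaches both sides of the
    theorem inside the same [pair_weight]. *)
Lemma gauss_cos a nu : 0 < a ->
  \int[mu]_t (gauss a t * cos (nu * t)) = \int[mu]_t gauss a t * gauss (4 * a)^-1 nu.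
Proof.
move=> a0; pose F nu := \int[mu]_t (gauss a t * cos (nu * t)).
pose E x := F x / gauss (4 * a)^-1 x.
have dE (y : R) : is_derive y 1 E 0.
  have g0 : gauss (4 * a)^-1 y != 0 by rewrite gt_eqF// gauss_gt0.
  apply: (is_derive_eq (is_derive1_div g0 (is_derive_gauss_cos y a0)
    (is_derive_gauss (4 * a)^-1 y))).
  by rewrite -/(F y); field; rewrite g0 gt_eqF.
have := @is_derive0_const R E (- (`|nu| + 1)) (`|nu| + 1) nu.
move=> /(_ _ _ (fun y _ => dE y)).
have n0 := normr_ge0 nu.
have -> : - (`|nu| + 1) < 0 < `|nu| + 1 by apply/andP; split; lra.
rewrite -ltr_norml ltrDl ltr01 => /(_ isT isT).
rewrite /E.
have -> : F 0 = \int[mu]_t gauss a t.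
  by apply: eq_Rintegral => t _; rewrite mul0r cos0 mulr1.
rewrite gauss0 divr1 => <-.
by rewrite divfK// gt_eqF// gauss_gt0.
Qed.

End gaussian.

(** * Pair weights and their exponential tilts *)

Section frequency_weights.
Context {R : realType} (beta kappa : R).
Hypotheses (beta0 : 0 < beta) (kappa0 : 0 < kappa).
Local Notation mu := (@lebesgue_measure R).
Implicit Types (s t x y : R).

Let k2 : 0 < kappa ^+ 2. Proof. exact: exprn_gt0. Qed.

Let amp : R := Num.sqrt (kappa * Num.sqrt (2 / pi)).

(** The Fourier transform of the time filter [f], hence the function [F] of the overview: its value
    at [omega - nu_p] is the coefficient of the component [a_p] in the jump operator at frequency
    [omega]. *)
Definition jump_profile x : R :=
  (Num.sqrt (2 * pi))^-1 * (amp * \int[mu]_t gauss (kappa ^+ 2) t)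
  * gauss (4 * kappa ^+ 2)^-1 x.

Let gaussian_filterE t : gaussian_filter kappa t = amp * gauss (kappa ^+ 2) t.
Proof. by rewrite /gaussian_filter /gauss mulrC. Qed.

Lemma integrable_gaussian_filter (f : R -> R) : continuous f -> (forall t, `|f t| <= 1) ->
  mu.-integrable setT (EFin \o (fun t => gaussian_filter kappa t * f t)).
Proof.
move=> cf f1.
apply: eq_integrable (integrableZl measurableT amp (gauss_trig_integrable k2 cf f1)) => // t _ /=.
by rewrite gaussian_filterE -[in RHS]mulrA.
Qed.

Lemma gaussian_filter_cos x :
  (Num.sqrt (2 * pi))^-1 * \int[mu]_t (gaussian_filter kappa t * cos (x * t)) = jump_profile x.
Proof.
transitivity ((Num.sqrt (2 * pi))^-1 * \int[mu]_t (amp * (gauss (kappa ^+ 2) t * cos (x * t)))).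
  by congr (_ * _); apply: eq_Rintegral => t _; rewrite gaussian_filterE -[LHS]mulrA.
rewrite RintegralZl//; last first.
  apply: (gauss_trig_integrable k2); last by move=> t; exact: cos_max.
  exact/continuous_scale/continuous_cos.
by rewrite gauss_cos// /jump_profile !mulrA.
Qed.

Lemma gaussian_filter_sin x : \int[mu]_t (gaussian_filter kappa t * sin (x * t)) = 0.
Proof.
transitivity (\int[mu]_t (amp * (gauss (kappa ^+ 2) t * sin (x * t)))).
  by apply: eq_Rintegral => t _; rewrite gaussian_filterE -[LHS]mulrA.
rewrite RintegralZl//; last first.
  apply: (gauss_trig_integrable k2); last by move=> t; rewrite ler_norml sin_geN1 sin_le1.
  exact/continuous_scale/continuous_sin.
by rewrite gauss_sin// mulr0.
Qed.

Let a : R := (4 * kappa ^+ 2)^-1.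
Let a0 : 0 < a. Proof. by rewrite invr_gt0 mulr_gt0. Qed.
Let N : R := (Num.sqrt (2 * pi))^-1 * (amp * \int[mu]_t gauss (kappa ^+ 2) t).
Let jE x : jump_profile x = N * gauss a x. Proof. by []. Qed.

Let N0 : 0 <= N.
Proof.
rewrite mulr_ge0 ?invr_ge0 ?sqrtr_ge0// mulr_ge0 ?sqrtr_ge0//.
by apply: Rintegral_ge0 => t _; rewrite ltW// gauss_gt0.
Qed.

Lemma jump_profileN x : jump_profile (- x) = jump_profile x.
Proof. by rewrite !jE /gauss sqrrN. Qed.

Definition pair_profile x y w : R := jump_profile (w - x) * jump_profile (w - y).

Lemma pair_profile_ge0 x y w : 0 <= pair_profile x y w.
Proof. by rewrite mulr_ge0// jE mulr_ge0// ltW// gauss_gt0. Qed.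

Lemma continuous_pair_profile x y : continuous (pair_profile x y).
Proof.
have cj z : continuous (fun w => jump_profile (w - z)).
  apply: continuous_mul; first by move=> ?; exact: cvg_cst.
  move=> w; apply: (@continuous_comp _ _ _ (fun w => w - z) (gauss a)).
    by apply: cvgB; [exact: cvg_id|exact: cvg_cst].
  exact: continuous_gauss.
exact: continuous_mul.
Qed.

Lemma integrable_pair_profile x y (f : R -> R) : measurable_fun setT f ->
  (forall w, `|f w| <= 1) ->
  mu.-integrable setT (EFin \o (fun w => pair_profile x y w * f w)).
Proof.
move=> mf f1.
apply: (le_integrable measurableT _ _ (integrableZl measurableT (N * N) (integrable_gauss_shift x a0))).
  apply/measurable_EFinP; apply: measurable_funM => //.
  by apply: continuous_measurable_fun; exact: continuous_pair_profile.
move=> t _ /=; rewrite lee_fin normrM [`|pair_profile _ _ _|]ger0_norm ?pair_profile_ge0//.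
rewrite [leRHS]ger0_norm; last exact: mulr_ge0 (mulr_ge0 N0 N0) (ltW (gauss_gt0 _ _)).
rewrite -[leRHS]mulr1; apply: ler_pM => //; first exact: pair_profile_ge0.
rewrite /pair_profile !jE mulrACA; apply: ler_wpM2l; first exact: mulr_ge0.
rewrite -[leRHS]mulr1; apply: ler_wpM2l; first exact/ltW/gauss_gt0.
by apply: gauss_le1; exact: ltW.
Qed.

(* Completing the square: a shift of the Gaussian pair weight is an exponential tilt. *)
Let pair_profile_tilt x y w c :
  pair_profile x y (w + c * kappa ^+ 2) =
  expR (c * ((x + y) / 2 - w) - c ^+ 2 * kappa ^+ 2 / 2) * pair_profile x y w.
Proof.
rewrite /pair_profile !jE /gauss.
rewrite mulrACA -expRD.
set e0 := expR (c * _ - _); set e1 := expR _; set e2 := expR _; set e3 := expR _.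
rewrite [RHS](_ : _ = N * N * (e0 * (e2 * e3))); last by ring.
rewrite -!expRD; congr (_ * expR _).
by rewrite /a; field; rewrite gt_eqF.
Qed.

(** This is the symmetric weight [eta] of the overview. *)
Definition pair_weight x y : R := \int[mu]_w (pair_profile x y w * filter_h beta kappa w).

Lemma measurable_filter_h : measurable_fun setT (filter_h beta kappa).
Proof.
apply: measurable_funM => //; apply: measurableT_comp => //.
apply: measurable_funN; apply: measurable_funM => //; apply: measurable_funM => //.
Qed.

Lemma filter_h_ge0 w : 0 <= filter_h beta kappa w.
Proof. by rewrite mulr_ge0// expR_ge0. Qed.

Lemma filter_h_le1 w : `|filter_h beta kappa w| <= 1.
Proof.
rewrite ger0_norm ?filter_h_ge0// /filter_h -expRD -[leRHS]expR0 ler_expR.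
have h1 : 0 <= kappa ^+ 2 * beta ^+ 2 / 8 by rewrite divr_ge0// mulr_ge0// sqr_ge0.
have h2 : 0 <= beta * `|w| / 2 by rewrite divr_ge0// mulr_ge0// ltW.
by rewrite -opprD oppr_le0 addr_ge0.
Qed.

Lemma integrable_pair_weight x y :
  mu.-integrable setT (EFin \o (fun w => pair_profile x y w * filter_h beta kappa w)).
Proof.
by apply: integrable_pair_profile; [exact: measurable_filter_h|exact: filter_h_le1].
Qed.

(** Working with nonnegative functions lets translation invariance deliver integrability together
    with the value. *)
Let translate (g : R -> R) x y c K : measurable_fun setT g -> (forall w, 0 <= g w) ->
  (forall w, g (w - c) = K * (pair_profile x y w * filter_h beta kappa w)) ->
  mu.-integrable setT (EFin \o g) /\ \int[mu]_w g w = K * pair_weight x y.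
Proof.
move=> mg g0 gE.
have E : (\int[mu]_w (g w)%:E = (K * pair_weight x y)%:E)%E.
  rewrite -(ge0_integral_translation c mg g0) /pair_weight.
  have i := integrable_pair_weight x y.
  have iK : mu.-integrable setT (EFin \o (fun w => K * (pair_profile x y w * filter_h beta kappa w))).
    exact: (integrableZl measurableT K i).
  rewrite -RintegralZl// /Rintegral fineK; last exact: (integrable_fin_num measurableT iK).
  by apply: eq_integral => w _; rewrite gE.
split; last by rewrite /Rintegral E.
apply/integrableP; split; first exact/measurable_EFinP.
by under eq_integral do rewrite /= ger0_norm//; rewrite E ltry.
Qed.

(** After the shift by [beta kappa^2 / 2] the exponent is [max w 0 = (w + |w|) / 2]. The [|w|] half
    is the one in [h], the [w] half cancels against the tilt with [c = - beta / 2], and the leftover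
    constant of that tilt is the prefactor [e^(- kappa^2 beta^2 / 8)] of [h]. *)
Lemma transition_weight_integral x y :
  mu.-integrable setT (EFin \o (fun w => pair_profile x y w * transition_weight beta kappa w)) /\
  \int[mu]_w (pair_profile x y w * transition_weight beta kappa w) =
    expR (- (beta * (x + y) / 4)) * pair_weight x y.
Proof.
apply: (translate (c := beta * kappa ^+ 2 / 2)).
- apply: measurable_funM; first by apply: continuous_measurable_fun; exact: continuous_pair_profile.
  apply: measurableT_comp => //; apply: measurable_funN; apply: measurable_funM => //.
  by apply: measurable_maxr => //; exact: measurable_funD.
- by move=> w; rewrite mulr_ge0 ?pair_profile_ge0// expR_ge0.
- move=> w; rewrite /transition_weight subrK.
  have -> : w - beta * kappa ^+ 2 / 2 = w + (- (beta / 2)) * kappa ^+ 2 by ring.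
  rewrite pair_profile_tilt /filter_h.
  have mE : Num.max w 0 = (w + `|w|) / 2.
    have [w0|/ltW w0] := lerP w 0; first by rewrite ler0_norm// subrr mul0r.
    by rewrite ger0_norm//; field.
  set e1 := expR _; set e2 := expR (- (beta * Num.max _ _)).
  rewrite [LHS](_ : _ = pair_profile x y w * (e1 * e2)); last by ring.
  by rewrite [RHS]mulrCA -!expRD mE; congr (_ * expR _); field.
Qed.

(** The tilt with [c = s beta] produces [- s beta w] in the exponent, and the exponential prefactor
    of [h_s] is chosen to cancel it. *)
Lemma filter_hs_integral x y s :
  mu.-integrable setT (EFin \o (fun w => pair_profile x y w * filter_hs beta kappa s w)) /\
  \int[mu]_w (pair_profile x y w * filter_hs beta kappa s w) =
    expR (s * beta * (x + y) / 2) * pair_weight x y.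
Proof.
apply: (translate (c := - (s * beta * kappa ^+ 2))).
- apply: measurable_funM; first by apply: continuous_measurable_fun; exact: continuous_pair_profile.
  apply: measurable_funM.
    by apply: measurableT_comp => //; do !apply: measurable_funM => //; exact: measurable_funB.
  by apply: measurableT_comp; [exact: measurable_filter_h|exact: measurable_funB].
- by move=> w; rewrite mulr_ge0 ?pair_profile_ge0// mulr_ge0 ?expR_ge0// filter_h_ge0.
- move=> w; rewrite /filter_hs opprK addrK pair_profile_tilt.
  rewrite [LHS](_ : _ = pair_profile x y w * filter_h beta kappa w *
    (expR (s * beta * ((x + y) / 2 - w) - (s * beta) ^+ 2 * kappa ^+ 2 / 2)
     * expR (s * beta * (2 * (w + s * beta * kappa ^+ 2) - s * beta * kappa ^+ 2) / 2))); last by ring.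
  by rewrite -expRD mulrC; congr (expR _ * _); field.
Qed.

(** Both [h] and the profile are even, so reflecting [w] suffices. This is the invariance of [eta]
    under the swap. *)
Lemma pair_weight_opp x y : pair_weight (- y) (- x) = pair_weight x y.
Proof.
rewrite /pair_weight -[RHS]Rintegral_oppr; last exact: integrable_pair_weight.
apply: eq_Rintegral => w _; rewrite /filter_h normrN; congr (_ * _).
rewrite /pair_profile mulrC.
by congr (_ * _); rewrite -[RHS]jump_profileN; congr jump_profile; ring.
Qed.

End frequency_weights.

(** * Complex-valued integrals *)

Section complex_integral.
Local Open Scope complex_scope.
Context {R : realType}.
Local Notation mu := (@lebesgue_measure R).
Local Notation C := R[i].
Implicit Types (f g : R -> C) (z : C).

Definition cintegral (D : set R) f : C :=
  (\int[mu]_(x in D) complex.Re (f x)) +i* (\int[mu]_(x in D) complex.Im (f x)).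

Definition cintegrable (D : set (measurableTypeR R)) f : Prop :=
  mu.-integrable D (EFin \o (fun x => complex.Re (f x))) /\
  mu.-integrable D (EFin \o (fun x => complex.Im (f x))).

Lemma ReM z1 z2 : complex.Re (z1 * z2) =
  complex.Re z1 * complex.Re z2 - complex.Im z1 * complex.Im z2.
Proof. by case: z1 z2 => a b [c d]. Qed.

Lemma ImM z1 z2 : complex.Im (z1 * z2) =
  complex.Re z1 * complex.Im z2 + complex.Im z1 * complex.Re z2.
Proof. by case: z1 z2 => a b [c d]. Qed.

Lemma ReD z1 z2 : complex.Re (z1 + z2) = complex.Re z1 + complex.Re z2.
Proof. by case: z1 z2 => a b [c d]. Qed.

Lemma ImD z1 z2 : complex.Im (z1 + z2) = complex.Im z1 + complex.Im z2.
Proof. by case: z1 z2 => a b [c d]. Qed.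

Lemma complex_ext z1 z2 : complex.Re z1 = complex.Re z2 ->
  complex.Im z1 = complex.Im z2 -> z1 = z2.
Proof. by case: z1 z2 => a b [c d] /= -> ->. Qed.

Lemma realCM (x y : R) : (x * y)%:C = x%:C * y%:C :> C.
Proof. by apply: complex_ext; rewrite ?ReM ?ImM /=; ring. Qed.

Lemma realCD (y z : R) : (y + z)%:C = y%:C + z%:C :> C.
Proof. by apply: complex_ext; rewrite ?ReD ?ImD //= addr0. Qed.

Lemma realCB (y z : R) : (y - z)%:C = y%:C - z%:C :> C.
Proof. by apply: complex_ext; rewrite ?ReD ?ImD //= subr0. Qed.

Lemma realC_inv (z : R) : z^-1%:C = (z%:C)^-1 :> C.
Proof. exact: fmorphV. Qed.

Lemma realC_div (y z : R) : (y / z)%:C = y%:C / z%:C :> C.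
Proof. by rewrite realCM realC_inv. Qed.

Lemma realC_half : (2^-1)%:C = 2^-1 :> C.
Proof. by rewrite realC_inv; congr (_^-1); rewrite rmorph_nat. Qed.

Lemma Re_sum (I : finType) (f : I -> C) : complex.Re (\sum_i f i) = \sum_i complex.Re (f i).
Proof. by elim/big_rec2: _ => // i x y _ <-; rewrite ReD. Qed.

Lemma Im_sum (I : finType) (f : I -> C) : complex.Im (\sum_i f i) = \sum_i complex.Im (f i).
Proof. by elim/big_rec2: _ => // i x y _ <-; rewrite ImD. Qed.

Section domain.
Variable D : set (measurableTypeR R).
Hypothesis mD : measurable D.

Lemma eq_cintegral f g : (forall x, D x -> f x = g x) -> cintegral D f = cintegral D g.
Proof.
by move=> fg; congr (_ +i* _); apply: eq_Rintegral => x /set_mem Dx; rewrite fg.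
Qed.

Lemma eq_cintegrable f g : (forall x, D x -> f x = g x) -> cintegrable D f -> cintegrable D g.
Proof.
by move=> fg [h1 h2]; split; [apply: eq_integrable h1|apply: eq_integrable h2] => //
  x /set_mem Dx /=; rewrite fg.
Qed.

Lemma cintegrableZl z f : cintegrable D f -> cintegrable D (fun x => z * f x).
Proof.
move=> [h1 h2]; split.
- apply: eq_integrable (integrableB mD (integrableZl mD (complex.Re z) h1)
    (integrableZl mD (complex.Im z) h2)) => // x _ /=.
  by rewrite ReM.
- apply: eq_integrable (integrableD mD (integrableZl mD (complex.Re z) h2)
    (integrableZl mD (complex.Im z) h1)) => // x _ /=.
  by rewrite ImM.
Qed.

Lemma cintegralZl z f : cintegrable D f ->
  cintegral D (fun x => z * f x) = z * cintegral D f.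
Proof.
move=> [h1 h2]; rewrite /cintegral; apply: complex_ext; rewrite /= ?ReM ?ImM /=.
- rewrite -!RintegralZl// -RintegralB//.
  + by apply: eq_Rintegral => x _; rewrite ReM.
  + exact: (integrableZl mD (complex.Re z) h1).
  + exact: (integrableZl mD (complex.Im z) h2).
- rewrite -!RintegralZl// -RintegralD//.
  + by apply: eq_Rintegral => x _; rewrite ImM.
  + exact: (integrableZl mD (complex.Re z) h2).
  + exact: (integrableZl mD (complex.Im z) h1).
Qed.

Lemma cintegrableD f g : cintegrable D f -> cintegrable D g ->
  cintegrable D (fun x => f x + g x).
Proof.
move=> [h1 h2] [k1 k2]; split.
- by apply: eq_integrable (integrableD mD h1 k1) => // x _ /=; rewrite ReD.
- by apply: eq_integrable (integrableD mD h2 k2) => // x _ /=; rewrite ImD.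
Qed.

Lemma cintegralD f g : cintegrable D f -> cintegrable D g ->
  cintegral D (fun x => f x + g x) = cintegral D f + cintegral D g.
Proof.
move=> [h1 h2] [k1 k2]; rewrite /cintegral; apply: complex_ext => /=.
- by rewrite -RintegralD//; apply: eq_Rintegral => x _; rewrite ReD.
- by rewrite -RintegralD//; apply: eq_Rintegral => x _; rewrite ImD.
Qed.

Lemma cintegral0 : cintegral D (fun=> 0) = 0 :> C.
Proof. by rewrite /cintegral /= Rintegral_cst// mul0r. Qed.

Lemma cintegrable0 : cintegrable D (fun=> 0).
Proof. by split; exact: integrable0. Qed.

Lemma cintegrable_sum (I : Type) (r : seq I) (f : I -> R -> C) :
  (forall i, cintegrable D (f i)) -> cintegrable D (fun x => \sum_(i <- r) f i x).
Proof.
move=> h; elim: r => [|i r ih].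
  by apply: eq_cintegrable cintegrable0 => x _; rewrite big_nil.
by apply: eq_cintegrable (cintegrableD (h i) ih) => x _; rewrite big_cons.
Qed.

Lemma cintegral_sum (I : Type) (r : seq I) (f : I -> R -> C) :
  (forall i, cintegrable D (f i)) ->
  cintegral D (fun x => \sum_(i <- r) f i x) = \sum_(i <- r) cintegral D (f i).
Proof.
move=> h; elim: r => [|i r ih].
  by rewrite big_nil -[RHS]cintegral0; apply: eq_cintegral => x _; rewrite big_nil.
rewrite big_cons -ih -cintegralD//; last exact: cintegrable_sum.
by apply: eq_cintegral => x _; rewrite big_cons.
Qed.

Lemma cintegrable_real (u : R -> R) :
  mu.-integrable D (EFin \o u) -> cintegrable D (fun x => (u x)%:C).
Proof. by move=> h; split=> //; exact: integrable0. Qed.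

Lemma cintegral_real (u : R -> R) :
  cintegral D (fun x => (u x)%:C) = (\int[mu]_(x in D) u x)%:C.
Proof. by rewrite /cintegral /= Rintegral_cst// mul0r. Qed.

(** The integrand is real, but its Bohr expansion is a sum of complex terms. Besides the value, the
    lemma records that the result is real, so that it can serve as the integrand of the next
    integral. *)
Lemma integral_of_complex (u : R -> R) f : (forall x, D x -> (u x)%:C = f x) ->
  cintegrable D f ->
  (\int[mu]_(x in D) (u x)%:E = (complex.Re (cintegral D f))%:E)%E /\
  (complex.Re (cintegral D f))%:C = cintegral D f.
Proof.
move=> uf fi; have [iu _] : cintegrable D (fun x => (u x)%:C).
  by apply: eq_cintegrable fi => x Dx; rewrite uf.
rewrite -(eq_cintegral uf) cintegral_real; split => //=.
by rewrite /Rintegral fineK//; exact: (integrable_fin_num mD iu).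
Qed.

Lemma mxintegral_sum m (I : finType) (phi : I -> R -> C) (B : I -> 'M[C]_m)
    (F : R -> 'M[C]_m) :
  (forall i, cintegrable D (phi i)) ->
  (forall x, D x -> F x = \sum_i phi i x *: B i) ->
  mxintegral D F = \sum_i cintegral D (phi i) *: B i.
Proof.
move=> h FE; apply/matrixP => i j; rewrite mxE.
rewrite -/(cintegral D (fun x => F x i j)) summxE.
transitivity (\sum_k cintegral D (fun x => B k i j * phi k x)).
  rewrite -cintegral_sum; last by move=> k; exact: cintegrableZl.
  apply: eq_cintegral => x Dx; rewrite FE// summxE.
  by apply: eq_bigr => k _; rewrite mxE mulrC.
by apply: eq_bigr => k _; rewrite cintegralZl// mxE mulrC.
Qed.

End domain.

Lemma expiD (x y : R) : expi (x + y) = expi x * expi y.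
Proof.
by rewrite /expi cosD sinD; apply: complex_ext; rewrite ?ReM ?ImM //= addrC mulrC [sin y * _]mulrC.
Qed.

Lemma expi0 : expi (0 : R) = 1.
Proof. by rewrite /expi cos0 sin0. Qed.

Lemma conj_real_expi (x y : R) : ((x%:C * expi y)^*)%R = x%:C * expi (- y).
Proof.
have ReJ (z : C) : complex.Re ((z^*)%R) = complex.Re z by case: z.
have ImJ (z : C) : complex.Im ((z^*)%R) = - complex.Im z by case: z.
by apply: complex_ext; rewrite ?ReJ ?ImJ ?ReM ?ImM /= cosN sinN; ring.
Qed.

Lemma real_expi (u : R -> R) nu (x : R) :
  (u x)%:C * expi (nu * x) = (u x * cos (nu * x)) +i* (u x * sin (nu * x)).
Proof. by apply: complex_ext; rewrite ?ReM ?ImM /= mul0r ?subr0 ?addr0. Qed.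

Lemma cintegrable_expi (D : set (measurableTypeR R)) (u : R -> R) nu : measurable D ->
  mu.-integrable D (EFin \o (fun x => u x * cos (nu * x))) ->
  mu.-integrable D (EFin \o (fun x => u x * sin (nu * x))) ->
  cintegrable D (fun x => (u x)%:C * expi (nu * x)).
Proof.
by move=> mD h1 h2; split; [apply: eq_integrable h1|apply: eq_integrable h2] => // x _;
  rewrite /comp real_expi.
Qed.

Lemma cintegral_expi (D : set (measurableTypeR R)) (u : R -> R) nu :
  cintegral D (fun x => (u x)%:C * expi (nu * x)) =
  (\int[mu]_(x in D) (u x * cos (nu * x))) +i* (\int[mu]_(x in D) (u x * sin (nu * x))).
Proof.
by rewrite /cintegral; congr (_ +i* _); apply: eq_Rintegral => x _; rewrite real_expi.
Qed.

End complex_integral.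

(** * Integrals of exponentials over [(-1/2, 1/2)] *)

Section exponential_integral.
Context {R : realType}.
Local Notation mu := (@lebesgue_measure R).
Implicit Types (y s : R).

Let halfD : set (measurableTypeR R) := `](- 2^-1), 2^-1[%classic.

Let measurable_half : measurable halfD. Proof. exact: measurable_itv. Qed.

Lemma integrable_half_expR y : mu.-integrable halfD (EFin \o (fun s => expR (s * y))).
Proof.
apply: measurable_bounded_integrable => //.
- change (mu (`](- 2^-1)%R, 2^-1%R[%classic : set R) < +oo)%E.
  by rewrite lebesgue_measure_itv/=; case: ifP => _; rewrite ?ltry// -EFinB ltry.
- by apply: measurable_funTS; apply: measurableT_comp => //; exact: measurable_funM.
- exists (expR `|y|); split; first exact: num_real.
  move=> M yM s; rewrite /halfD /= in_itv/= => /andP[s1 s2].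
  rewrite ger0_norm ?expR_ge0//; apply: le_trans (ltW yM); rewrite ler_expR.
  apply: le_trans (ler_norm _) _; rewrite normrM ler_piMl// ler_norml.
  by apply/andP; split; lra.
Qed.

(** Kept in product form, the identity holds at [y = 0] as well and feeds directly on the factor [y]
    supplied by a commutator. *)
Lemma Rintegral_half_expR y :
  y * \int[mu]_(s in halfD) expR (s * y) = expR (y / 2) - expR (- (y / 2)).
Proof.
rewrite -RintegralZl//; last exact: integrable_half_expR.
have D s : is_derive s 1 (fun s => expR (s * y)) (y * expR (s * y)).
  have := is_derive1_scale (f := @expR R) (b := y) (x := s) (is_derive_expR (y * s)).
  by rewrite [y * s]mulrC; under eq_fun do rewrite mulrC.
have cE := is_derive1_continuous D.
have cD : continuous (fun s => y * expR (s * y)).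
  by apply: continuous_mul => //; move=> x; exact: cvg_cst.
rewrite /Rintegral /halfD integral_itv_obnd_cbnd; last first.
  by apply/measurable_EFinP/measurable_funTS; exact: continuous_measurable_fun.
rewrite integral_itv_bndo_bndc; last first.
  by apply/measurable_EFinP/measurable_funTS; exact: continuous_measurable_fun.
rewrite (continuous_FTC2 (F := fun s => expR (s * y)))//=.
- by rewrite mulNr mulrC.
- lra.
- by apply: continuous_subspaceT => x; exact: cD.
- split.
  + by move=> x _; case: (D x).
  + by apply: cvg_at_right_filter; exact: cE.
  + by apply: cvg_at_left_filter; exact: cE.
- by move=> x _; rewrite derive1E; case: (D x).
Qed.

End exponential_integral.

(** * Exchange of two integrals of nonnegative functions *)

Section tonelli.
Context {R : realType}.
Local Notation mu := (@lebesgue_measure R).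

(** Multiplication by the indicator of [D] extends the integrand by 0; it is needed because [g_s] is
    known to be nonnegative for [|s| < 1/2] only. *)
Lemma tonelli_swap (D : set (measurableTypeR R)) (G : R -> R -> R) : measurable D ->
  measurable_fun setT (fun z : measurableTypeR R * measurableTypeR R => G z.1 z.2) ->
  (forall x s, D s -> 0 <= G x s) ->
  (\int[mu]_x \int[mu]_(s in D) (G x s)%:E = \int[mu]_(s in D) \int[mu]_x (G x s)%:E)%E.
Proof.
move=> mD mG G0.
pose F (z : measurableTypeR R * measurableTypeR R) : \bar R := (G z.1 z.2 * \1_D z.2)%:E.
have mF : measurable_fun setT F.
  apply/measurable_EFinP; apply: measurable_funM => //.
  exact: (measurableT_comp (measurable_indic mD) measurable_snd).
have F0 z : (0 <= F z)%E.
  rewrite /F lee_fin indicE; have [/set_mem Dz|_] := boolP (z.2 \in D).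
    by rewrite mulr1; exact: G0.
  by rewrite mulr0.
have := @fubini_tonelli _ _ _ _ _ mu mu F mF F0.
rewrite [LHS](_ : _ = \int[mu]_x \int[mu]_(s in D) (G x s)%:E)%E; last first.
  apply: eq_integral => x _; rewrite [RHS]integral_mkcond.
  apply: eq_integral => s _; rewrite /F patchE indicE /=.
  by case: ifP => _; rewrite ?mulr1 ?mulr0.
move=> ->; rewrite [RHS]integral_mkcond; apply: eq_integral => s _.
rewrite patchE; case: ifPn => sD.
  by apply: eq_integral => x _; rewrite /F /= indicE sD mulr1.
by rewrite -[RHS](integral0 mu setT); apply: eq_integral => x _; rewrite /F /= indicE (negbTE sD) mulr0.
Qed.

End tonelli.

(** * Bohr components *)

Local Open Scope sesquilinear_scope.

Section adjoint.
Context {C : numClosedFieldType} {m : nat}.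
Implicit Types X Y : 'M[C]_m.

Lemma adjmxM X Y : (X *m Y) ^t* = Y ^t* *m X ^t*.
Proof. by rewrite trmx_mul map_mxM. Qed.

Lemma adjmxB X Y : (X - Y) ^t* = X ^t* - Y ^t*.
Proof. by rewrite linearB/= map_mxB. Qed.

Lemma adjmxZ (z : C) X : (z *: X) ^t* = z ^* *: X ^t*.
Proof. by rewrite linearZ/= map_mxZ. Qed.

Lemma adjmx_sum (I : finType) (F : I -> 'M[C]_m) :
  (\sum_i F i) ^t* = \sum_i (F i) ^t*.
Proof. by rewrite linear_sum/= map_mx_sum. Qed.

Lemma hermsymmx_adj X : X \is hermsymmx -> X ^t* = X.
Proof. by move/is_hermitianmxP => {2}->; rewrite expr0 scale1r. Qed.

End adjoint.

(** * Spectral projections and functions in a fixed eigenbasis *)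

Section unitary_functions.
Context {C : numClosedFieldType} {m : nat} (V : 'M[C]_m).
Hypothesis Vu : V \is unitarymx.
Implicit Types (g : 'I_m -> C).

Let VK : V *m V ^t* = 1%:M. Proof. exact/unitarymxP. Qed.
Let VK' : V ^t* *m V = 1%:M. Proof. exact: mulmx1C. Qed.

Definition uproj (i : 'I_m) : 'M[C]_m := V ^t* *m delta_mx i i *m V.

(** The function lives on positions rather than on eigenvalues, so degenerate spectra need no
    separate treatment. The adjoint stands on the left to match the convention of [spectralmx]. *)
Definition ufun g : 'M[C]_m := V ^t* *m diag_mx (\row_i g i) *m V.

Lemma ufunE g : ufun g = \sum_i g i *: uproj i.
Proof.
rewrite /ufun diag_mx_sum_delta mulmx_sumr mulmx_suml.
by apply: eq_bigr => i _; rewrite mxE -scalemxAr -scalemxAl.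
Qed.

Lemma uproj_mul i j : uproj i *m uproj j = (i == j)%:R *: uproj i.
Proof.
have -> : uproj i *m uproj j = V ^t* *m (delta_mx i i *m (V *m V ^t*) *m delta_mx j j) *m V.
  by rewrite /uproj !mulmxA.
rewrite VK mulmx1 mul_delta_mx_cond /uproj; case: eqVneq => [->|_].
  by rewrite mulr1n scale1r.
by rewrite mulr0n scale0r mulmx0 mul0mx.
Qed.

Lemma uproj_sum : \sum_i uproj i = 1%:M.
Proof.
rewrite -mulmx_suml -mulmx_sumr.
have -> : \sum_i delta_mx i i = 1%:M :> 'M[C]_m.
  apply/matrixP => i j; rewrite summxE mxE (bigD1 i)//= mxE eqxx/= big1; last first.
    by move=> k ki; rewrite mxE [i == k]eq_sym (negbTE ki).
  by rewrite addr0 eq_sym.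
by rewrite mulmx1.
Qed.

Lemma uproj_adj i : (uproj i) ^t* = uproj i.
Proof.
rewrite /uproj !adjmxM trmxCK mulmxA; congr (_ *m _ *m _).
by rewrite trmx_delta map_delta_mx.
Qed.

Lemma ufun_mul_uproj g j : ufun g *m uproj j = g j *: uproj j.
Proof.
rewrite ufunE mulmx_suml (bigD1 j)//= -scalemxAl uproj_mul eqxx scale1r.
rewrite big1 ?addr0// => i ij.
by rewrite -scalemxAl uproj_mul (negbTE ij) scale0r scaler0.
Qed.

Lemma uproj_mul_ufun g j : uproj j *m ufun g = g j *: uproj j.
Proof.
rewrite ufunE mulmx_sumr (bigD1 j)//= -scalemxAr uproj_mul eqxx scale1r.
rewrite big1 ?addr0// => i ij.
by rewrite -scalemxAr uproj_mul eq_sym (negbTE ij) scale0r scaler0.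
Qed.

Lemma ufun_adj g : (ufun g) ^t* = ufun (fun i => (g i) ^*).
Proof.
rewrite !ufunE adjmx_sum; apply: eq_bigr => i _.
by rewrite adjmxZ uproj_adj.
Qed.

Lemma tr_ufun g : \tr (ufun g) = \sum_i g i.
Proof.
rewrite /ufun mxtrace_mulC mulmxA VK mul1mx /mxtrace.
by apply: eq_bigr => i _; rewrite !mxE eqxx mulr1n.
Qed.

Definition ubasis (X : 'M[C]_m) : 'M[C]_m := V *m X *m V ^t*.

Lemma tr_sandwich_ufun (f g : 'I_m -> C) (X Y : 'M[C]_m) :
  \tr (X ^t* *m ufun f *m Y *m ufun g) =
  \sum_i \sum_j (ubasis X i j) ^* * f i * ubasis Y i j * g j.
Proof.
rewrite /ufun; set D1 := diag_mx _; set D2 := diag_mx _.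
rewrite !mulmxA mxtrace_mulC !mulmxA.
have -> : V *m X ^t* *m V ^t* *m D1 *m V *m Y *m V ^t* *m D2 =
    (ubasis X) ^t* *m D1 *m ubasis Y *m D2.
  by rewrite /ubasis !adjmxM trmxCK !mulmxA.
rewrite /mxtrace exchange_big; apply: eq_bigr => j _.
rewrite mul_mx_diag mxE mxE mulr_suml; apply: eq_bigr => i _.
by rewrite mul_mx_diag !mxE.
Qed.

Lemma ufun1 : ufun (fun=> 1) = 1%:M.
Proof. by rewrite ufunE -uproj_sum; apply: eq_bigr => i _; rewrite scale1r. Qed.

Lemma tr_ufun_left (f : 'I_m -> C) (X Y : 'M[C]_m) : \tr (X^t* *m ufun f *m Y) =
  \sum_i \sum_j (ubasis X i j)^* * f i * ubasis Y i j.
Proof.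
rewrite -[_ *m Y]mulmx1 -ufun1 tr_sandwich_ufun.
by apply: eq_bigr => i _; apply: eq_bigr => j _; rewrite mulr1.
Qed.

Lemma tr_ufun_right (g : 'I_m -> C) (X Y : 'M[C]_m) : \tr (X^t* *m Y *m ufun g) =
  \sum_i \sum_j (ubasis X i j)^* * ubasis Y i j * g j.
Proof.
rewrite -[X^t*]mulmx1 -ufun1 tr_sandwich_ufun.
by apply: eq_bigr => i _; apply: eq_bigr => j _; rewrite mulr1.
Qed.

Lemma ubasis_comm g (X : 'M[C]_m) i j :
  ubasis (ufun g *m X - X *m ufun g) i j = (g i - g j) * ubasis X i j.
Proof.
have -> : ubasis (ufun g *m X - X *m ufun g) =
    diag_mx (\row_i g i) *m ubasis X - ubasis X *m diag_mx (\row_i g i).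
  rewrite /ubasis /ufun mulmxBr mulmxBl; congr (_ - _).
    by rewrite !mulmxA VK mul1mx.
  by rewrite -!mulmxA VK mulmx1.
by rewrite mul_diag_mx mul_mx_diag; move: (ubasis X) => B; rewrite !mxE mulrBl [X in _ - X]mulrC.
Qed.

Lemma ubasisD (X Y : 'M[C]_m) : ubasis (X + Y) = ubasis X + ubasis Y.
Proof. by rewrite /ubasis mulmxDr mulmxDl. Qed.

Lemma ubasisZ (z : C) (X : 'M[C]_m) : ubasis (z *: X) = z *: ubasis X.
Proof. by rewrite /ubasis -scalemxAr -scalemxAl. Qed.

(** Components are indexed by pairs of eigenvectors, a refinement of the usual splitting by distinct
    energy differences; equal differences may occur for several pairs. *)
Definition bohr (X : 'M[C]_m) (p : 'I_m * 'I_m) : 'M[C]_m := uproj p.1 *m X *m uproj p.2.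

Lemma bohr_sum X : X = \sum_p bohr X p.
Proof.
rewrite -(pair_bigA _ (fun i j => bohr X (i, j)))/= /bohr/=.
under eq_bigr do rewrite -mulmx_sumr uproj_sum mulmx1.
by rewrite -mulmx_suml uproj_sum mul1mx.
Qed.

Lemma bohr_adj X p : X ^t* = X -> (bohr X p) ^t* = bohr X (p.2, p.1).
Proof. by move=> Xh; rewrite /bohr (adjmxM (uproj p.1 *m X)) (adjmxM (uproj p.1)) !uproj_adj Xh mulmxA. Qed.

Lemma ufun_bohr f g X p :
  ufun f *m bohr X p *m ufun g = (f p.1 * g p.2) *: bohr X p.
Proof.
have assoc (a b c d e : 'M[C]_m) : a *m (b *m c *m d) *m e = (a *m b) *m c *m (d *m e).
  by rewrite !mulmxA.
rewrite /bohr assoc ufun_mul_uproj uproj_mul_ufun -scalemxAr -scalemxAl -scalemxAl.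
by rewrite scalerA mulrC.
Qed.

Lemma ufun_comm_bohr g X p :
  ufun g *m bohr X p - bohr X p *m ufun g = (g p.1 - g p.2) *: bohr X p.
Proof.
have assocl (a b c d : 'M[C]_m) : a *m (b *m c *m d) = (a *m b) *m c *m d.
  by rewrite !mulmxA.
have assocr (b c d e : 'M[C]_m) : b *m c *m d *m e = b *m c *m (d *m e).
  by rewrite !mulmxA.
rewrite /bohr assocl ufun_mul_uproj assocr uproj_mul_ufun -scalemxAr -scalemxAl -scalemxAl.
by rewrite scalerBl.
Qed.

End unitary_functions.

(** With [M = V W^*] the equality says [(x_i - y_j) M_ij = 0], so [x_i = y_j], and then
    [x'_i = y'_j], wherever [M_ij] is nonzero. It makes the functional calculus independent of the
    eigenbasis. *)
Lemma diag_intertwine (C : numClosedFieldType) m (V W : 'M[C]_m)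
    (x y x' y' : 'I_m -> C) :
  V \is unitarymx -> W \is unitarymx ->
  ufun V x = ufun W y -> (forall i j, x i = y j -> x' i = y' j) ->
  ufun V x' = ufun W y'.
Proof.
move=> Vu Wu E h.
have VK : V *m V ^t* = 1%:M by apply/unitarymxP.
have WK : W *m W ^t* = 1%:M by apply/unitarymxP.
have VK' : V ^t* *m V = 1%:M by exact: mulmx1C.
have WK' : W ^t* *m W = 1%:M by exact: mulmx1C.
pose M := V *m W ^t*.
have red (u v : 'I_m -> C) : diag_mx (\row_i u i) *m M = M *m diag_mx (\row_i v i) <->
    ufun V u = ufun W v.
  split => H.
    transitivity (V ^t* *m (diag_mx (\row_i u i) *m M) *m W).
      by rewrite /M /ufun -!mulmxA WK' mulmx1.
    by rewrite H /M /ufun !mulmxA VK' mul1mx.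
  transitivity (V *m ufun V u *m W ^t*).
    by rewrite /ufun /M !mulmxA VK mul1mx.
  by rewrite H /ufun /M -!mulmxA WK mulmx1.
apply/red; move/red: E => E; apply/matrixP => i j; move/matrixP/(_ i j): E.
rewrite !mul_diag_mx !mul_mx_diag !mxE.
set z := \sum_k _; have [->|z0] := eqVneq z 0; first by rewrite !mulr0 !mul0r.
rewrite mulrC => /(mulfI z0) /h ->.
by rewrite mulrC.
Qed.

(** * Spectral decomposition of normal and Hermitian matrices *)

Section unitary_functions_spectral.
Context {C : numClosedFieldType} {m : nat}.
Implicit Types (A V : 'M[C]_m) (f g : 'I_m -> C).

Lemma eq_ufun V f g : f =1 g -> ufun V f = ufun V g.
Proof.
by move=> fg; rewrite /ufun; congr (_ *m diag_mx _ *m _); apply/rowP => i; rewrite !mxE fg.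
Qed.

Lemma ufunZ V (z : C) f : z *: ufun V f = ufun V (fun i => z * f i).
Proof. by rewrite !ufunE scaler_sumr; apply: eq_bigr => i _; rewrite scalerA. Qed.

Lemma conj_diag_ufun V (r : 'rV[C]_m) : V \is unitarymx ->
  invmx V *m diag_mx r *m V = ufun V (r 0).
Proof.
move=> Vu; rewrite invmx_unitary// /ufun; congr (_ *m diag_mx _ *m _).
by apply/rowP => i; rewrite mxE.
Qed.

Lemma ufun_self_adj V f : (forall i, (f i)^* = f i) -> (ufun V f) ^t* = ufun V f.
Proof. by move=> fr; rewrite ufun_adj; exact: eq_ufun. Qed.

Lemma normalmx_ufun A : A \is normalmx -> A = ufun (spectralmx A) (spectral_diag A 0).
Proof.
move=> An; rewrite {1}(orthomx_spectralP An) conj_diag_ufun//.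
exact: spectral_unitarymx.
Qed.

Lemma ufun_hermsymmx V f : (forall i, (f i)^* = f i) -> ufun V f \is hermsymmx.
Proof.
move=> fr; apply/is_hermitianmxP; rewrite expr0 scale1r ufun_adj.
by apply: eq_ufun => i; rewrite fr.
Qed.

(** Testing positivity on the columns of the adjoint of [V] gives [f i >= 0]; full rank makes the
    determinant, hence every factor [f i], nonzero. *)
Lemma ufun_psd_gt0 V f : V \is unitarymx ->
  (forall v : 'cV[C]_m, 0 <= (v ^t* *m ufun V f *m v) 0 0) ->
  \rank (ufun V f) = m -> forall i, 0 < f i.
Proof.
move=> Vu psd rk i.
have VK : V *m V ^t* = 1%:M by apply/unitarymxP.
have Vf (v : 'cV[C]_m) : v = V ^t* *m delta_mx i 0 ->
    v ^t* *m ufun V f *m v = (f i)%:M.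
  move=> ->.
  have -> : (V ^t* *m delta_mx i 0) ^t* = delta_mx 0 i *m V :> 'rV[C]_m.
    by rewrite trmx_mul map_mxM trmx_delta map_delta_mx trmxCK.
  have -> : delta_mx 0 i *m V *m ufun V f *m (V ^t* *m delta_mx i 0) =
      delta_mx 0 i *m (V *m V ^t*) *m diag_mx (\row_i f i) *m (V *m V ^t*) *m delta_mx i 0 :> 'M[C]_1.
    by rewrite /ufun !mulmxA.
  rewrite VK !mulmx1; apply/matrixP => j k; rewrite !ord1 -rowE -colE.
  by rewrite !mxE !eqxx.
have fi : 0 <= f i.
  by have := psd (V ^t* *m delta_mx i 0); rewrite Vf// mxE eqxx mulr1n.
rewrite lt_def fi andbT.
have : ufun V f \in unitmx by rewrite -row_free_unit /row_free rk.
rewrite unitmxE /ufun !det_mulmx !unitrM => /andP[/andP[_ +] _].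
by rewrite det_diag unitfE => /prodf_neq0/(_ i isT); rewrite mxE.
Qed.

End unitary_functions_spectral.

(** * Sandwiches and commutators of linear combinations *)

Section pair_sums.
Context {C : numClosedFieldType} {m : nat} {P : finType}.
Implicit Types (phi : P -> C) (a b : P -> 'M[C]_m) (S T X : 'M[C]_m).

Lemma adj_sumZ phi a : (\sum_p phi p *: a p) ^t* = \sum_p (phi p)^* *: (a p) ^t*.
Proof. by rewrite adjmx_sum; apply: eq_bigr => p _; rewrite adjmxZ. Qed.

Lemma adj_mul_sumZ phi a S T :
  (\sum_p phi p *: a p) ^t* *m S *m (\sum_p phi p *: a p) *m T =
  \sum_(r : P * P) ((phi r.2)^* * phi r.1) *: ((a r.2) ^t* *m S *m a r.1 *m T).
Proof.
rewrite adj_sumZ -(pair_bigA _ (fun p q => ((phi q)^* * phi p) *: ((a q) ^t* *m S *m a p *m T)))/=.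
rewrite mulmx_sumr mulmx_suml; apply: eq_bigr => p _.
rewrite !mulmx_suml; apply: eq_bigr => q _.
by rewrite -!scalemxAl -scalemxAr -scalemxAl scalerA.
Qed.

Lemma sumZ_mul_adj phi a X :
  (\sum_p phi p *: a p) *m X *m (\sum_p phi p *: a p) ^t* =
  \sum_(r : P * P) ((phi r.2)^* * phi r.1) *: (a r.1 *m X *m (a r.2) ^t*).
Proof.
rewrite adj_sumZ -(pair_bigA _ (fun p q => ((phi q)^* * phi p) *: (a p *m X *m (a q) ^t*)))/=.
rewrite !mulmx_suml; apply: eq_bigr => p _.
rewrite mulmx_sumr; apply: eq_bigr => q _.
by rewrite -!scalemxAl -scalemxAr scalerA mulrC.
Qed.

Lemma tr_adj_sumZ phi a S T :
  \tr ((\sum_p phi p *: a p) ^t* *m S *m (\sum_p phi p *: a p) *m T) =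
  \sum_(r : P * P) ((phi r.2)^* * phi r.1) * \tr ((a r.2) ^t* *m S *m a r.1 *m T).
Proof.
by rewrite adj_mul_sumZ raddf_sum/=; apply: eq_bigr => r _; rewrite linearZ.
Qed.

Lemma comm_sumZ phi a X :
  (\sum_p phi p *: a p) *m X - X *m (\sum_p phi p *: a p) =
  \sum_p phi p *: (a p *m X - X *m a p).
Proof.
rewrite mulmx_suml mulmx_sumr -sumrB; apply: eq_bigr => p _.
by rewrite -scalemxAl -scalemxAr scalerBr.
Qed.

Lemma acomm_sumZ phi a X :
  (\sum_p phi p *: a p) *m X + X *m (\sum_p phi p *: a p) =
  \sum_p phi p *: (a p *m X + X *m a p).
Proof.
rewrite mulmx_suml mulmx_sumr -big_split; apply: eq_bigr => p _ /=.
by rewrite -scalemxAl -scalemxAr scalerDr.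
Qed.

Lemma scaler_collect (z w r t : C) S T : z * w = r * t ->
  z *: (w *: S) + r *: T = r *: (t *: S + T).
Proof. by move=> e; rewrite scalerDr !scalerA e. Qed.

End pair_sums.

Section bohr_sandwich.
Context {C : numClosedFieldType} {m : nat} (V : 'M[C]_m).
Hypothesis Vu : V \is unitarymx.

Lemma ufun_sandwich f g (X : 'M[C]_m) :
  ufun V f *m X *m ufun V g = \sum_p (f p.1 * g p.2) *: bohr V X p.
Proof.
rewrite {1}(bohr_sum Vu X) mulmx_sumr mulmx_suml; apply: eq_bigr => p _.
exact: ufun_bohr.
Qed.

Lemma ufun_sandwich_bohr f g phi (X : 'M[C]_m) :
  ufun V f *m (\sum_p phi p *: bohr V X p) *m ufun V g =
  \sum_p (phi p * (f p.1 * g p.2)) *: bohr V X p.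
Proof.
rewrite mulmx_sumr mulmx_suml; apply: eq_bigr => p _.
by rewrite -scalemxAr -scalemxAl ufun_bohr// scalerA.
Qed.

End bohr_sandwich.

(** * Cyclic rearrangement of traces *)

Section trace_expansions.
Context {C : comNzRingType} {m : nat}.
Implicit Types A B Q S D : 'M[C]_m.

Lemma mxtrace_mulZl (z : C) A D : \tr (z *: A *m D) = z * \tr (A *m D).
Proof. by rewrite -scalemxAl linearZ. Qed.

Lemma mxtrace_rot4 A B S D : \tr (A *m B *m S *m D) = \tr (D *m A *m B *m S).
Proof. by rewrite mxtrace_mulC !mulmxA. Qed.

Lemma mxtrace_commx1 Q S A D : \tr ((D *m Q - Q *m D) *m S *m A) =
  \tr (Q *m S *m A *m D) - \tr (Q *m D *m S *m A).
Proof. by rewrite !mulmxBl raddfB/= (mxtrace_rot4 Q S A D). Qed.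

Lemma mxtrace_commx3 Q S A D : \tr (Q *m S *m (A *m D - D *m A)) =
  \tr (Q *m S *m A *m D) - \tr (Q *m S *m D *m A).
Proof. by rewrite !mulmxBr raddfB/= !mulmxA. Qed.

Lemma mxtrace_commx2 Q S A D : \tr (Q *m (A *m D - D *m A) *m S) =
  \tr (Q *m A *m D *m S) - \tr (Q *m D *m A *m S).
Proof. by rewrite mulmxBr mulmxBl raddfB/= !mulmxA. Qed.

(** Cyclicity brings every term to a word starting with [Q]; for [Q = a_q^*] and [A = a_p] only
    three different words survive. *)
Lemma mxtrace_dissipator A Q S D (th h : C) :
  \tr ((th *: (Q *m A *m S - S *m (Q *m A)) + (A *m S *m Q
    - h *: (Q *m A *m S + S *m (Q *m A)))) *m D) =
  th * (\tr (Q *m A *m S *m D) - \tr (Q *m A *m D *m S)) + \tr (Q *m D *m A *m S)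
  - h * (\tr (Q *m A *m S *m D) + \tr (Q *m A *m D *m S)).
Proof.
rewrite mulmxDl mulmxBl -!scalemxAl raddfD/= raddfB/= !linearZ/=.
rewrite mulmxBl mulmxDl raddfB/= raddfD/= !mulmxA.
have -> : \tr (A *m S *m Q *m D) = \tr (Q *m D *m A *m S).
  by rewrite [RHS]mxtrace_rot4 [RHS]mxtrace_rot4.
have -> : \tr (S *m Q *m A *m D) = \tr (Q *m A *m D *m S) by rewrite [RHS]mxtrace_rot4.
by rewrite addrA.
Qed.

End trace_expansions.

(** * The algebraic identity between entropy production and Fisher information *)

Section bohr_identity.
Context {C : numClosedFieldType} {m : nat} {P : finType}.
Variables (sw : P -> P) (a : P -> 'M[C]_m) (sigma D : 'M[C]_m).
Variables (eta : P -> P -> C) (u : P -> C).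
Hypotheses (swK : involutive sw) (a_adj : forall p, (a p) ^t* = a (sw p)).
Hypotheses (D_adj : D ^t* = D) (u0 : forall p, u p != 0).
Hypothesis u_sw : forall p, u (sw p) = (u p)^-1.
Hypothesis uu0 : forall p q, u p ^+ 2 + u q ^+ 2 != 0.
Hypothesis eta_sw : forall p q, eta (sw q) (sw p) = eta p q.

Let B p : 'M[C]_m := a p *m D - D *m a p.

(** For [u p = e^(beta nu_p / 4)] this is [tanh (beta (nu_p - nu_q) / 4)]; [bohr_sech] is then one
    half of the corresponding [sech]. *)
Definition bohr_tanh p q : C := (u p ^+ 2 - u q ^+ 2) / (u p ^+ 2 + u q ^+ 2).

Definition bohr_sech p q : C := u p * u q / (u p ^+ 2 + u q ^+ 2).

Definition bohr_fisher p q : C :=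
  - (u p ^+ 2 * \tr ((B q) ^t* *m sigma *m a p)
     - u p ^- 2 * \tr ((B q) ^t* *m a p *m sigma))
  - (u q ^+ 2 * \tr ((a q) ^t* *m sigma *m B p)
     - u q ^- 2 * \tr ((a q) ^t* *m B p *m sigma)).

Definition bohr_generator p q : 'M[C]_m :=
  (2^-1 * bohr_tanh p q) *: ((a q) ^t* *m a p *m sigma - sigma *m ((a q) ^t* *m a p))
  + (a p *m sigma *m (a q) ^t*
     - 2^-1 *: ((a q) ^t* *m a p *m sigma + sigma *m ((a q) ^t* *m a p))).

(** In [X], [Y], [Z] the state stands after [a_p], in [X1], [Y1], [Z1] before it. The swap exchanges
    the two families: [X1] with [X], [Y1] with [Z], [Z1] with [Y]. *)
Let X p q := \tr ((a q) ^t* *m D *m a p *m sigma).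
Let Y p q := \tr ((a q) ^t* *m a p *m sigma *m D).
Let Z p q := \tr ((a q) ^t* *m a p *m D *m sigma).
Let X1 p q := \tr ((a q) ^t* *m sigma *m a p *m D).
Let Y1 p q := \tr ((a q) ^t* *m D *m sigma *m a p).
Let Z1 p q := \tr ((a q) ^t* *m sigma *m D *m a p).

Let B_adj q : (B q) ^t* = D *m (a q) ^t* - (a q) ^t* *m D.
Proof. by rewrite /B adjmxB !adjmxM D_adj. Qed.

Let fisherE p q : bohr_fisher p q =
  - (u p ^+ 2 * (X1 p q - Y1 p q) - u p ^- 2 * (Y p q - X p q))
  - (u q ^+ 2 * (X1 p q - Z1 p q) - u q ^- 2 * (Z p q - X p q)).
Proof.
by rewrite /bohr_fisher B_adj /B !mxtrace_commx1 mxtrace_commx3 mxtrace_commx2.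
Qed.

Let a_adj2 p : (a (sw p)) ^t* = a p. Proof. by rewrite a_adj swK. Qed.

Let X1_sw p q : X1 (sw q) (sw p) = X p q.
Proof. by rewrite /X1 /X a_adj2 -a_adj [RHS]mxtrace_rot4 [RHS]mxtrace_rot4. Qed.

Let Y1_sw p q : Y1 (sw q) (sw p) = Z p q.
Proof. by rewrite /Y1 /Z a_adj2 -a_adj [LHS]mxtrace_rot4. Qed.

Let Z1_sw p q : Z1 (sw q) (sw p) = Y p q.
Proof. by rewrite /Z1 /Y a_adj2 -a_adj [LHS]mxtrace_rot4. Qed.

Let generatorE p q : \tr (bohr_generator p q *m D) =
  2^-1 * bohr_tanh p q * (Y p q - Z p q) + X p q - 2^-1 * (Y p q + Z p q).
Proof. exact: mxtrace_dissipator. Qed.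

(** Pair by pair the two sides differ: the generator yields the words [X], [Y], [Z] only, the Fisher
    term all six. The common weight [w] is invariant under the swap, which turns [u^2] into [u^-2]
    and the second family into the first, so the two halves of the Fisher sum agree. The entropy
    side is exactly twice one half. *)
Lemma bohr_entropy_identity :
  - \sum_(r : P * P) eta r.1 r.2 / (u r.1 * u r.2) * \tr (bohr_generator r.1 r.2 *m D) =
  \sum_(r : P * P) eta r.1 r.2 * (2^-1 * bohr_sech r.1 r.2) * bohr_fisher r.1 r.2.
Proof.
pose w p q : C := eta p q * (2^-1 * bohr_sech p q).
have w_sw p q : w (sw q) (sw p) = w p q.
  rewrite /w /bohr_sech !u_sw eta_sw; congr (_ * (_ * _)).
  have hp := u0 p; have hq := u0 q; have h := uu0 p q.
  field.
  by rewrite hp hq h/=.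
pose swr (r : P * P) := (sw r.2, sw r.1).
have swrK : involutive swr by move=> [p q]; rewrite /swr /= !swK.
have swap (F : P -> P -> C) : \sum_(r : P * P) w r.1 r.2 * F r.1 r.2 =
    \sum_(r : P * P) w r.1 r.2 * F (sw r.2) (sw r.1).
  rewrite (reindex_inj (inv_inj swrK))/=; apply: eq_bigr => r _.
  by rewrite w_sw.
transitivity (\sum_(r : P * P) w r.1 r.2 *
    (2 * (u r.1 ^- 2 * (Y r.1 r.2 - X r.1 r.2) + u r.2 ^- 2 * (Z r.1 r.2 - X r.1 r.2)))).
  rewrite -sumrN; apply: eq_bigr => -[p q] _ /=.
  rewrite generatorE /w /bohr_tanh /bohr_sech.
  have hp := u0 p; have hq := u0 q; have h := uu0 p q.
  move: (X p q) (Y p q) (Z p q) (eta p q) => x y z e.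
  field.
  by rewrite hp hq h.
have -> : \sum_(r : P * P) eta r.1 r.2 * (2^-1 * bohr_sech r.1 r.2) * bohr_fisher r.1 r.2 =
  \sum_(r : P * P) w r.1 r.2 * (u r.1 ^- 2 * (Y r.1 r.2 - X r.1 r.2) + u r.2 ^- 2 * (Z r.1 r.2 - X r.1 r.2))
  + \sum_(r : P * P) w r.1 r.2 * (- (u r.1 ^+ 2 * (X1 r.1 r.2 - Y1 r.1 r.2)
     + u r.2 ^+ 2 * (X1 r.1 r.2 - Z1 r.1 r.2))).
  rewrite -big_split; apply: eq_bigr => r _ /=; rewrite fisherE -/(w _ _); ring.
rewrite [X in _ = _ + X](swap (fun p q => - (u p ^+ 2 * (X1 p q - Y1 p q) + u q ^+ 2 * (X1 p q - Z1 p q)))).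
rewrite -big_split; apply: eq_bigr => r _ /=.
rewrite X1_sw Y1_sw Z1_sw !u_sw !exprVn; ring.
Qed.

End bohr_identity.

Local Open Scope complex_scope.

(** * Spectral form of the Lindbladian and of the Fisher information *)

Section functional_calculus.
Context {R : realType} {m : nat}.
Local Notation C := R[i].
Implicit Types (A V W : 'M[C]_m) (d x : 'I_m -> R).

(** One basis serves all functions at once, so powers and logarithms of the same matrix are
    simultaneously diagonal. *)
Lemma hermfun_spectral A : exists V d, [/\ V \is unitarymx,
  forall f : R -> C, hermfun f A = ufun V (fun i => f (d i))
  & A \is hermsymmx -> A = ufun V (fun i => (d i)%:C)].
Proof.
exists (spectralmx A), (fun i => complex.Re (spectral_diag A 0 i)).
have Vu := spectral_unitarymx A; split; first exact: Vu.
  move=> f; apply: etrans (conj_diag_ufun _ Vu) _.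
  by apply: eq_ufun => i; rewrite mxE.
move=> Ah; apply: etrans (normalmx_ufun (hermitian_normalmx Ah)) _.
apply: eq_ufun => i.
have := hermitian_spectral_diag_real Ah => /mxOverP/(_ 0 i).
by case: (spectral_diag A 0 i) => a b; rewrite complex_real => /= /eqP ->.
Qed.

(** The eigenbasis chosen by [hermfun] need not be [V]; [diag_intertwine] compares the two. *)
Lemma hermfun_ufun V x (f : R -> C) : V \is unitarymx ->
  hermfun f (ufun V (fun i => (x i)%:C)) = ufun V (fun i => f (x i)).
Proof.
move=> Vu.
have Ah : ufun V (fun i => (x i)%:C) \is hermsymmx.
  by apply: ufun_hermsymmx => i; exact: conjc_real.
have [W [d [Wu fE AE]]] := hermfun_spectral (ufun V (fun i => (x i)%:C)).
rewrite fE; apply: (diag_intertwine (x' := fun i => f (d i)) (y' := fun i => f (x i)) Wu Vu (esym (AE Ah))).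
by move=> i j [->].
Qed.

(** The constant is [- ln Z], and a positive dimension makes the partition function [Z] positive. *)
Lemma gibbs_log (beta : R) V d : (0 < m)%N -> V \is unitarymx ->
  exists c : R, logmx (gibbs beta (ufun V (fun i => (d i)%:C))) =
    ufun V (fun i => (c - beta * d i)%:C).
Proof.
move=> m0 Vu; pose Z := \sum_i expR (- (beta * d i)).
have Z0 : 0 < Z.
  rewrite /Z (bigD1 (Ordinal m0))//=; apply: ltr_pwDl; first exact: expR_gt0.
  by apply: sumr_ge0 => i _; exact: expR_ge0.
exists (- ln Z); rewrite /logmx /gibbs /expmx.
have -> : - beta%:C *: ufun V (fun i => (d i)%:C) = ufun V (fun i => (- (beta * d i))%:C).
  by rewrite ufunZ; apply: eq_ufun => i; apply: complex_ext; rewrite ?ReM ?ImM /=; ring.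
rewrite (@hermfun_ufun V (fun i => - (beta * d i)) (fun y => (expR y)%:C) Vu) tr_ufun// ufunZ.
have -> : \sum_i (expR (- (beta * d i)))%:C = Z%:C.
  by rewrite /Z; elim/big_rec2: _ => // i x y _ ->; apply: complex_ext; rewrite ?ReD ?ImD /= ?addr0.
have -> : ufun V (fun i => (Z%:C)^-1 * (expR (- (beta * d i)))%:C) =
    ufun V (fun i => (Z^-1 * expR (- (beta * d i)))%:C).
  by apply: eq_ufun => i; rewrite -fmorphV -rmorphM.
apply: etrans (@hermfun_ufun V (fun i => Z^-1 * expR (- (beta * d i))) (fun y => (ln y)%:C) Vu) _.
apply: eq_ufun => i; congr (_%:C).
by rewrite lnM ?posrE ?invr_gt0 ?expR_gt0// lnV ?posrE// expRK.
Qed.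

Lemma state_spectral (sigma : 'M[C]_m) : is_state sigma -> \rank sigma = m ->
  exists V x, [/\ V \is unitarymx, forall i, 0 < x i,
    sigma = ufun V (fun i => (x i)%:C)
  & forall f : R -> C, hermfun f sigma = ufun V (fun i => f (x i))].
Proof.
move=> [sh s0 _] rk; have [V [x [Vu fE sE]]] := hermfun_spectral sigma.
have {}sE := sE sh; exists V, x; split => //.
rewrite sE in s0 rk; move=> i.
by have := ufun_psd_gt0 Vu s0 rk i; rewrite ltcR.
Qed.

End functional_calculus.

(** * Principal values of finite matrix sums *)

Section principal_value.
Context {R : realType} {m : nat}.
Local Notation C := R[i].

Lemma cvg_sum_mul (I : finType) (S : I -> R -> R) (l c : I -> R) :
  (forall i, S i e @[e --> (0 : R)^'+] --> l i) ->
  \sum_i S i e * c i @[e --> (0 : R)^'+] --> \sum_i l i * c i.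
Proof.
move=> Sl; elim: (index_enum I) => [|i r ih].
  by under eq_fun do rewrite big_nil; rewrite big_nil; exact: cvg_cst.
under eq_fun do rewrite big_cons; rewrite big_cons.
exact: (cvgD (cvgM (Sl i) (cvg_cst (c i))) ih).
Qed.

(** The principal value takes limits of real and imaginary parts entrywise. The cutoff dependence
    sits in the real factors [S i e], so both parts are real combinations of the same convergent
    functions. *)
Lemma pvmxintegral_sum (I : finType) (k : I -> C) (S : I -> R -> R) (l : I -> R)
    (B : I -> 'M[C]_m) (F : R -> 'M[C]_m) :
  (forall e, 0 < e ->
    mxintegral [set t : R | e < `|t|] F = \sum_i (k i * (S i e)%:C) *: B i) ->
  (forall i, S i e @[e --> (0 : R)^'+] --> l i) ->
  pvmxintegral F = \sum_i (k i * (l i)%:C) *: B i.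
Proof.
move=> FE Sl; apply/matrixP => r c; rewrite mxE.
have ent (s : I -> R) : (\sum_i (k i * (s i)%:C) *: B i) r c =
    (\sum_i s i * complex.Re (k i * B i r c)) +i* (\sum_i s i * complex.Im (k i * B i r c)).
  rewrite summxE; apply: complex_ext; rewrite ?Re_sum ?Im_sum; apply: eq_bigr => i _;
    rewrite mxE mulrAC [_ * _%:C]mulrC ?(ReM, ImM) /=; ring.
rewrite ent; congr (_ +i* _); apply: cvg_lim => //.
- apply: (cvg_trans _ (cvg_sum_mul (c := fun i => complex.Re (k i * B i r c)) Sl)).
  apply: near_eq_cvg; near=> e.
  have e0 : 0 < e by near: e; exact: nbhs_right_gt.
  by rewrite FE// ent.
- apply: (cvg_trans _ (cvg_sum_mul (c := fun i => complex.Im (k i * B i r c)) Sl)).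
  apply: near_eq_cvg; near=> e.
  have e0 : 0 < e by near: e; exact: nbhs_right_gt.
  by rewrite FE// ent.
Unshelve. all: by end_near. Qed.

End principal_value.

(** * Bohr expansion of the jump operators and of the Lindbladian *)

Section bohr_expansion.
Context {R : realType} {m : nat} (beta kappa : R) (H A V : 'M[R[i]]_m) (d : 'I_m -> R).
Hypotheses (beta0 : 0 < beta) (kappa0 : 0 < kappa) (Vu : V \is unitarymx).
Hypothesis HE : forall f : R -> R[i], hermfun f H = ufun V (fun i => f (d i)).
Local Notation C := R[i].
Local Notation mu := (@lebesgue_measure R).
Local Notation P := ('I_m * 'I_m)%type.

Definition bohr_freq (p : P) : R := d p.1 - d p.2.
Local Notation nu := bohr_freq.
Local Notation a := (bohr V A).

Lemma heisenberg_bohr t :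
  propagator H t *m A *m propagator H (- t) = \sum_p expi (nu p * t) *: a p.
Proof.
rewrite /propagator !HE; apply: etrans (ufun_sandwich Vu _ _ A) _.
by apply: eq_bigr => p _; rewrite -expiD /nu; congr (expi _ *: _); ring.
Qed.

Lemma jump_freq_bohr w :
  jump_freq kappa H A w = \sum_p (jump_profile kappa (w - nu p))%:C *: a p.
Proof.
rewrite /jump_freq.
pose phi (p : P) t := (gaussian_filter kappa t)%:C * expi ((nu p - w) * t).
have phi_int p : cintegrable setT (phi p).
  apply: cintegrable_expi => //; apply: (integrable_gaussian_filter kappa0).
  - exact/continuous_scale/continuous_cos.
  - by move=> t; exact: cos_max.
  - exact/continuous_scale/continuous_sin.
  - by move=> t; rewrite ler_norml sin_geN1 sin_le1.
rewrite (mxintegral_sum measurableT (phi := phi) (B := a)) => [||t _].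
- rewrite scaler_sumr; apply: eq_bigr => p _; rewrite scalerA; congr (_ *: _).
  rewrite /phi cintegral_expi gaussian_filter_sin//.
  rewrite -[w - nu p]opprB jump_profileN -gaussian_filter_cos//.
  by apply: complex_ext; rewrite ?ReM ?ImM /= ?mulr0 ?mul0r ?subr0 ?addr0.
- exact: phi_int.
- rewrite heisenberg_bohr scaler_sumr; apply: eq_bigr => p _.
  rewrite scalerA /phi; congr (_ *: _).
  have -> : (nu p - w) * t = - (w * t) + nu p * t by ring.
  by rewrite expiD; ring.
Qed.

Lemma jump_time_bohr w t : jump_time kappa H A w t =
  \sum_p ((jump_profile kappa (w - nu p))%:C * expi (nu p * t)) *: a p.
Proof.
rewrite /jump_time jump_freq_bohr /propagator !HE.
apply: etrans (ufun_sandwich_bohr Vu _ _ _ A) _.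
apply: eq_bigr => p _; rewrite -expiD /nu; congr ((_ * expi _) *: _); ring.
Qed.

Lemma conj_profile_mul (p q : P) w t :
  (((jump_profile kappa (w - nu q))%:C * expi (nu q * t))^*)%R *
    ((jump_profile kappa (w - nu p))%:C * expi (nu p * t)) =
  (pair_profile kappa (nu p) (nu q) w)%:C * expi ((nu p - nu q) * t).
Proof.
rewrite conj_real_expi; have -> : (nu p - nu q) * t = nu p * t + - (nu q * t) by ring.
by rewrite expiD /pair_profile realCM; move: (_%:C) (_%:C) (expi _) (expi _) => u v y z; ring.
Qed.

Definition bohr_gram (r : P * P) : 'M[C]_m := (a r.2) ^t* *m a r.1.

Lemma jump_time_gram w t :
  (jump_time kappa H A w t) ^t* *m jump_time kappa H A w t =
  \sum_(r : P * P) ((pair_profile kappa (nu r.1) (nu r.2) w)%:C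
     * expi ((nu r.1 - nu r.2) * t)) *: bohr_gram r.
Proof.
rewrite jump_time_bohr.
have := adj_mul_sumZ (fun p => (jump_profile kappa (w - nu p))%:C * expi (nu p * t)) a 1%:M 1%:M.
rewrite !mulmx1 => ->; apply: eq_bigr => r _.
by rewrite conj_profile_mul !mulmx1.
Qed.

Definition bohr_tan (r : P * P) : R :=
  2^-1 * (sinh (beta * (nu r.1 - nu r.2) / 4) / cosh (beta * (nu r.1 - nu r.2) / 4)).

Definition bohr_rate (r : P * P) : R :=
  expR (- (beta * (nu r.1 + nu r.2) / 4)) * pair_weight beta kappa (nu r.1) (nu r.2).

(** The cosine transform of [c] is zero at each cutoff, so only the sine survives; this is where the
    purely imaginary coefficient comes from. *)
Lemma coherent_term_pv w :
  pvmxintegral (fun t =>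
    (transition_weight beta kappa w * coherent_kernel beta t)%:C *:
      ((jump_time kappa H A w t) ^t* *m jump_time kappa H A w t)) =
  \sum_(r : P * P) ((0 +i* (pair_profile kappa (nu r.1) (nu r.2) w
     * transition_weight beta kappa w)) * (bohr_tan r)%:C) *: bohr_gram r.
Proof.
pose g r := pair_profile kappa (nu r.1) (nu r.2) w * transition_weight beta kappa w.
pose x (r : P * P) := nu r.1 - nu r.2.
pose phi r t := (g r)%:C * ((coherent_kernel beta t)%:C * expi (x r * t)).
apply: (pvmxintegral_sum (S := fun r e =>
  \int[mu]_(t in [set t : R | e < `|t|]) (coherent_kernel beta t * sin (x r * t)))); last first.
  by move=> r; exact: coherent_kernel_sin.
move=> e e0; have mD := measurable_cut e.
have phi_int r : cintegrable [set t : R | e < `|t|]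
    (fun t => (coherent_kernel beta t)%:C * expi (x r * t)).
  apply: cintegrable_expi => //; apply: integrable_cut_kernel => //.
  - exact/continuous_scale/continuous_cos.
  - by move=> t; exact: cos_max.
  - exact/continuous_scale/continuous_sin.
  - by move=> t; rewrite ler_norml sin_geN1 sin_le1.
rewrite (mxintegral_sum mD (phi := phi) (B := bohr_gram)) => [||t _].
- apply: eq_bigr => r _; congr (_ *: _).
  rewrite /phi cintegralZl// cintegral_expi coherent_kernel_cos//.
  by apply: complex_ext; rewrite ?ReM ?ImM /= /g /x; ring.
- by move=> r; exact: cintegrableZl.
- rewrite jump_time_gram scaler_sumr; apply: eq_bigr => r _.
  rewrite scalerA; congr (_ *: _).
  by rewrite /phi /g !realCM; ring.
Qed.

Lemma coherent_term_bohr : coherent_term beta kappa H A =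
  \sum_(r : P * P) ((0 +i* bohr_rate r) * (bohr_tan r)%:C) *: bohr_gram r.
Proof.
rewrite /coherent_term.
pose g r w := pair_profile kappa (nu r.1) (nu r.2) w * transition_weight beta kappa w.
pose phi r w : C := ((0 +i* 1) * (bohr_tan r)%:C) * (g r w)%:C.
have gi r : mu.-integrable setT (EFin \o g r) /\ \int[mu]_w g r w = bohr_rate r.
  exact: transition_weight_integral.
have phi_int r : cintegrable setT (fun w => (g r w)%:C).
  by apply: cintegrable_real => //; exact: (gi r).1.
rewrite (mxintegral_sum measurableT (phi := phi) (B := bohr_gram)) => [||w _].
- apply: eq_bigr => r _; congr (_ *: _).
  rewrite /phi (cintegralZl measurableT _ (phi_int r)) (cintegral_real measurableT).
  transitivity ((0 +i* 1) * (bohr_tan r)%:C * (bohr_rate r)%:C).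
    by congr (_ * _%:C); exact: (gi r).2.
  by apply: complex_ext; rewrite ?ReM ?ImM /= /bohr_rate; ring.
- by move=> r; exact: (cintegrableZl measurableT _ (phi_int r)).
- rewrite coherent_term_pv; apply: eq_bigr => r _; congr (_ *: _).
  by apply: complex_ext; rewrite ?ReM ?ImM /= /g; ring.
Qed.

(** The [-i] of the commutator cancels the [i] of the sine transform, and both parts carry the same
    integrated rate. The coherent term thus becomes a real multiple that merges with the dissipator,
    pair by pair. *)
Lemma lindbladian_bohr X : lindbladian beta kappa H A X =
  \sum_(r : P * P) (bohr_rate r)%:C *:
    ((bohr_tan r)%:C *: (bohr_gram r *m X - X *m bohr_gram r)
     + (a r.1 *m X *m (a r.2) ^t* - 2^-1 *: (bohr_gram r *m X + X *m bohr_gram r))).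
Proof.
rewrite /lindbladian coherent_term_bohr /commx comm_sumZ.
pose g r w := pair_profile kappa (nu r.1) (nu r.2) w * transition_weight beta kappa w.
have gi r : mu.-integrable setT (EFin \o g r) /\ \int[mu]_w g r w = bohr_rate r.
  exact: transition_weight_integral.
pose B (r : P * P) := a r.1 *m X *m (a r.2) ^t* - 2^-1 *: (bohr_gram r *m X + X *m bohr_gram r).
rewrite (mxintegral_sum measurableT (phi := fun r w => (g r w)%:C) (B := B)) => [||w _].
- rewrite scaler_sumr -big_split; apply: eq_bigr => r _ /=.
  have -> : cintegral setT (fun w => (g r w)%:C) = (bohr_rate r)%:C.
    by rewrite (cintegral_real measurableT); congr (_%:C); exact: (gi r).2.
  apply: scaler_collect.
  by apply: complex_ext; rewrite ?ReM ?ImM /=; ring.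
- by move=> r; apply: cintegrable_real => //; exact: (gi r).1.
- have jE := jump_freq_bohr w.
  pose phi (p : P) : C := (jump_profile kappa (w - nu p))%:C.
  have phiE (r : P * P) : (((phi r.2)^*)%R * phi r.1 = (pair_profile kappa (nu r.1) (nu r.2) w)%:C).
    have := conj_profile_mul r.1 r.2 w 0.
    by rewrite !mulr0 expi0 !mulr1.
  have E1 := sumZ_mul_adj phi a X.
  have E2 := adj_mul_sumZ phi a 1%:M 1%:M.
  rewrite !mulmx1 in E2.
  rewrite jE E1 E2 /acommx acomm_sumZ scaler_sumr -sumrB scaler_sumr.
  apply: eq_bigr => r _; rewrite phiE !mulmx1 /B /g scalerA realCM.
  rewrite [in RHS]mulrC -[RHS]scalerA; congr (_ *: _).
  by rewrite scalerBr mulrC scalerA.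
Qed.

End bohr_expansion.

(** * The integral over time, frequency and [s] *)

Section triple_integral.
Context {R : realType} (beta kappa : R) (K : finType) (c : K -> R[i]) (la x y : K -> R).
Hypotheses (beta0 : 0 < beta) (kappa0 : 0 < kappa).
Local Notation C := R[i].
Local Notation mu := (@lebesgue_measure R).

(** [N] is known only through its complex expansion; taking real parts exhibits it as a finite sum
    of measurable real terms. *)
Lemma measurable_complex_sum d (T : measurableType d) (u v : K -> T -> R) (N : T -> R) :
  (forall k, measurable_fun setT (u k)) -> (forall k, measurable_fun setT (v k)) ->
  (forall z, (N z)%:C = \sum_k c k * (u k z)%:C * expi (v k z)) ->
  measurable_fun setT N.
Proof.
move=> mu_ mv NE.
have -> : N = fun z => \sum_k (u k z * (complex.Re (c k) * cos (v k z)
    - complex.Im (c k) * sin (v k z))).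
  apply/funext => z; rewrite -[LHS]/(complex.Re (N z)%:C) NE Re_sum; apply: eq_bigr => k _.
  by rewrite !ReM ?ImM /=; ring.
apply: measurable_sum => k; apply: measurable_funM => //.
apply: measurable_funB; apply: measurable_funM => //.
- by apply: measurableT_comp => //; apply: continuous_measurable_fun; exact: continuous_cos.
- by apply: measurableT_comp => //; apply: continuous_measurable_fun; exact: continuous_sin.
Qed.

Lemma measurable_filter_gs d (T : measurableType d) (s t : T -> R) :
  measurable_fun setT s -> measurable_fun setT t ->
  measurable_fun setT (fun z => filter_gs beta (s z) (t z)).
Proof.
move=> ms mt.
have mcos : measurable_fun setT (@cos R) by apply: continuous_measurable_fun; exact: continuous_cos.
have mcosh : measurable_fun setT (@cosh R) by apply: continuous_measurable_fun; exact: continuous_cosh.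
apply: measurable_funM => //; apply: measurable_funM.
  apply: measurable_funM; apply: measurableT_comp => //; apply: measurable_funM => //.
  exact: measurable_funM.
apply: (measurable_fun_inv (f := fun z => cosh (4 * pi * t z / beta) + cos (2 * s z * pi))).
apply: measurable_funD; apply: measurableT_comp => //; apply: measurable_funM => //.
- exact: measurable_funM.
- exact: measurable_funM.
Qed.

Lemma measurable_filter_hs d (T : measurableType d) (s w : T -> R) :
  measurable_fun setT s -> measurable_fun setT w ->
  measurable_fun setT (fun z => filter_hs beta kappa (s z) (w z)).
Proof.
move=> ms mw; apply: measurable_funM.
  apply: measurableT_comp => //; apply: measurable_funM => //.
  apply: measurable_funM; first exact: measurable_funM.
  apply: measurable_funB; first exact: measurable_funM.
  by apply: measurable_funM => //; apply: measurable_funM.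
apply: (measurableT_comp (measurable_filter_h beta kappa)).
apply: measurable_funB => //.
by apply: measurable_funM => //; apply: measurable_funM.
Qed.

Lemma filter_hs_ge0 s w : 0 <= filter_hs beta kappa s w.
Proof. by rewrite mulr_ge0 ?expR_ge0// filter_h_ge0. Qed.

Let halfD : set (measurableTypeR R) := `](- 2^-1), 2^-1[%classic.

Definition half_integral (z : R) : R := \int[mu]_(s in halfD) expR (s * z).

Definition pair_sech (k : K) : R :=
  pair_weight beta kappa (x k) (y k) / (4 * cosh (beta * (x k - y k) / 4)).

(** Two exchanges move [s] outside. The frequency integral yields [e^(s beta (x + y) / 2)], the time
    integral [cosh (s beta (x - y) / 2)]; their product is half of [e^(s beta x) + e^(s beta y)],
    which explains the two half integrals and the 4 in [pair_sech]. *)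
Lemma triple_integral (N : R -> R -> R -> R) :
  (forall w t s, 0 <= N w t s) ->
  (forall w t s, (N w t s)%:C = \sum_k c k *
     (pair_profile kappa (x k) (y k) w * expR (s * la k))%:C * expi ((x k - y k) * t)) ->
  let S := \sum_k c k * (pair_sech k *
     (half_integral (la k + beta * x k) + half_integral (la k + beta * y k)))%:C in
  (\int[mu]_t \int[mu]_w \int[mu]_(s in `](- 2^-1)%R, (2^-1)%R[)
     (N w t s * filter_hs beta kappa s w * filter_gs beta s t)%:E = (complex.Re S)%:E)%E
  /\ (complex.Re S)%:C = S.
Proof.
move=> N0 NE S.
have mD : measurable halfD by exact: measurable_itv.
have halfP s : halfD s -> - 2^-1 < s < 2^-1 by rewrite /halfD /= in_itv.
pose fM t s : C := \sum_k (c k * expi ((x k - y k) * t) * (expR (s * la k) * filter_gs beta s t)%:C)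
  * (expR (s * beta * (x k + y k) / 2) * pair_weight beta kappa (x k) (y k))%:C.
have stepw t s : halfD s ->
    (\int[mu]_w (N w t s * filter_hs beta kappa s w * filter_gs beta s t)%:E
      = (complex.Re (fM t s))%:E)%E /\ (complex.Re (fM t s))%:C = fM t s.
  move=> Ds.
  pose f k w : C := (c k * expi ((x k - y k) * t) * (expR (s * la k) * filter_gs beta s t)%:C)
    * (pair_profile kappa (x k) (y k) w * filter_hs beta kappa s w)%:C.
  have hi k := filter_hs_integral beta0 kappa0 (x k) (y k) s.
  have fi0 k : cintegrable setT (fun w => (pair_profile kappa (x k) (y k) w * filter_hs beta kappa s w)%:C).
    by apply: cintegrable_real => //; exact: (hi k).1.
  have fi k : cintegrable setT (f k) by exact: (cintegrableZl measurableT _ (fi0 k)).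
  have fS := cintegrable_sum measurableT (index_enum K) fi.
  have SE : cintegral setT (fun w => \sum_k f k w) = fM t s.
    rewrite (cintegral_sum measurableT)//; apply: eq_bigr => k _.
    rewrite (cintegralZl measurableT _ (fi0 k)); congr (_ * _).
    by rewrite (cintegral_real measurableT); congr (_%:C); exact: (hi k).2.
  rewrite -SE; apply: (integral_of_complex measurableT _ fS) => w _.
  rewrite realCM realCM NE !mulr_suml; apply: eq_bigr => k _; rewrite /f !realCM.
  by ring.
pose M t s : R := complex.Re (fM t s).
pose fQ s : C := \sum_k (c k * (pair_sech k)%:C)
  * (expR (s * (la k + beta * x k)) + expR (s * (la k + beta * y k)))%:C.
have stept s : halfD s ->
    (\int[mu]_t (M t s)%:E = (complex.Re (fQ s))%:E)%E /\ (complex.Re (fQ s))%:C = fQ s.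
  move=> Ds.
  pose e k : R := expR (s * la k) * (expR (s * beta * (x k + y k) / 2)
    * pair_weight beta kappa (x k) (y k)).
  pose f k t : C := (c k * (e k)%:C) * ((filter_gs beta s t)%:C * expi ((x k - y k) * t)).
  have fi0 k : cintegrable setT (fun t => (filter_gs beta s t)%:C * expi ((x k - y k) * t)).
    have [g1 g2] := integrable_filter_gs beta0 (x k - y k) (halfP _ Ds).
    exact: cintegrable_expi.
  have fi k : cintegrable setT (f k) by exact: (cintegrableZl measurableT _ (fi0 k)).
  have fS := cintegrable_sum measurableT (index_enum K) fi.
  have SE : cintegral setT (fun t => \sum_k f k t) = fQ s.
    rewrite (cintegral_sum measurableT)//; apply: eq_bigr => k _.
    rewrite (cintegralZl measurableT _ (fi0 k)) cintegral_expi.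
    have [-> ->] := filter_gs_transform beta0 (x k - y k) (halfP _ Ds).
    rewrite -mulrA -[in RHS]mulrA -realCM; congr (_ * _); rewrite -[_ +i* 0]/(_%:C) -realCM.
    congr (_%:C).
    rewrite /e /pair_sech.
    have -> : expR (s * (la k + beta * x k)) = expR (s * la k) *
        (expR (s * beta * (x k + y k) / 2) * expR (s * (beta * (x k - y k) / 2))).
      by rewrite -!expRD; congr expR; field.
    have -> : expR (s * (la k + beta * y k)) = expR (s * la k) *
        (expR (s * beta * (x k + y k) / 2) * expR (- (s * (beta * (x k - y k) / 2)))).
      by rewrite -!expRD; congr expR; field.
    have := cosh_gt0 (beta * (x k - y k) / 4); move: (cosh _) => ch ch0.
    rewrite /cosh; move: (expR _) (expR _) (expR _) (expR _) (pair_weight _ _ _ _) => z1 z2 z3 z4 z5.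
    by field; rewrite gt_eqF.
  rewrite -SE; apply: (integral_of_complex measurableT _ fS) => t _.
  rewrite (stepw t s Ds).2 /fM; apply: eq_bigr => k _; rewrite /f /e !realCM; ring.
have [steps1 steps2] : (\int[mu]_(s in halfD) (complex.Re (fQ s))%:E = (complex.Re S)%:E)%E /\
    (complex.Re S)%:C = S.
  pose f k s : C := (c k * (pair_sech k)%:C)
    * (expR (s * (la k + beta * x k)) + expR (s * (la k + beta * y k)))%:C.
  have ei k : mu.-integrable halfD (EFin \o
      (fun s => expR (s * (la k + beta * x k)) + expR (s * (la k + beta * y k)))).
    apply: eq_integrable (integrableD mD (integrable_half_expR (la k + beta * x k))
      (integrable_half_expR (la k + beta * y k))) => //.
  have fi0 k : cintegrable halfD (fun s =>
      (expR (s * (la k + beta * x k)) + expR (s * (la k + beta * y k)))%:C).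
    by apply: cintegrable_real; exact: ei.
  have fi k : cintegrable halfD (f k) by exact: (cintegrableZl mD _ (fi0 k)).
  have fS := cintegrable_sum mD (index_enum K) fi.
  have SE : cintegral halfD (fun s => \sum_k f k s) = S.
    rewrite (cintegral_sum mD)//; apply: eq_bigr => k _.
    rewrite (cintegralZl mD _ (fi0 k)) -mulrA; congr (_ * _).
    rewrite (cintegral_real mD) -realCM; congr ((_ * _)%:C).
    by rewrite RintegralD//; exact: integrable_half_expR.
  rewrite -SE; apply: (integral_of_complex mD _ fS) => s Ds.
  by rewrite (stept s Ds).2.
have G0 w t s : halfD s -> 0 <= N w t s * filter_hs beta kappa s w * filter_gs beta s t.
  move=> Ds; apply: mulr_ge0; last by apply: filter_gs_ge0 => //; exact: halfP.
  by apply: mulr_ge0; [exact: N0|exact: filter_hs_ge0].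
split; last exact: steps2.
transitivity (\int[mu]_t \int[mu]_(s in halfD) (M t s)%:E)%E.
  apply: eq_integral => t _.
  rewrite (tonelli_swap (D := halfD) (G := fun w s => N w t s * filter_hs beta kappa s w * filter_gs beta s t) mD).
  - by apply: eq_integral => s /set_mem Ds; exact: (stepw t s Ds).1.
  - apply: measurable_funM; last first.
      by apply: measurable_filter_gs => //; exact: measurable_snd.
    apply: measurable_funM; last first.
      by apply: measurable_filter_hs; [exact: measurable_snd|exact: measurable_fst].
    apply: (@measurable_complex_sum _ (measurableTypeR R * measurableTypeR R)%type
      (fun k z => pair_profile kappa (x k) (y k) z.1 * expR (z.2 * la k))
      (fun k z => (x k - y k) * t) (fun z => N z.1 t z.2)) => [k|k|z].
    + apply: measurable_funM.
        apply: (measurableT_comp _ measurable_fst); apply: continuous_measurable_fun.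
        exact: continuous_pair_profile.
      apply: measurableT_comp => //; apply: measurable_funM => //; exact: measurable_snd.
    + exact: measurable_cst.
    + exact: NE.
  - by move=> w s Ds; exact: G0.
have M0 t s : halfD s -> 0 <= M t s.
  move=> Ds; rewrite -lee_fin -(stepw t s Ds).1; apply: integral_ge0 => w _.
  by rewrite lee_fin; exact: G0.
(* An explicit real form of [M], from which joint measurability in [t] and [s] can be read off for
   the second exchange. *)
pose M' t s : R := \sum_k (expR (s * la k) * filter_gs beta s t * 
   (expR (s * beta * (x k + y k) / 2) * pair_weight beta kappa (x k) (y k))) *
   (complex.Re (c k) * cos ((x k - y k) * t) - complex.Im (c k) * sin ((x k - y k) * t)).
have MM' : M = M'.
  apply/funext => t; apply/funext => s; rewrite /M /fM Re_sum; apply: eq_bigr => k _.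
  by rewrite !(ReM, ImM) /=; ring.
rewrite (tonelli_swap mD _ (fun t s => M0 t s)).
  rewrite -steps1; apply: eq_integral => s /set_mem Ds; exact: (stept s Ds).1.
rewrite MM'; apply: measurable_sum => k; apply: measurable_funM.
- apply: measurable_funM; first apply: measurable_funM.
  + by apply: measurableT_comp => //; apply: measurable_funM => //; exact: measurable_snd.
  + by apply: measurable_filter_gs; [exact: measurable_snd|exact: measurable_fst].
  + apply: measurable_funM => //; apply: measurableT_comp => //.
    apply: measurable_funM => //; apply: measurable_funM => //; apply: measurable_funM => //; exact: measurable_snd.
- apply: measurable_funB; apply: measurable_funM => //.
  + apply: (measurableT_comp (f := fun t => cos ((x k - y k) * t)) _ measurable_fst).
    by apply: continuous_measurable_fun; apply: continuous_scale; exact: continuous_cos.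
  + apply: (measurableT_comp (f := fun t => sin ((x k - y k) * t)) _ measurable_fst).
    by apply: continuous_measurable_fun; apply: continuous_scale; exact: continuous_sin.
Qed.

End triple_integral.

(** * Fisher information and entropy production in the eigenbasis of the state *)

Section modular_expansion.
Context {R : realType} {m : nat} (beta kappa c : R) (H A V W : 'M[R[i]]_m) (d x : 'I_m -> R).
Hypotheses (beta0 : 0 < beta) (kappa0 : 0 < kappa).
Hypotheses (Vu : V \is unitarymx) (Wu : W \is unitarymx) (x0 : forall i, 0 < x i).
Hypothesis HE : forall f : R -> R[i], hermfun f H = ufun V (fun i => f (d i)).
Local Notation C := R[i].
Local Notation P := ('I_m * 'I_m)%type.
Local Notation nu := (bohr_freq d).
Local Notation a := (bohr V A).
Local Notation al p := (ubasis W (a p)).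
Local Notation sigma := (ufun W (fun i => (x i)%:C)).

Hypothesis SE : forall f : R -> R[i], hermfun f sigma = ufun W (fun i => f (x i)).

Let D : 'M[C]_m := ufun W (fun i => (ln (x i))%:C) - ufun V (fun i => (c - beta * d i)%:C).

Definition bohr_force (p : P) : 'M[C]_m := a p *m D - D *m a p.
Local Notation B := bohr_force.

Definition log_ratio (ij : P) : R := ln (x ij.1) - ln (x ij.2).

(** The [log sigma] part of the commutator acts diagonally on entries in the basis [W], the
    [log rho] part on Bohr components. The entry of a single component is therefore merely rescaled,
    although the two bases are unrelated. *)
Lemma ubasis_force p i j :
  ubasis W (B p) i j = (- (log_ratio (i, j) + beta * nu p))%:C * al p i j.
Proof.
pose L := ufun W (fun i => (ln (x i))%:C); pose M := ufun V (fun i => (c - beta * d i)%:C).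
have -> : B p = (-1) *: (L *m a p - a p *m L) + (M *m a p - a p *m M).
  rewrite /B /D mulmxBr mulmxBl scaleN1r -/L -/M; move: (_ *m L) (_ *m M) (L *m _) (M *m _).
  by move=> y1 y2 y3 y4; rewrite !opprB addrACA [in RHS]addrACA [- y2 - y3]addrC.
have e1 : M *m a p - a p *m M = ((c - beta * d p.1)%:C - (c - beta * d p.2)%:C) *: a p.
  exact: (ufun_comm_bohr Vu).
have e2 : ubasis W (L *m a p - a p *m L) i j = ((ln (x i))%:C - (ln (x j))%:C) * al p i j.
  exact: (ubasis_comm Wu).
rewrite e1; move: (_ - _) e2 => Y e2.
rewrite ubasisD !ubasisZ mxE [X in X + _]mxE [X in _ + X]mxE e2 mulrA -mulrDl; congr (_ * _).
by apply: complex_ext; rewrite !(ReM, ImM, ReD, ImD) /= /log_ratio /bohr_freq /=; ring.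
Qed.

Let coef (k : (P * P) * P) : C :=
  ((ubasis W (B k.1.2) k.2.1 k.2.2)^*)%R * ubasis W (B k.1.1) k.2.1 k.2.2
  * (expR ((ln (x k.2.1) + ln (x k.2.2)) / 2))%:C.

Lemma powR_expR s i j : x i `^ (2^-1 + s) * x j `^ (2^-1 - s) =
  expR ((ln (x i) + ln (x j)) / 2) * expR (s * log_ratio (i, j)).
Proof.
by rewrite /powR !gt_eqF ?x0// -!expRD /log_ratio /=; congr expR; field.
Qed.

Lemma weight_rearrange (z b1 b2 y1 y2 y3 : C) (g r : R) : y1 * y2 = y3 * r%:C ->
  g%:C * z * (b1 * y1 * b2 * y2) = b1 * b2 * y3 * (g * r)%:C * z.
Proof.
move=> e; rewrite realCM; transitivity (y1 * y2 * (b1 * b2 * g%:C * z)); first by ring.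
by rewrite e; ring.
Qed.

(** This is the input format of [triple_integral]; an index combines a pair of Bohr components with
    a matrix position in the basis [W]. *)
Lemma normsq_bohr w t s :
  (weighted_normsq sigma s (commx (jump_time kappa H A w t) D))%:C =
  \sum_(k : (P * P) * P) coef k *
    (pair_profile kappa (nu k.1.1) (nu k.1.2) w * expR (s * log_ratio k.2))%:C
    * expi ((nu k.1.1 - nu k.1.2) * t).
Proof.
rewrite -(weighted_innerE sigma s _).1 /weighted_inner /commx.
rewrite (jump_time_bohr A kappa0 Vu HE) comm_sumZ -/B tr_adj_sumZ.
rewrite -(pair_bigA _ (fun (r : P * P) (ij : P) => coef (r, ij) *
    (pair_profile kappa (nu r.1) (nu r.2) w * expR (s * log_ratio ij))%:C
    * expi ((nu r.1 - nu r.2) * t)))/=.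
apply: eq_bigr => r _; rewrite conj_profile_mul /powmx !SE tr_sandwich_ufun//.
rewrite (pair_bigA _ (fun i j => ((ubasis W (B r.2) i j)^*)%R * (x i `^ (2^-1 + s))%:C
  * ubasis W (B r.1) i j * (x j `^ (2^-1 - s))%:C)) mulr_sumr.
apply: eq_bigr => -[i j] _ /=; rewrite /coef /=.
apply: weight_rearrange; have := congr1 (fun z : R => z%:C : C) (powR_expR s i j).
by rewrite [LHS]realCM [RHS]realCM.
Qed.

Local Notation gm i j := (expR ((ln (x i) + ln (x j)) / 2)).

(** The geometric mean of [x i] and [x j] meets the endpoint exponentials at [s = 1/2] and
    [s = -1/2], leaving [x i] and [x j] themselves; this removes every power of the state. *)
Lemma modular_weight z i j :
  (log_ratio (i, j) + z) * (gm i j * half_integral (log_ratio (i, j) + z)) =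
  expR (z / 2) * x i - expR (- (z / 2)) * x j.
Proof.
rewrite mulrCA /half_integral Rintegral_half_expR mulrBr -!expRD.
by rewrite -[x i in RHS]lnK ?posrE// -[x j in RHS]lnK ?posrE// -!expRD /log_ratio/=;
  congr (expR _ - expR _); field.
Qed.

Lemma tr_modular (X Y : 'M[C]_m) z :
  \sum_(ij : P) ((ubasis W X ij.1 ij.2)^*)%R * ubasis W Y ij.1 ij.2 *
    ((log_ratio ij + z) * (gm ij.1 ij.2 * half_integral (log_ratio ij + z)))%:C =
  (expR (z / 2))%:C * \tr (X ^t* *m sigma *m Y) - (expR (- (z / 2)))%:C * \tr (X ^t* *m Y *m sigma).
Proof.
rewrite tr_ufun_left// tr_ufun_right// !pair_bigA/= !mulr_sumr -sumrB.
apply: eq_bigr => -[i j] _ /=; rewrite modular_weight.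
have -> : (expR (z / 2) * x i - expR (- (z / 2)) * x j)%:C =
    (expR (z / 2))%:C * (x i)%:C - (expR (- (z / 2)))%:C * (x j)%:C :> C.
  by apply: complex_ext; rewrite !(ReM, ImM, ReD, ImD) /=; ring.
by move: (_%:C) (_%:C) (_%:C) (_%:C) (ubasis W X i j) (ubasis W Y i j) => y1 y2 y3 y4 b1 b2; ring.
Qed.

Definition bohr_boost (p : P) : C := (expR (beta * nu p / 4))%:C.
Local Notation u := bohr_boost.

Let boost2 p : u p ^+ 2 = (expR (beta * nu p / 2))%:C.
Proof. by rewrite /u expr2 -realCM -expRD; congr (expR _)%:C; field. Qed.

Let boost2N p : u p ^- 2 = (expR (- (beta * nu p / 2)))%:C.
Proof. by rewrite boost2 expRN fmorphV. Qed.

(** Two commutator factors are available and each half integral consumes one: the integral with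
    [nu_p] takes [y] from the entry of [B p], the one with [nu_q] takes [y'] from that of [B q]. The
    other commutator stays. *)
Lemma force_rearrange (bp bq ap aq : C) (y y' g i i' : R) :
  bp = (- y)%:C * ap -> bq = (- y')%:C * aq ->
  bq * bp * (g * (i + i'))%:C =
  - (bq * ap * (y * (g * i))%:C) - (aq * bp * (y' * (g * i'))%:C).
Proof.
move=> -> ->.
have -> : (g * (i + i'))%:C = g%:C * i%:C + g%:C * i'%:C :> C.
  by apply: complex_ext; rewrite !(ReM, ImM, ReD, ImD) /=; ring.
have realCN (r : R) : (- r)%:C = - r%:C :> C by apply: complex_ext; rewrite /= ?oppr0.
by rewrite !realCN !realCM; ring.
Qed.

Lemma fisher_bohr p q :
  \sum_(ij : P) ((ubasis W (B q) ij.1 ij.2)^*)%R * ubasis W (B p) ij.1 ij.2 *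
    (gm ij.1 ij.2 * (half_integral (log_ratio ij + beta * nu p)
       + half_integral (log_ratio ij + beta * nu q)))%:C =
  bohr_fisher a sigma D u p q.
Proof.
have -> : bohr_fisher a sigma D u p q =
  - (u p ^+ 2 * \tr ((B q) ^t* *m sigma *m a p) - u p ^- 2 * \tr ((B q) ^t* *m a p *m sigma))
  - (u q ^+ 2 * \tr ((a q) ^t* *m sigma *m B p) - u q ^- 2 * \tr ((a q) ^t* *m B p *m sigma)).
  by [].
pose F1 (ij : P) : C := ((ubasis W (B q) ij.1 ij.2)^*)%R * al p ij.1 ij.2 *
  ((log_ratio ij + beta * nu p) * (gm ij.1 ij.2 * half_integral (log_ratio ij + beta * nu p)))%:C.
pose F2 (ij : P) : C := ((al q ij.1 ij.2)^*)%R * ubasis W (B p) ij.1 ij.2 *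
  ((log_ratio ij + beta * nu q) * (gm ij.1 ij.2 * half_integral (log_ratio ij + beta * nu q)))%:C.
transitivity (- (\sum_ij F1 ij) - \sum_ij F2 ij); last first.
  rewrite (boost2N p) (boost2N q) (boost2 p) (boost2 q).
  by congr (- _ - _); exact: tr_modular.
rewrite -!sumrN -big_split; apply: eq_bigr => -[i j] _ /=.
apply: force_rearrange; first exact: ubasis_force.
by rewrite ubasis_force rmorphM; congr (_ * _); exact: conjc_real.
Qed.

Definition bohr_weight (r : P * P) : R :=
  pair_weight beta kappa (nu r.1) (nu r.2) / (4 * cosh (beta * (nu r.1 - nu r.2) / 4)).

Lemma weight_assoc (b1 b2 : C) (g w i : R) :
  b1 * b2 * g%:C * (w * i)%:C = w%:C * (b1 * b2 * (g * i)%:C).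
Proof. by rewrite !realCM; ring. Qed.

Lemma fisher_integral_bohr :
  let S := \sum_(r : P * P) (bohr_weight r)%:C * bohr_fisher a sigma D u r.1 r.2 in
  (\int[@lebesgue_measure R]_t \int[@lebesgue_measure R]_w
     \int[@lebesgue_measure R]_(s in `](- 2^-1)%R, (2^-1)%R[)
       (weighted_normsq sigma s (commx (jump_time kappa H A w t) D)
        * filter_hs beta kappa s w * filter_gs beta s t)%:E = (complex.Re S)%:E)%E
  /\ (complex.Re S)%:C = S.
Proof.
move=> S.
have := triple_integral beta0 kappa0
  (fun w t s => (weighted_innerE sigma s (commx (jump_time kappa H A w t) D)).2) normsq_bohr.
set S0 := (X in let S0 := X in _).
have -> : S0 = S; last by [].
rewrite /S0 -(pair_bigA _ (fun (r : P * P) (ij : P) => coef (r, ij) * (bohr_weight r *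
  (half_integral (log_ratio ij + beta * nu r.1)
   + half_integral (log_ratio ij + beta * nu r.2)))%:C))/=.
apply: eq_bigr => r _; rewrite -fisher_bohr mulr_sumr; apply: eq_bigr => ij _.
exact: weight_assoc.
Qed.

(** Here and in [boost_sech] the common factor [e^(beta (z1 + z2) / 4)] cancels. *)
Lemma boost_tanh z1 z2 :
  (expR (beta * z1 / 2) - expR (beta * z2 / 2)) / (expR (beta * z1 / 2) + expR (beta * z2 / 2)) =
  sinh (beta * (z1 - z2) / 4) / cosh (beta * (z1 - z2) / 4).
Proof.
have -> : beta * z1 / 2 = beta * (z1 + z2) / 4 + beta * (z1 - z2) / 4 by field.
have -> : beta * z2 / 2 = beta * (z1 + z2) / 4 - beta * (z1 - z2) / 4 by field.
rewrite !expRD /sinh /cosh; have := expR_gt0 (beta * (z1 + z2) / 4).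
have := expR_gt0 (beta * (z1 - z2) / 4); have := expR_gt0 (- (beta * (z1 - z2) / 4)).
move: (expR _) (expR _) (expR _) => a1 a2 a3 h1 h2 h3.
by field; rewrite -mulrDr !gt_eqF ?mulr_gt0 ?addr_gt0.
Qed.

Lemma boost_sech z1 z2 :
  2^-1 * (expR (beta * z1 / 4) * expR (beta * z2 / 4)
     / (expR (beta * z1 / 2) + expR (beta * z2 / 2))) =
  (4 * cosh (beta * (z1 - z2) / 4))^-1.
Proof.
rewrite -expRD; have -> : beta * z1 / 4 + beta * z2 / 4 = beta * (z1 + z2) / 4 by field.
have -> : beta * z1 / 2 = beta * (z1 + z2) / 4 + beta * (z1 - z2) / 4 by field.
have -> : beta * z2 / 2 = beta * (z1 + z2) / 4 - beta * (z1 - z2) / 4 by field.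
rewrite !expRD /cosh; have := expR_gt0 (beta * (z1 + z2) / 4).
have := expR_gt0 (beta * (z1 - z2) / 4); have := expR_gt0 (- (beta * (z1 - z2) / 4)).
move: (expR _) (expR _) (expR _) => a1 a2 a3 h1 h2 h3.
by field; rewrite -mulrDr !gt_eqF ?mulr_gt0 ?addr_gt0.
Qed.

(** Instantiates the algebraic identity with [sw] reversing a pair of eigenvectors: it negates [nu],
    hence inverts [u], and by hermiticity of [A] it implements the adjoint of components. *)
Lemma entropy_bohr : A ^t* = A -> 
  - \tr (lindbladian beta kappa H A sigma *m D) =
  \sum_(r : P * P) (bohr_weight r)%:C * bohr_fisher a sigma D u r.1 r.2.
Proof.
move=> Ah; pose sw (p : P) := (p.2, p.1).
pose eta p q : C := (pair_weight beta kappa (nu p) (nu q))%:C.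
have nu_sw p : nu (sw p) = - nu p by rewrite /bohr_freq opprB.
have DD : D ^t* = D.
  rewrite /D; apply: etrans (adjmxB _ _) _; congr (_ - _); apply: ufun_self_adj => i; exact: conjc_real.
have eR (r : R) : 0 < r -> r%:C != 0 :> C.
  by move=> r0; rewrite -[0]/(0%:C) (inj_eq (@complexI R)) gt_eqF.
have tanhE (r : P * P) : 2^-1 * bohr_tanh u r.1 r.2 = (bohr_tan beta d r)%:C.
  rewrite /bohr_tanh !boost2 -realCB -realCD -realC_div// -realC_half -realCM /bohr_tan.
  by rewrite boost_tanh.
have rateE (r : P * P) : eta r.1 r.2 / (u r.1 * u r.2) = (bohr_rate beta kappa d r)%:C.
  rewrite /eta /u -realCM -realC_div// /bohr_rate -expRD -expRN mulrC.
  by congr (expR _ * _)%:C; field.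
have weightE (r : P * P) : eta r.1 r.2 * (2^-1 * bohr_sech u r.1 r.2) = (bohr_weight r)%:C.
  rewrite /eta /bohr_sech !boost2 /u -realCM -realCD -realC_div// -realC_half -!realCM /bohr_weight.
  by rewrite boost_sech.
have swK : involutive sw by case.
have u0 p : u p != 0 by exact/eR/expR_gt0.
have u_sw p : u (sw p) = (u p)^-1.
  by rewrite /u nu_sw -realC_inv -expRN; congr (expR _)%:C; field.
have uu0 p q : u p ^+ 2 + u q ^+ 2 != 0.
  by rewrite !boost2 -realCD; apply: eR; rewrite addr_gt0// expR_gt0.
have eta_sw p q : eta (sw q) (sw p) = eta p q by rewrite /eta !nu_sw pair_weight_opp.
have := bohr_entropy_identity sigma swK (fun p => bohr_adj V p Ah) DD u0 u_sw uu0 eta_sw.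
move=> E.
transitivity (- \sum_(r : P * P) eta r.1 r.2 / (u r.1 * u r.2) * \tr (bohr_generator a sigma u r.1 r.2 *m D)); last first.
  rewrite E; apply: eq_bigr => r _; rewrite weightE //.
congr (- _); rewrite (lindbladian_bohr A beta0 kappa0 Vu HE) mulmx_suml raddf_sum/=.
apply: eq_bigr => r _; apply: etrans (mxtrace_mulZl _ _ _) _; rewrite rateE.
by rewrite /bohr_generator tanhE.
Qed.

End modular_expansion.

(** The Fisher information is an extended real and [fine] sends infinite values to 0, so finiteness
    is stated alongside the equality. *)
Theorem theoremB1 (R : realType) (n : nat) (beta kappa : R)
    (H A sigma : 'M[R[i]]_(2 ^ n)) :
  0 < beta -> 0 < kappa <= beta^-1 ->
  H \is hermsymmx -> A \is hermsymmx ->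
  is_state sigma -> \rank sigma = (2 ^ n)%N ->
  let rho := gibbs beta H in
  let FI := fisher_information beta kappa H A sigma rho in
  FI \is a fin_num /\
  entropy_production (lindbladian beta kappa H A) rho sigma = (fine FI)%:C.
Proof.
move=> beta0 /andP[kappa0 _] Hh Ah st rk rho FI.
have [V [d [Vu HE Hd]]] := hermfun_spectral H.
have [W [x [Wu x0 sE SE]]] := state_spectral st rk.
have m0 : (0 < 2 ^ n)%N by rewrite expn_gt0.
have [c rhoE] := gibbs_log beta d m0 Vu; rewrite -(Hd Hh) -/rho in rhoE.
rewrite {}/FI {st rk}; move: sE SE => -> SE.
have sE : logmx _ = _ := SE (fun y => (ln y)%:C).
have [FIE SR] := fisher_integral_bohr c A beta0 kappa0 Vu Wu x0 HE SE.
rewrite /fisher_information /entropy_production sE rhoE FIE; split => //=.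
(* [SR] says that the complex Bohr sum is real, which turns the computed real part into the sum
   itself. *)
by rewrite SR; apply: entropy_bohr => //; exact: hermsymmx_adj.
Qed.
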